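(* Let $K$ be one of the fields $\mathbb{Q}$, $\mathbb{Q}(\sqrt{-1})$, $\mathbb{Q}(\sqrt{-2})$, and let $D$ be the discriminant of $K$. Then there exists a random variable $X$ taking values in $(0,\infty)$ such that for every $s\in\mathbb{C}$ the expectation $\mathbb{E}(X^s)$ is finite and $$\mathbb{E}(X^s)=|D|^{-s/2}\,\xi_K(s).$$
   Context: For a number field $K$ with $r_1$ real and $r_2$ complex embeddings, the Dedekind zeta function is $\zeta_K(s)=\prod_{\mathfrak p}(1-N(\mathfrak p)^{-s})^{-1}$ for $\mathrm{Re}(s)>1$ (product over nonzero prime ideals of $\mathcal{O}_K$, $N(\mathfrak p)=\#\mathcal O_K/\mathfrak p$). Set $\Gamma_{\mathbb R}(s)=\pi^{-s/2}\Gamma(s/2)$ and $\Gamma_{\mathbb C}(s)=(2\pi)^{1-s}\Gamma(s)$, and $Z_K(s)=\Gamma_{\mathbb R}(s)^{r_1}\Gamma_{\mathbb C}(s)^{r_2}\zeta_K(s)$, which extends meromorphically to $\mathbb C$ with only simple poles at $s=0,1$. Let $c_K=\frac{2^{r_1}(2\pi)^{r_2}hR}{w}$, where $h$ is the class number, $R$ the regulator and $w$ the number of roots of unity of $K$. The Dedekind xi function is $\xi_K(s)=c_K^{-1}s(s-1)|D|^{s/2}Z_K(s)$; it is entire, satisfies $\xi_K(s)=\xi_K(1-s)$ and $\xi_K(0)=\xi_K(1)=1$. *)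

(* Defs.v *)
From HB Require Import structures.
From mathcomp Require Import all_boot all_order all_algebra.
From mathcomp Require Import all_classical all_reals all_analysis.
From mathcomp Require Import complex.
Set Implicit Arguments. Unset Strict Implicit. Unset Printing Implicit Defensive.
Import Order.TTheory GRing.Theory Num.Theory.
Import numFieldNormedType.Exports.
Local Open Scope classical_set_scope.
Local Open Scope ring_scope.
Local Open Scope complex_scope.

Inductive qfield := FQ | FQi | FQsqrtm2.

Section Defs.
Variable R : realType.
Local Notation C := R[i].

Definition qgen (K : qfield) : C :=
  match K with
  | FQ => 0
  | FQi => 'i
  | FQsqrtm2 => (Num.sqrt (2 : R)) *i
  end.

Definition field_set (K : qfield) : set C :=
  [set z | exists a b : rat, z = ratr a + ratr b * qgen K].

Definition algebraic_integer (z : C) : Prop :=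
  exists p : {poly int}, p \is monic /\ (map_poly (fun n : int => n%:~R : C) p).[z] = 0.

Definition OK (K : qfield) : set C := [set z | field_set K z /\ algebraic_integer z].

Definition is_ideal (K : qfield) (I : set C) : Prop :=
  [/\ I `<=` OK K, I 0,
      (forall x y, I x -> I y -> I (x - y)) &
      (forall a x, OK K a -> I x -> I (a * x))].

Definition prime_ideal (K : qfield) (P : set C) : Prop :=
  [/\ is_ideal K P, (exists x, P x /\ x != 0), ~ P 1 &
      (forall x y, OK K x -> OK K y -> P (x * y) -> P x \/ P y)].

(* #(O_K / I) = n : there is a complete system of n distinct residues *)
Definition has_index (K : qfield) (I : set C) (n : nat) : Prop :=
  exists f : 'I_n -> C, (forall k, OK K (f k)) /\
    (forall x, OK K x -> exists! k, I (x - f k)).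

Definition ideal_norm (K : qfield) (I : set C) : nat :=
  xget 0%N [set n | has_index K I n].

Definition euler_partial (K : qfield) (s : R) (n : nat) : R :=
  \big[*%R/1%R]_(P \in [set P | prime_ideal K P /\ (ideal_norm K P <= n)%N])
     (1 - powR (ideal_norm K P)%:R (- s))^-1.

(* Dedekind zeta function for real s > 1 (Euler product) *)
Definition dedekind_zeta (K : qfield) (s : R) : R := limn (euler_partial K s).

(* Euler Gamma function for real s > 0 *)
Definition Gamma (s : R) : R :=
  Rintegral (@lebesgue_measure R) `]0, +oo[%classic
    (fun t => powR t (s - 1) * expR (- t)).

Definition GammaR (s : R) : R := powR pi (- s / 2) * Gamma (s / 2).
Definition GammaC (s : R) : R := powR (2 * pi) (1 - s) * Gamma s.

Definition r1 (K : qfield) : nat := match K with FQ => 1%N | _ => 0%N end.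
Definition r2 (K : qfield) : nat := match K with FQ => 0%N | _ => 1%N end.
Definition discr (K : qfield) : int :=
  match K with FQ => 1 | FQi => -4 | FQsqrtm2 => -8 end.
Definition class_number (K : qfield) : nat := 1%N.
Definition regulator (K : qfield) : R := 1.
Definition nroots_unity (K : qfield) : nat :=
  match K with FQ => 2%N | FQi => 4%N | FQsqrtm2 => 2%N end.

Definition cK (K : qfield) : R :=
  (2 ^+ r1 K * (2 * pi) ^+ r2 K * (class_number K)%:R * regulator K)
  / (nroots_unity K)%:R.

(* xi_K(s) for real s > 1 *)
Definition xi_real (K : qfield) (s : R) : R :=
  (cK K)^-1 * s * (s - 1) * powR (`|discr K|%:~R) (s / 2)
  * GammaR s ^+ r1 K * GammaC s ^+ r2 K * dedekind_zeta K s.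

(* x^s = exp(s log x) for real x > 0 and complex s *)
Definition cpow (x : R) (s : C) : C :=
  (powR x (complex.Re s))%:C * (cos (complex.Im s * ln x) +i* sin (complex.Im s * ln x)).

Definition entire (f : C -> C) : Prop :=
  forall z, exists l : C, forall e : R, 0 < e -> exists d : R, 0 < d /\
    forall h : C, h != 0 -> `|h| < d%:C -> `|(f (z + h) - f z) / h - l| < e%:C.

Definition cexpect d (T : measurableType d) (P : probability T R) (Y : T -> C) : C :=
  (Rintegral P setT (fun t => complex.Re (Y t))) +i* (Rintegral P setT (fun t => complex.Im (Y t))).

End Defs.

(* Main.v *)
Require Import Defs.
From HB Require Import structures.
From mathcomp Require Import all_boot all_order all_algebra.
From mathcomp Require Import all_classical all_reals all_analysis.
From mathcomp Require Import measurable_realfun complex algC algnum.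
From mathcomp Require Import zify ring lra.
Import Order.TTheory GRing.Theory Num.Theory.
Import numFieldNormedType.Exports.
Import Normc.
Local Open Scope classical_set_scope.
Local Open Scope ring_scope.
Local Open Scope complex_scope.
Set Implicit Arguments. Unset Strict Implicit. Unset Printing Implicit Defensive.

(** Let [r k] be the number of [x] in O_K whose norm form (x^2 for K = Q, the norm
    otherwise) is [k]. The theta function T(x) = sum_k r(k) exp(- lam k e^x) satisfies
    T(-x) = e^(w x) T(x) by Jacobi's identity, with w = 1/2 for Q and w = 1 otherwise.
    Differentiating twice, p = (T'' + w T') / w satisfies p(-x) = e^(w x) p(x). The
    discriminant is so small that lam > 1 + w, hence for x >= 0 every term of the series
    of p is nonnegative, and the symmetry gives p >= 0 everywhere. Its primitive T + T'/w
    increases from 0 to 1, so p is a probability density.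
    Integrating p against e^(s w x) term by term gives the Dirichlet series of zeta_K times
    Gamma factors, that is xi_K(s), for real s > 1; the Dirichlet series is the Euler product
    because O_K is Euclidean. All exponential moments of p are finite, so its Laplace transform
    is entire and equals xi_K by the identity theorem. The random variable is
    X = |D|^(-1/2) e^(w x).

    Jacobi's identity is obtained, following Polya, by letting m tend to infinity with
    m / l^2 fixed in the expansion of sum_k (2 cos (k pi / l))^(2 m) in binomial
    coefficients. *)

(** * Goursat and the identity theorem *)

(** The operator d/dx (d/dx + w) annihilates 1 and e^(-w x), the behaviours of T at +oo and at -oo;
    what it leaves decays so fast that p has all exponential moments. On the Mellin side the same
    operator produces the factor s (s - w), which is the factor s (s - 1) of xi. With y = lam k e^x
    the k-th term of p is r(k) (y^2 - (1 + w) y) e^(-y) / w, hence the condition on lam; for a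
    quadratic field it reads sqrt|D| < pi. In the three fields the ring of integers is Z or
    Z[sqrt(-d)] with d = 1, 2, so the norm form is diagonal and the lattice theta function is a
    product of one-dimensional ones. Since [entire] asks for complex differentiability alone, the
    complex analysis begins with Goursat's subdivision, and the identity theorem is drawn from a
    mean value inequality. The continuation of xi enters as a given entire function that agrees with
    [xi_real] for s > 1. *)

Section SegmentIntegral.
Variable R : realType.
Local Notation mu := (@lebesgue_measure R).
Implicit Types f g : R -> R.

Lemma continuous_itv_integrable f a b : continuous f ->
  mu.-integrable `[a, b] (EFin \o f).
Proof.
move=> cf; apply: continuous_compact_integrable; first exact: segment_compact.
exact: continuous_subspaceT.
Qed.

Lemma Rintegral_itv_split f a b c : continuous f -> a <= b -> b <= c ->
  \int[mu]_(x in `[a, c]) f x =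
  \int[mu]_(x in `[a, b]) f x + \int[mu]_(x in `[b, c]) f x.
Proof.
move=> cf ab bc.
have := @Rintegral_itvB R f (BLeft a) (BRight c) b
  (continuous_itv_integrable a c cf) ab bc.
rewrite Rintegral_itv_obnd_cbnd; last first.
  apply: integrableS (continuous_itv_integrable b c cf) => //.
  by apply: subset_itvr; rewrite bnd_simp.
by move/eqP; rewrite subr_eq addrC => /eqP.
Qed.

Lemma Rintegral_itv_cst a b r : a <= b -> \int[mu]_(_ in `[a, b]) r = r * (b - a).
Proof.
move=> ab; rewrite Rintegral_cst//= lebesgue_measure_itv/= lte_fin.
by case: ltP => //= ba; rewrite (le_anti (introT andP (conj ab ba))) subrr.
Qed.

Lemma Rintegral_itv_close f a b r (e : R) : continuous f -> a <= b ->
  (forall x, a <= x <= b -> `|f x - r| <= e) ->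
  `|\int[mu]_(x in `[a, b]) f x - r * (b - a)| <= e * (b - a).
Proof.
move=> cf ab fe; rewrite -!Rintegral_itv_cst//.
have ic k : mu.-integrable `[a, b] (EFin \o (fun=> k)).
  by apply: continuous_itv_integrable => x; exact: cvg_cst.
rewrite -RintegralB//; last exact: continuous_itv_integrable.
have cfr : continuous (fun x => f x - r).
  by move=> x; apply: cvgB; [exact: cf|exact: cvg_cst].
apply: le_trans (le_normr_Rintegral _ _) _ => //.
  exact: continuous_itv_integrable.
have icfr : mu.-integrable `[a, b] (EFin \o (fun x => `|f x - r|)).
  by apply: continuous_itv_integrable => x; apply: cvg_norm; exact: cfr.
apply: le_Rintegral => // x; rewrite /= in_itv/=; exact: fe.
Qed.

End SegmentIntegral.

Section Goursat.
Variable R : realType.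
Local Notation mu := (@lebesgue_measure R).
Variables u v : R -> R -> R.
Implicit Types x y l m p q e : R.

(** Real form of complex differentiability of u + iv at a point, the derivative being a - ib.
    Continuity of the derivative is not asked, so Green's formula is replaced by subdivision. *)
Definition CR_at (x y : R) := exists a b : R, forall e : R, 0 < e ->
  exists2 d : R, 0 < d & forall h k : R, `|h| < d -> `|k| < d ->
    `|u (x + h) (y + k) - u x y - (a * h + b * k)| <= e * (`|h| + `|k|) /\
    `|v (x + h) (y + k) - v x y - (a * k - b * h)| <= e * (`|h| + `|k|).

Hypothesis uvCR : forall x y, CR_at x y.

Lemma lipschitz_at_continuous (f : R -> R) (x c d : R) : 0 < d ->
  (forall k, `|k| < d -> `|f (x + k) - f x| <= c * `|k|) -> {for x, continuous f}.
Proof.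
move=> d0 fc; apply/cvgrPdist_lt => e e0.
have c0 : 0 < `|c| + 1 by rewrite ltr_wpDl.
near=> y.
have yd : `|y - x| < Num.min d (e / (`|c| + 1)).
  rewrite distrC; near: y; apply: (@cvgr_dist_lt _ R^o _ _ _ id x) => //.
  by rewrite lt_min d0 divr_gt0.
move: yd; rewrite lt_min => /andP[yd ye].
have := fc _ yd; rewrite subrKC distrC => /le_lt_trans; apply.
rewrite ltr_pdivlMr// in ye; apply: le_lt_trans ye.
rewrite mulrC ler_wpM2l//.
by rewrite (le_trans (ler_norm c))// lerDl.
Unshelve. all: by end_near. Qed.

(** Continuity in each variable separately is what the integrals along axis-parallel segments call
    for. *)
Lemma CR_continuous x y : [/\ {for x, continuous (u ^~ y)}, {for y, continuous (u x)},
  {for x, continuous (v ^~ y)} & {for y, continuous (v x)}].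
Proof.
have [a [b]] := uvCR x y => /(_ 1 ltr01)[d d0 uvd].
have n0 : `|0 : R| < d by rewrite normr0.
split.
- apply: (@lipschitz_at_continuous _ _ (1 + `|a|) d) => // k kd.
  have [+ _] := uvd _ _ kd n0.
  rewrite addr0 mulr0 addr0 normr0 addr0 mulrDl => h.
  have := ler_normD (u (x + k) y - u x y - a * k) (a * k).
  by rewrite subrK => /le_trans; apply; rewrite lerD// normrM.
- apply: (@lipschitz_at_continuous _ _ (1 + `|b|) d) => // k kd.
  have [+ _] := uvd _ _ n0 kd.
  rewrite addr0 mulr0 add0r normr0 add0r mulrDl => h.
  have := ler_normD (u x (y + k) - u x y - b * k) (b * k).
  by rewrite subrK => /le_trans; apply; rewrite lerD// normrM.
- apply: (@lipschitz_at_continuous _ _ (1 + `|b|) d) => // k kd.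
  have [_ +] := uvd _ _ kd n0.
  rewrite addr0 mulr0 sub0r opprK normr0 addr0 mulrDl => h.
  have := ler_normB (v (x + k) y - v x y + b * k) (b * k).
  by rewrite addrK => /le_trans; apply; rewrite lerD// normrM.
- apply: (@lipschitz_at_continuous _ _ (1 + `|a|) d) => // k kd.
  have [_ +] := uvd _ _ n0 kd.
  rewrite addr0 mulr0 subr0 normr0 add0r mulrDl => h.
  have := ler_normD (v x (y + k) - v x y - a * k) (a * k).
  by rewrite subrK => /le_trans; apply; rewrite lerD// normrM.
Qed.

Let cu1 x : continuous (u x). Proof. by move=> y; have [] := CR_continuous x y. Qed.
Let cv2 y : continuous (v ^~ y). Proof. by move=> x; have [] := CR_continuous x y. Qed.

Let cuB x x' : continuous (fun t => u x t - u x' t).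
Proof. by move=> t; apply: cvgB; exact: cu1. Qed.
Let cvB y y' : continuous (fun t => v t y - v t y').
Proof. by move=> t; apply: cvgB; exact: cv2. Qed.

(* the imaginary part of the integral of u + iv along the boundary of [x, x + l] x [y, y + m] *)
Definition circulation x y l m :=
  \int[mu]_(t in `[y, y + m]) (u (x + l) t - u x t) -
  \int[mu]_(t in `[x, x + l]) (v t (y + m) - v t y).

Lemma circulation_quarters x y l m : 0 <= l -> 0 <= m ->
  circulation x y (l + l) (m + m) =
  circulation x y l m + circulation (x + l) y l m +
  circulation x (y + m) l m + circulation (x + l) (y + m) l m.
Proof.
move=> l0 m0; rewrite /circulation !addrA.
rewrite (@Rintegral_itv_split _ _ y (y + m) (y + m + m)) ?lerDl//.
rewrite (@Rintegral_itv_split _ _ x (x + l) (x + l + l)) ?lerDl//.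
have iu a b c : mu.-integrable `[a, b] (EFin \o u c) by exact: continuous_itv_integrable.
have iv a b c : mu.-integrable `[a, b] (EFin \o (v ^~ c)) by exact: continuous_itv_integrable.
have IU a b c c' : \int[mu]_(t in `[a, b]) (u c t - u c' t) =
  \int[mu]_(t in `[a, b]) u c t - \int[mu]_(t in `[a, b]) u c' t by rewrite RintegralB.
have IV a b c c' : \int[mu]_(t in `[a, b]) (v t c - v t c') =
  \int[mu]_(t in `[a, b]) v t c - \int[mu]_(t in `[a, b]) v t c' by rewrite RintegralB.
by rewrite !IU !IV; ring.
Qed.

(** The linear part of u contributes a l m to the first integral and that of v the same to the
    second, so they cancel; the remainders are at most e (l + m) m and e (l + m) l. *)
Lemma circulation_local x y e : 0 < e -> exists2 d : R, 0 < d &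
  forall p q l m : R, p <= x <= p + l -> q <= y <= q + m -> l < d -> m < d ->
  `|circulation p q l m| <= e * (l + m) ^+ 2.
Proof.
move=> e0; have [a [b]] := uvCR x y => /(_ (e / 2)).
rewrite divr_gt0// => /(_ isT)[d d0 uvd]; exists d => // p q l m.
move=> /andP[px xp] /andP[qy yq] ld md.
have l0 : 0 <= l by lra.
have m0 : 0 <= m by lra.
have Hd s t : p <= s <= p + l -> q <= t <= q + m ->
   `|s - x| <= l /\ `|t - y| <= m.
  by move=> /andP[? ?] /andP[? ?]; rewrite !ler_norml; split; apply/andP; split; lra.
have U s t : p <= s <= p + l -> q <= t <= q + m ->
   `|u s t - u x y - (a * (s - x) + b * (t - y))| <= e / 2 * (l + m) /\
   `|v s t - v x y - (a * (t - y) - b * (s - x))| <= e / 2 * (l + m).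
  move=> sp tq; have [sl tm] := Hd _ _ sp tq.
  have [] := uvd (s - x) (t - y) (le_lt_trans sl ld) (le_lt_trans tm md).
  rewrite !subrKC => h1 h2.
  have K : e / 2 * (`|s - x| + `|t - y|) <= e / 2 * (l + m).
    by rewrite ler_wpM2l// ?lerD// divr_ge0// ltW.
  by split; exact: le_trans K.
have [pl pr] : p <= p + l <= p + l /\ p <= p <= p + l by split; apply/andP; split; lra.
have [ql qr] : q <= q + m <= q + m /\ q <= q <= q + m by split; apply/andP; split; lra.
have I1 : `|\int[mu]_(t in `[q, q + m]) (u (p + l) t - u p t) - (a * l) * ((q + m) - q)|
    <= (e * (l + m)) * ((q + m) - q).
  apply: Rintegral_itv_close => //; first by rewrite lerDl.
  move=> t tq.
  have [+ _] := U (p + l) t pl tq.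
  have [+ _] := U p t pr tq.
  rewrite !ler_norml => /andP[? ?] /andP[? ?]; apply/andP; split; lra.
have I2 : `|\int[mu]_(t in `[p, p + l]) (v t (q + m) - v t q) - (a * m) * ((p + l) - p)|
    <= (e * (l + m)) * ((p + l) - p).
  apply: Rintegral_itv_close => //; first by rewrite lerDl.
  move=> t tp.
  have [_ +] := U t (q + m) tp ql.
  have [_ +] := U t q tp qr.
  rewrite !ler_norml => /andP[? ?] /andP[? ?]; apply/andP; split; lra.
have E1 (r s : R) : r + s - r = s by ring.
rewrite !E1 in I1 I2; rewrite /circulation.
move: I1 I2; set A := Rintegral _ _ _; set B := Rintegral _ _ _.
rewrite !ler_norml => /andP[? ?] /andP[? ?]; apply/andP; split; lra.
Qed.

Lemma exists_large_quarter x y l m : 0 <= l -> 0 <= m ->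
  exists p q : R, [/\ p = x \/ p = x + l, q = y \/ q = y + m &
    `|circulation x y (l + l) (m + m)| <= 4 * `|circulation p q l m|].
Proof.
move=> l0 m0; rewrite circulation_quarters//.
set a := circulation x y l m; set b := circulation (x + l) y l m.
set c := circulation x (y + m) l m; set d := circulation (x + l) (y + m) l m.
have K : `|a + b + c + d| <= `|a| + `|b| + `|c| + `|d|.
  by do 3!(apply: (le_trans (ler_normD _ _)); rewrite lerD2r).
set S := `|_ + _ + _ + _| in K *.
have [h|ha] := leP S (4 * `|a|); first by exists x, y; split; [left|left|].
have [h|hb] := leP S (4 * `|b|); first by exists (x + l), y; split; [right|left|].
have [h|hc] := leP S (4 * `|c|); first by exists x, (y + m); split; [left|right|].
exists (x + l), (y + m); split; [by right|by right|].
rewrite -/d; lra.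
Qed.

Let half_itv_sub (a b p q l l' : R) : a <= p -> p + l <= b -> l' + l' = l ->
  0 <= l' -> q = p \/ q = p + l' -> a <= q /\ q + l' <= b.
Proof. by move=> ? ? ? ? [] ->; split; lra. Qed.

(** Goursat's argument: repeatedly choose a quarter with at least a fourth of the circulation, and
    apply [circulation_local] at the common point of the nested rectangles. *)
Lemma circulation_eq0 x y l m : 0 <= l -> 0 <= m -> circulation x y l m = 0.
Proof.
move=> l0 m0.
pose L n := l / 2 ^+ n; pose M n := m / 2 ^+ n.
have LS n : L n.+1 + L n.+1 = L n by rewrite /L exprS invfM; field; rewrite expf_neq0.
have MS n : M n.+1 + M n.+1 = M n by rewrite /M exprS invfM; field; rewrite expf_neq0.
have L0 n : 0 <= L n by rewrite divr_ge0// exprn_ge0.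
have M0 n : 0 <= M n by rewrite divr_ge0// exprn_ge0.
have ex n (pq : R * R) : exists pq' : R * R,
   [/\ pq'.1 = pq.1 \/ pq'.1 = pq.1 + L n.+1, pq'.2 = pq.2 \/ pq'.2 = pq.2 + M n.+1 &
     `|circulation pq.1 pq.2 (L n) (M n)| <=
       4 * `|circulation pq'.1 pq'.2 (L n.+1) (M n.+1)|].
  have [p [q [h1 h2 h3]]] := exists_large_quarter pq.1 pq.2 (L0 n.+1) (M0 n.+1).
  by exists (p, q); split=> //; rewrite -LS -MS.
pose nxt n pq := projT1 (cid (ex n pq)).
have nxtP n pq := projT2 (cid (ex n pq)).
pose Q := fix Q n := if n is k.+1 then nxt k (Q k) else (x, y).
have QP n := nxtP n (Q n).
have Qb n : `|circulation x y l m| <= 4 ^+ n * `|circulation (Q n).1 (Q n).2 (L n) (M n)|.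
  elim: n => [|n IH]; first by rewrite /L /M !expr0 !divr1 mul1r.
  by apply: (le_trans IH); rewrite exprSr -mulrA ler_wpM2l ?exprn_ge0//; have [] := QP n.
have mono n k : [/\ (Q n).1 <= (Q (n + k)%N).1, (Q (n + k)%N).1 + L (n + k)%N <= (Q n).1 + L n,
    (Q n).2 <= (Q (n + k)%N).2 & (Q (n + k)%N).2 + M (n + k)%N <= (Q n).2 + M n].
  elim: k => [|k [h1 h2 h3 h4]]; first by rewrite addn0 !lexx.
  rewrite addnS /=; have [q1 q2 _] := QP (n + k)%N; rewrite -/(nxt _ _) in q1 q2.
  have [? ?] := half_itv_sub h1 h2 (LS _) (L0 _) q1.
  by have [? ?] := half_itv_sub h3 h4 (MS _) (M0 _) q2.
(* Nested intervals, used for each coordinate: the supremum of the left ends lies in all of them. *)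
have lim (f : R -> R -> nat -> R) (w : nat -> R) (W : nat -> R) :
    (forall n k, w n <= w (n + k)%N /\ w (n + k)%N + W (n + k)%N <= w n + W n) ->
    (forall n, 0 <= W n) ->
    exists z, forall n, w n <= z <= w n + W n.
  move=> wW W0.
  have ub n k : w k <= w n + W n.
    have [h1 _] := wW k n; have [_ h2] := wW n k; have := W0 (n + k)%N.
    by rewrite addnC in h1; lra.
  have hs : has_sup (range w).
    by split; [exists (w 0%N), 0%N|exists (w 0%N + W 0%N) => _ [k _ <-]].
  exists (sup (range w)) => n; apply/andP; split.
    by apply: (ub_le_sup hs.2); exists n.
  by apply: sup_le_ub => [|_ [k _ <-]]; [exact: hs.1|].
have [X HX] := lim (fun _ _ _ => 0) (fun n => (Q n).1) L
  (fun n k => let: And4 a b _ _ := mono n k in conj a b) L0.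
have [Y HY] := lim (fun _ _ _ => 0) (fun n => (Q n).2) M
  (fun n k => let: And4 _ _ a b := mono n k in conj a b) M0.
have cvg2 c : c / 2 ^+ n @[n --> \oo] --> (0 : R).
  rewrite -(mulr0 c); apply: cvgM; first exact: cvg_cst.
  under eq_fun do rewrite -exprVn.
  by apply: cvg_expr; rewrite ger0_norm; lra.
apply/eqP; rewrite -normr_eq0 eq_le normr_ge0 andbT; apply/ler_addgt0Pl => e e0.
rewrite addr0.
pose e' := e / ((l + m) ^+ 2 + 1).
have lm0 : 0 < (l + m) ^+ 2 + 1 by rewrite ltr_wpDl// sqr_ge0.
have e'0 : 0 < e' by rewrite divr_gt0.
have [d d0 Hd] := circulation_local X Y e'0.
have [n [Ln Mn]] : exists n, L n < d /\ M n < d.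
  have hL : \forall n \near \oo, `|L n| < d.
    by move/cvgr0_norm_lt : (cvg2 l) => /(_ d d0).
  have hM : \forall n \near \oo, `|M n| < d.
    by move/cvgr0_norm_lt : (cvg2 m) => /(_ d d0).
  have [N _ HN] := filterI hL hM.
  exists N; have [] := HN N (leqnn _).
  by rewrite !ger0_norm.
apply: (le_trans (Qb n)).
have := Hd _ _ _ _ (HX n) (HY n) Ln Mn.
rewrite -(ler_pM2l (_ : 0 < 4 ^+ n)) ?exprn_gt0// => /le_trans; apply.
(* Each halving divides the squared size by 4 and so pays exactly for the factor 4 lost in the
   choice of a quarter. *)
have -> : 4 ^+ n * (e' * (L n + M n) ^+ 2) = e' * (l + m) ^+ 2.
  rewrite /L /M -mulrDl exprMn (_ : 4 = 2 ^+ 2 :> R); last by rewrite -natrX.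
  rewrite -exprM mulnC exprM exprVn; field; exact: expf_neq0.
by rewrite /e' mulrAC ler_pdivrMr// ler_wpM2l// ?lerDl// ltW.
Qed.

End Goursat.

(** * Second-order remainders of the exponential and trigonometric functions *)

Section ElementaryBounds.
Variable R : realType.
Implicit Types a b x y h k : R.

Lemma normr_sin_le b : `|sin b| <= `|b|.
Proof.
have pos (c : R) : 0 < c -> `|sin c| <= `|c|.
  move=> c0; have [|e _] := @MVT R sin cos 0 c c0 (fun x _ => is_derive_sin x).
    by apply: continuous_subspaceT; exact: continuous_sin.
  rewrite sin0 !subr0 => ->; rewrite normrM ler_piMl//.
  by rewrite cos_max.
have [b0|b0|->] := ltgtP b 0; last by rewrite sin0.
- by rewrite -normrN -sinN -[leRHS]normrN pos// oppr_gt0.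
- exact: pos.
Qed.

Lemma cos_ge1B b : 1 - b ^+ 2 / 2 <= cos b.
Proof.
have -> : b = (b / 2) *+ 2 by rewrite -mulr_natr divfK.
rewrite cos_mulr2n cos2sin2 mulrnBl.
have : sin (b / 2) ^+ 2 <= (b / 2) ^+ 2.
  by rewrite -[leLHS]real_normK ?num_real// -[leRHS]real_normK ?num_real// ler_pXn2r ?nnegrE// normr_sin_le.
lra.
Qed.

Lemma normr_cosB1_le b : `|cos b - 1| <= `|b|.
Proof.
have h1 := cos_ge1B b; have h2 := cos_le1 b; have h3 := cos_geN1 b.
have e : cos b - 1 = - (1 - cos b) by ring.
rewrite e normrN ger0_norm ?subr_ge0//.
have := real_normK (num_real b); have := normr_ge0 b; nra.
Qed.

Lemma normr_sinB_le b : `|sin b - b| <= b ^+ 2.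
Proof.
have pos (c : R) : 0 < c -> `|sin c - c| <= c ^+ 2.
  move=> c0.
  have dF x : x \in `]0, c[ -> is_derive x 1 (fun x => sin x - x) (cos x - 1).
    by move=> _; apply: is_deriveB.
  have [|e] := @MVT R _ _ 0 c c0 dF.
    apply: continuous_subspaceT => x.
    by apply: cvgB; [exact: continuous_sin|exact: cvg_id].
  rewrite in_itv/= => /andP[e0 ec].
  rewrite sin0 !subr0 => ->; rewrite normrM expr2 (ger0_norm (ltW c0)).
  rewrite ler_wpM2r ?(ltW c0)//; apply: le_trans (normr_cosB1_le e) _.
  by rewrite gtr0_norm// ltW.
have [b0|b0|->] := ltgtP b 0; last by rewrite sin0 subr0 normr0 expr0n.
- by have := pos (- b); rewrite sinN -opprD normrN sqrrN oppr_gt0 => /(_ b0).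
- exact: pos.
Qed.

Lemma normr_expRB1_le a : `|expR a - 1| <= `|a| * expR `|a|.
Proof.
have h1 := expR_ge1Dx a; have h2 := expR_ge1Dx (- a).
have h3 := expRxMexpNx_1 a; have h4 := expR_gt0 a; have h5 := expR_gt0 (- a).
have [a0|a0] := leP 0 a.
  rewrite (ger0_norm a0) ger0_norm; last by lra.
  nra.
rewrite (ltr0_norm a0); have : expR a <= 1 by rewrite expR_le1 ltW.
move=> e1; rewrite ler0_norm; last by lra.
nra.
Qed.

Lemma normr_expRB1B_le a : `|expR a - 1 - a| <= a ^+ 2 * expR `|a|.
Proof.
have h1 := expR_ge1Dx a; have h2 := expR_ge1Dx (- a).
have h3 := expRxMexpNx_1 a; have h4 := expR_gt0 a; have h5 := expR_gt0 (- a).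
have hh : expR a - 1 - a <= a * (expR a - 1) by nra.
rewrite ger0_norm; last by lra.
apply: (le_trans hh); apply: (le_trans (ler_norm _)).
rewrite normrM -real_normK ?num_real// expr2 -mulrA ler_wpM2l//.
exact: normr_expRB1_le.
Qed.

(** With [expsin_bound], these are the two parts of exp(a + ib) - 1 - (a + ib). The bound holds for
    all a and b, its factor exp|a| being integrable against the density later on. *)
Lemma expcos_bound a b :
  `|expR a * cos b - 1 - a| <= 2 * (a ^+ 2 + b ^+ 2) * expR `|a|.
Proof.
have -> : expR a * cos b - 1 - a = (expR a - 1 - a) - expR a * (1 - cos b) by ring.
apply: le_trans (ler_normB _ _) _.
have h1 := normr_expRB1B_le a; have h2 := cos_ge1B b; have h3 := cos_le1 b.
rewrite normrM (ger0_norm (expR_ge0 a)) (@ger0_norm _ (1 - _)) ?subr_ge0//.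
have h4 : expR a <= expR `|a| by rewrite ler_expR ler_norm.
have h5 := expR_gt0 a; have := sqr_ge0 a; have := sqr_ge0 b; nra.
Qed.

Lemma expsin_bound a b :
  `|expR a * sin b - b| <= 2 * (a ^+ 2 + b ^+ 2) * expR `|a|.
Proof.
have -> : expR a * sin b - b = (expR a - 1) * sin b + (sin b - b) by ring.
apply: le_trans (ler_normD _ _) _.
have h1 := normr_expRB1_le a; have h2 := normr_sinB_le b; have h3 := normr_sin_le b.
have h4 : 1 <= expR `|a| by rewrite -expR0 ler_expR.
rewrite normrM.
have := normr_ge0 (expR a - 1); have := normr_ge0 (sin b).
have := normr_ge0 a; have := normr_ge0 b.
rewrite -[a ^+ 2]real_normK ?num_real// -[b ^+ 2]real_normK ?num_real//.
rewrite -[b ^+ 2]real_normK ?num_real// in h2.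
set A := `|a| in h1 *; set B := `|b| in h2 h3 *; set E := expR A in h1 h4 *.
move=> B0 A0 S0 T0.
have k1 : `|expR a - 1| * `|sin b| <= A * E * B by apply: ler_pM.
have k2 : B ^+ 2 <= B ^+ 2 * E by rewrite ler_peMr// sqr_ge0.
have k3 : (A * B) * E <= (A ^+ 2 + B ^+ 2) * E.
  by rewrite ler_wpM2r//; [lra|have := sqr_ge0 (A - B); nra].
have k4 : 0 <= A ^+ 2 * E by rewrite mulr_ge0 ?sqr_ge0//; lra.
nra.
Qed.

End ElementaryBounds.

(** * Complex modulus, differentiability and logarithmic polar coordinates *)

Section ComplexNorm.
Variable R : realType.
Local Notation C := R[i].
Implicit Types z w : C.

Lemma normcE_ z : `|z| = (normc z)%:C. Proof. by []. Qed.

Lemma normc_ge0 z : 0 <= normc z.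
Proof. by case: z => a b; rewrite /= sqrtr_ge0. Qed.

Lemma normr_Re_le z : `|complex.Re z| <= normc z.
Proof.
case: z => a b /=; rewrite -sqrtr_sqr ler_wsqrtr// lerDl sqr_ge0//.
Qed.

Lemma normr_Im_le z : `|complex.Im z| <= normc z.
Proof.
case: z => a b /=; rewrite -sqrtr_sqr ler_wsqrtr// lerDr sqr_ge0//.
Qed.

Lemma normc_le_ReIm z : normc z <= `|complex.Re z| + `|complex.Im z|.
Proof.
case: z => a b /=; rewrite -[leRHS]ger0_norm ?addr_ge0// -sqrtr_sqr ler_wsqrtr//.
rewrite sqrrD !real_normK ?num_real// addrAC lerDl mulrn_wge0// mulr_ge0//.
Qed.

Lemma normcR (x : R) : normc x%:C = `|x|.
Proof. by rewrite /= expr0n/= addr0 sqrtr_sqr. Qed.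

Lemma normcB z w : normc (z - w) <= normc z + normc w.
Proof. by rewrite -(normcN w); exact: le_normcD. Qed.

(** Free of division and with a real-valued modulus, so that h = 0 is no exception and real
    arithmetic applies. *)
Definition cdiff (f : C -> C) z l := forall e : R, 0 < e -> exists2 d : R, 0 < d &
  forall h, normc h < d -> normc (f (z + h) - f z - l * h) <= e * normc h.

Lemma entire_cdiff (f : C -> C) : entire f <-> forall z, exists l, cdiff f z l.
Proof.
split=> H z; have [l Hl] := H z; exists l => e e0.
  have [d [d0 Hd]] := Hl e e0; exists d => // h hd.
  have [->|h0] := eqVneq h 0; first by rewrite addr0 subrr mulr0 subr0 normc0 mulr0.
  have := Hd h h0; rewrite !normcE_ !ltcR => /(_ hd)/ltW.
  have -> : (f (z + h) - f z) / h - l = (f (z + h) - f z - l * h) / h by field.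
  have h1 : 0 < normc h.
    by rewrite lt_neqAle normc_ge0 eq_sym andbT; apply: contra h0 => /eqP/eq0_normc/eqP.
  by rewrite normcM normcV ler_pdivrMr.
have e2 : 0 < e / 2 by rewrite divr_gt0.
have [d d0 Hd] := Hl _ e2; exists d; split=> // h h0.
rewrite !normcE_ !ltcR => hd.
have -> : (f (z + h) - f z) / h - l = (f (z + h) - f z - l * h) / h by field.
have h1 : 0 < normc h.
  by rewrite lt_neqAle normc_ge0 eq_sym andbT; apply: contra h0 => /eqP/eq0_normc/eqP.
rewrite normcM normcV ltr_pdivrMr//; apply: le_lt_trans (Hd _ hd) _.
by rewrite ltr_pM2r// ltr_pdivrMr// mulr2n mulrDr mulr1 ltrDl.
Qed.

(** This is exp(x + iy). It makes polar coordinates a holomorphic change of variables in which an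
    annulus is a rectangle, so that [circulation_eq0] applies to it. *)
Definition pol (x y : R) : C := (expR x * cos y) +i* (expR x * sin y).

Lemma normc_pol (x y : R) : normc (pol x y) = expR x.
Proof. by rewrite /= !exprMn -mulrDr cos2Dsin2 mulr1 sqrtr_sqr ger0_norm// expR_ge0. Qed.

Lemma polD (x y h k : R) : pol (x + h) (y + k) = pol x y * pol h k.
Proof. by rewrite /pol; simpc; rewrite expRD cosD sinD; congr (_ +i* _); ring. Qed.

Lemma pol_bound (h k : R) : normc (pol h k - 1 - (h +i* k)) <=
  4 * (`|h| + `|k|) ^+ 2 * expR `|h|.
Proof.
apply: le_trans (normc_le_ReIm _) _ => /=; rewrite subr0.
have h1 := expcos_bound h k; have h2 := expsin_bound h k; have h3 := expR_gt0 `|h|.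
apply: (le_trans (lerD h1 h2)).
rewrite -mulrDl ler_wpM2r ?(ltW h3)// -mulrDl.
rewrite -[h ^+ 2]real_normK ?num_real// -[k ^+ 2]real_normK ?num_real//.
have := normr_ge0 h; have := normr_ge0 k; nra.
Qed.

End ComplexNorm.

(** * The mean value inequality on circles *)

Section MeanValue.
Variable R : realType.
Local Notation C := R[i].
Local Notation mu := (@lebesgue_measure R).
Variables (g : C -> C) (z0 : C).
Hypothesis dg : forall z, exists l, cdiff g z l.

Let u x y := complex.Re (g (z0 + pol x y)).
Let v x y := complex.Im (g (z0 + pol x y)).

Lemma polar_CR x y : CR_at u v x y.
Proof.
set w := pol x y; set z := z0 + w.
have [l Hl] := dg z.
pose A := complex.Re (l * w); pose B := complex.Im (l * w).
(* By the chain rule the derivative is l w = A + iB, and [CR_at] writes a derivative as a - ib. *)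
exists A, (- B) => e e0.
set N := expR x; have N0 : 0 < N by exact: expR_gt0.
set K : R := 1 + 4 * expR 1; have K0 : 0 < K.
  by rewrite /K; have := expR_gt0 (1 : R); lra.
set L : R := normc l; have L0 : 0 <= L by exact: normc_ge0.
have e10 : 0 < e / (2 * N * K) by rewrite divr_gt0// !mulr_gt0.
have [d0 d00 Hd] := Hl _ e10.
set D : R := 2 * L * N * K + 1; have D0 : 0 < D by rewrite /D; have := mulr_ge0 (mulr_ge0 L0 (ltW N0)) (ltW K0); lra.
(* The first bound gives T <= 1, the second keeps the increment of [pol] inside the disc of radius
   [d0], the third makes l times the quadratic remainder of [pol] at most e T / 2. *)
exists (Num.min (1 / 2) (Num.min (d0 / (2 * N * K)) (e / (2 * D)))).
  by rewrite !lt_min !divr_gt0// !mulr_gt0.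
move=> h k; rewrite !lt_min => /and3P[h1 h2 h3] /and3P[k1 k2 k3].
set T : R := `|h| + `|k|; have T0 : 0 <= T by rewrite addr_ge0.
have T1 : T <= 1 by rewrite /T; lra.
have T2 : T * (N * K) < d0.
  move: h2 k2; rewrite !ltr_pdivlMr ?mulr_gt0// /T; lra.
have T3 : T * D <= e.
  move: h3 k3; rewrite !ltr_pdivlMr ?mulr_gt0// /T; lra.
set de := pol h k - 1 - (h +i* k).
have deT : normc de <= (K - 1) * T ^+ 2.
  apply: le_trans (pol_bound h k) _; rewrite -/T /K (_ : 1 + _ - 1 = 4 * expR 1); last by ring.
  rewrite mulrAC ler_wpM2r ?sqr_ge0// ler_pM2l// ler_expR; lra.
have hkT : normc (h +i* k) <= T by exact: normc_le_ReIm.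
have pT : normc (pol h k - 1) <= K * T.
  have -> : pol h k - 1 = de + (h +i* k) by rewrite /de subrK.
  apply: le_trans (le_normcD _ _) _.
  have : T ^+ 2 <= T by rewrite expr2 ler_piMl.
  by move: deT hkT; rewrite /K; have := expR_gt0 (1 : R); nra.
pose ze := w * (pol h k - 1).
have zeT : normc ze <= N * (K * T) by rewrite normcM normc_pol ler_wpM2l// ltW.
have zed : normc ze < d0 by apply: le_lt_trans zeT _; rewrite mulrA mulrC.
have E1 : z0 + pol (x + h) (y + k) = z + ze.
  by rewrite polD /z /ze mulrBr mulr1 -/w -addrA [w + _]addrC subrK.
have E2 : g (z0 + pol (x + h) (y + k)) - g z - (l * w) * (h +i* k) =
    (g (z + ze) - g z - l * ze) + l * w * de.
  by rewrite E1 /de /ze; ring.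
have : normc (g (z0 + pol (x + h) (y + k)) - g z - (l * w) * (h +i* k)) <= e * T.
  rewrite E2; apply: le_trans (le_normcD _ _) _.
  have s1 := Hd _ zed.
  have s2 : e / (2 * N * K) * normc ze <= e / (2 * N * K) * (N * (K * T)).
    by rewrite ler_wpM2l// ltW.
  have s3 : e / (2 * N * K) * (N * (K * T)) = e / 2 * T by field; rewrite !gt_eqF.
  have s4 : normc (l * w * de) <= L * N * ((K - 1) * T ^+ 2).
    by rewrite normcM normcM normc_pol ler_wpM2l// mulr_ge0// ltW.
  have s5 : L * N * ((K - 1) * T ^+ 2) <= T * (L * N * K * T).
    have q1 : 0 <= L * N * T ^+ 2 by rewrite !mulr_ge0// ?sqr_ge0// ltW.
    by nra.
  have s6 : T * (L * N * K * T) <= T * (e / 2).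
    by rewrite ler_wpM2l//; move: T3; rewrite /D; lra.
  by lra.
have -> : l * w = A +i* B by rewrite /A /B; case: (l * w).
set q := g _ - g z; move=> Hq.
have -> : u (x + h) (y + k) - u x y - (A * h + - B * k) =
   complex.Re (q - (A +i* B) * (h +i* k)).
  by rewrite /q /u -/w -/z; case: (g _) => ? ?; case: (g _) => ? ? /=; ring.
have -> : v (x + h) (y + k) - v x y - (A * k - - B * h) =
   complex.Im (q - (A +i* B) * (h +i* k)).
  by rewrite /q /v -/w -/z; case: (g _) => ? ?; case: (g _) => ? ? /=; ring.
by split; apply: le_trans Hq; [exact: normr_Re_le|exact: normr_Im_le].
Qed.

Lemma circle_bounded x : exists M : R, forall t, 0 <= t <= pi *+ 2 -> normc (g (z0 + pol x t)) <= M.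
Proof.
have c : continuous (fun t => `|u x t| + `|v x t|).
  move=> t; have [_ cu _ cv] := CR_continuous polar_CR x t.
  by apply: cvgD; apply: cvg_norm; [exact: cu|exact: cv].
have p0 : 0 <= pi *+ 2 :> R by rewrite mulrn_wge0// pi_ge0.
have [m _ mP] := @EVT_max R _ 0 (pi *+ 2) p0 (continuous_subspaceT c).
exists (`|u x m| + `|v x m|) => t t0; apply: le_trans (normc_le_ReIm _) _.
by apply: mP; rewrite in_itv.
Qed.

(** The circulation around [y, x] times [0, 2 pi] is zero and its horizontal sides cancel by
    periodicity, so the circle integral of Re g does not depend on the radius; as the radius shrinks
    it tends to 2 pi Re g(z0). *)
Lemma Re_mean_value_le x M :
  (forall t, 0 <= t <= pi *+ 2 -> complex.Re (g (z0 + pol x t)) <= M) ->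
  complex.Re (g z0) <= M.
Proof.
move=> gM; have p0 : 0 < pi *+ 2 :> R by rewrite pmulrn_lgt0// pi_gt0.
have cu y : continuous (u y).
  by move=> t; have [_ + _ _] := CR_continuous polar_CR y t.
have Ieq y : y <= x -> \int[mu]_(t in `[0, pi *+ 2]) u y t = \int[mu]_(t in `[0, pi *+ 2]) u x t.
  move=> yx; have xy : 0 <= x - y by rewrite subr_ge0.
  have := @circulation_eq0 R u v polar_CR y 0 (x - y) (pi *+ 2) xy (ltW p0).
  rewrite /circulation add0r subrKC.
  rewrite [X in _ - X](_ : _ = 0); last first.
    rewrite /Rintegral (eq_integral (fun=> 0%E)) ?integral0// => t _ /=.
    by rewrite /v /pol cos2pi sin2pi cos0 sin0 subrr.
  have Jx := continuous_itv_integrable 0 (pi *+ 2) (cu x).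
  have Jy := continuous_itv_integrable 0 (pi *+ 2) (cu y).
  have e : \int[mu]_(t in `[0, pi *+ 2]) (u x t - u y t) =
      \int[mu]_(t in `[0, pi *+ 2]) u x t - \int[mu]_(t in `[0, pi *+ 2]) u y t.
    by apply: RintegralB Jx Jy; exact: measurable_itv.
  by rewrite subr0 e => /subr0_eq ->.
have IM : \int[mu]_(t in `[0, pi *+ 2]) u x t <= M * (pi *+ 2 - 0).
  rewrite -Rintegral_itv_cst ?(ltW p0)//; apply: le_Rintegral => //.
  - exact: continuous_itv_integrable.
  - by apply: continuous_itv_integrable => ?; exact: cvg_cst.
apply/ler_addgt0Pl => e e0.
have [l Hl] := dg z0; have [d d0 Hd] := Hl 1 ltr01.
set L : R := normc l; have L0 : 0 <= L by exact: normc_ge0.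
(* Within distance d of z0, g moves by at most (1 + L) times the distance; radius r therefore keeps
   it within e of g(z0). *)
pose r := Num.min (d / 2) (e / (1 + L)).
have r0 : 0 < r by rewrite lt_min !divr_gt0// ltr_pwDl.
have rd : r < d by rewrite gt_min; apply/orP; left; lra.
pose y := Num.min x (ln r).
have yr : expR y <= r.
  rewrite -[leRHS](@lnK R r) ?posrE// ler_expR ge_min lexx orbT//.
have He t : `|u y t - complex.Re (g z0)| <= e.
  have pd : normc (pol y t) < d by rewrite normc_pol (le_lt_trans yr).
  have := Hd _ pd; rewrite mul1r normc_pol => H1.
  have -> : u y t - complex.Re (g z0) = complex.Re (g (z0 + pol y t) - g z0).
    by rewrite /u; case: (g _) => ? ?; case: (g _).
  apply: le_trans (normr_Re_le _) _.
  rewrite -[X in normc X](subrK (l * pol y t)).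
  apply: le_trans (le_normcD _ _) _; rewrite normcM normc_pol -/L.
  have : r * (1 + L) <= e by rewrite -ler_pdivlMr ?ltr_pwDl// ge_min lexx orbT.
  by nra.
have := @Rintegral_itv_close R (u y) 0 (pi *+ 2) (complex.Re (g z0)) e (cu y) (ltW p0) (fun t _ => He t).
rewrite Ieq ?ge_min ?lexx// subr0 ler_norml => /andP[H1 H2].
rewrite subr0 in IM.
have H3 : - (e * (pi *+ 2)) <= M * (pi *+ 2) - complex.Re (g z0) * (pi *+ 2).
  by apply: le_trans H1 _; rewrite lerD2r.
by rewrite -(ler_pM2r p0) mulrDl; move: H3; clear; lra.
Qed.

End MeanValue.

Lemma cdiffZ (R : realType) (f : R[i] -> R[i]) z l c : cdiff f z l -> cdiff (fun w => c * f w) z (c * l).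
Proof.
move=> fl e e0.
have c0 : 0 < normc c + 1 by rewrite ltr_wpDl ?normc_ge0.
have [d d0 Hd] := fl _ (divr_gt0 e0 c0); exists d => // h hd.
have -> : c * f (z + h) - c * f z - c * l * h = c * (f (z + h) - f z - l * h) by ring.
rewrite normcM; have := Hd _ hd; rewrite mulrAC ler_pdivlMr// => H; apply: le_trans H.
by rewrite mulrC ler_wpM2l ?normc_ge0// lerDl.
Qed.

Lemma mean_value_le (R : realType) (g : R[i] -> R[i]) z0 x M :
  (forall z, exists l, cdiff g z l) ->
  (forall t, 0 <= t <= pi *+ 2 -> normc (g (z0 + pol x t)) <= M) ->
  normc (g z0) <= M.
Proof.
move=> dg gM.
have M0 : 0 <= M.
  by apply: le_trans (gM 0 _); [exact: normc_ge0|rewrite lexx mulrn_wge0// pi_ge0].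
have [->|n0] := eqVneq (normc (g z0)) 0; first by [].
have npos : 0 < normc (g z0) by rewrite lt_neqAle eq_sym n0 normc_ge0.
(* Multiplying by this conjugate turns the value at z0 into the real number |g z0|^2, and bounds for
   real parts become bounds for the modulus. *)
pose c := (g z0)^*%C.
have nc : normc c = normc (g z0) by rewrite /c; case: (g z0) => a b /=; rewrite sqrrN.
have dcg z : exists l, cdiff (fun w => c * g w) z l.
  by have [l gl] := dg z; exists (c * l); exact: cdiffZ.
have := @Re_mean_value_le R _ z0 dcg x (normc (g z0) * M).
rewrite (_ : complex.Re (c * g z0) = normc (g z0) ^+ 2); last first.
  rewrite /c; case: (g z0) => a b /=; rewrite sqr_sqrtr ?addr_ge0 ?sqr_ge0//; ring.
rewrite expr2 ler_pM2l//; apply => t t0.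
apply: le_trans (ler_norm _) _; apply: le_trans (normr_Re_le _) _.
by rewrite normcM nc ler_pM2l// gM.
Qed.

(** * Removing zeros, and the identity theorem *)

Section IdentityTheorem.
Variable R : realType.
Local Notation C := R[i].

(** A bridge to [derivable] over [C^o], whose product and inverse rules treat the quotients
    below. *)
Lemma derivable_cdiff (f : C -> C) (z : C) :
  derivable (f : C^o -> C^o) z 1 <-> exists l, cdiff f z l.
Proof.
split.
- move=> /cvg_ex[/= l fl]; exists l => e e0.
  have e0' : 0 < e%:C by rewrite ltcR.
  move/cvgrPdist_le : fl => /(_ _ e0').
  rewrite near_withinE => /nbhs_normP[/= d d0 Hd].
  have dR : d = (complex.Re d)%:C by rewrite RRe_real// gtr0_real.
  exists (complex.Re d); first by move: d0; rewrite dR ltcR.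
  move=> h hd; have [->|h0] := eqVneq h 0.
    by rewrite addr0 subrr mulr0 subr0 normc0 mulr0.
  have := Hd h; rewrite /= /ball_/= sub0r normrN => /(_ _ h0).
  rewrite {1}normcE_ dR ltcR => /(_ hd).
  have nh : 0 < normc h.
    by rewrite lt_neqAle normc_ge0 eq_sym andbT; apply: contra h0 => /eqP/eq0_normc/eqP.
  have -> : l - h^-1 *: (f (h *: 1 + z) - f z) = - (f (z + h) - f z - l * h) / h.
    by rewrite /GRing.scale/= mulr1 addrC (addrC h); field.
  by rewrite normcE_ lecR normcM normcN normcV ler_pdivrMr.
- move=> [l fl]; apply/cvg_ex; exists l; apply/cvgrPdist_le => e e0.
  have eR : e = (complex.Re e)%:C by rewrite RRe_real// gtr0_real.
  have e0' : 0 < complex.Re e by move: e0; rewrite eR ltcR.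
  have [d d0 Hd] := fl _ e0'.
  rewrite near_withinE; apply/nbhs_normP; exists d%:C; first by rewrite /= ltcR.
  move=> h; rewrite /ball_/= sub0r normrN normcE_ ltcR => hd h0.
  have nh : 0 < normc h.
    by rewrite lt_neqAle normc_ge0 eq_sym andbT; apply: contra h0 => /eqP/eq0_normc/eqP.
  have -> : l - h^-1 *: (f (h *: 1 + z) - f z) = - (f (z + h) - f z - l * h) / h.
    by rewrite /GRing.scale/= mulr1 addrC (addrC h); field.
  by rewrite normcE_ eR lecR normcM normcN normcV ler_pdivrMr// Hd.
Qed.

Lemma derivable_subc (p z : C^o) : derivable (fun z : C^o => z - p : C^o) z 1.
Proof. by apply: derivableB. Qed.

(* squaring makes the quotient differentiable at the zero p itself *)
Lemma derivable_sqr_div (f : C^o -> C^o) (p z : C^o) : (forall z, derivable f z 1) ->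
  f p = 0 -> derivable (fun z : C^o => f z ^+ 2 / (z - p) : C^o) z 1.
Proof.
move=> df fp; have [->|zp] := eqVneq z p.
  have /cvg_ex[/= l fl] := df p.
  apply/cvg_ex; exists (l ^+ 2).
  have : (h^-1 *: (f (h *: 1 + p) - f p)) ^+ 2 @[h --> (0 : C^o)^'] --> (l ^+ 2 : C^o).
    by rewrite expr2; under eq_fun do rewrite expr2; exact: (cvgM fl fl).
  apply: cvg_trans; apply: near_eq_cvg; near=> h.
  have h0 : h != 0 by near: h; exact: nbhs_dnbhs_neq.
  rewrite /= fp subr0 expr0n/= mul0r subr0 /GRing.scale/= mulr1 addrK.
  by rewrite exprMn; field.
have dz := @derivable_subc p z.
have := derivableM (@derivableX _ _ f 2 z 1 (df z)) (derivableV _ dz).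
by apply; rewrite subr_eq0.
Unshelve. all: by end_near. Qed.

Lemma derivable_prod (I : Type) (r : seq I) (P : pred I) (F : I -> C^o -> C^o) (z : C^o) :
  (forall i, derivable (F i) z 1) ->
  derivable (fun w : C^o => \prod_(i <- r | P i) F i w : C^o) z 1.
Proof.
move=> dF; elim: r => [|i r IH].
  rewrite (_ : (fun w => _) = cst 1) ?derivable_cst//.
  by apply/funext => w; rewrite big_nil.
rewrite (_ : (fun w => _) = (if P i then F i \* (fun w => \prod_(i <- r | P i) F i w)
  else (fun w => \prod_(i <- r | P i) F i w))); last first.
  by apply/funext => w; rewrite big_cons; case: ifP.
case: (P i); last exact: IH.
have := @derivableM _ _ (F i) (fun w => \prod_(i <- r | P i) F i w) z 1 (dF i) IH.
exact.
Qed.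

(** As p is injective, at most one factor vanishes at z; it is paired with the square of f, and the
    other factors are inverted. *)
Lemma derivable_sqr_div_prod (f : C^o -> C^o) (p : nat -> C^o) n (z : C^o) :
  (forall z, derivable f z 1) -> (forall i, f (p i) = 0) -> injective p ->
  derivable (fun z : C^o => f z ^+ 2 / \prod_(j < n) (z - p j) : C^o) z 1.
Proof.
move=> df fp pinj.
have dB (j : 'I_n) := @derivable_subc (p j) z.
have [[j zj]|nz] := pselect (exists j : 'I_n, z = p j).
  rewrite (_ : (fun z => _) = (fun w => f w ^+ 2 / (w - p j)) \*
      (fun w => (\prod_(i < n | i != j) (w - p i))^-1)); last first.
    by apply/funext => w; rewrite (bigD1 j)//= invfM mulrA.
  have d1 := @derivable_sqr_div f (p j) z df (fp j).
  have d2 : derivable (fun w : C^o => (\prod_(i < n | i != j) (w - p i))^-1 : C^o) z 1.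
    apply: derivableV; last exact: derivable_prod.
    apply/prodf_neq0 => i ij; rewrite zj subr_eq0; apply: contra ij => /eqP/pinj ij.
    exact/eqP/val_inj.
  have := derivableM d1 d2; exact.
have d2 : derivable (fun w : C^o => (\prod_(i < n) (w - p i))^-1 : C^o) z 1.
  apply: derivableV; last exact: derivable_prod.
  apply/prodf_neq0 => i _; rewrite subr_eq0; apply: contra_notN nz => /eqP zi.
  by exists i.
have := derivableM (@derivableX _ _ f 2 z 1 (df z)) d2; exact.
Qed.

(** f vanishes at the infinitely many points p j of (2, 3]. Applying [mean_value_le] to the entire
    functions f^2 / prod (z - p j) on one fixed circle bounds |f z0|^2 by M^2 / 2^n for every n. *)
Lemma identity_theorem (f : C -> C) : entire f ->
  (forall s : R, 1 < s -> f s%:C = 0) -> forall z, f z = 0.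
Proof.
move=> /entire_cdiff df f0 z0.
have df' (z : C^o) : derivable (f : C^o -> C^o) z 1 by apply/derivable_cdiff.
pose p (j : nat) : C := (2 + (j.+1%:R)^-1)%:C.
have pinj i j : p i = p j -> i = j.
  by move=> []/addrI/invr_inj/eqP; rewrite eqr_nat eqSS => /eqP.
have fp j : f (p j) = 0.
  by apply: f0; rewrite (@lt_le_trans _ _ 2)// ?ltr1n// lerDl invr_ge0.
have pn j : normc (p j) <= 3.
  rewrite normcR ger0_norm ?addr_ge0// ?invr_ge0//.
  have : (j.+1%:R : R)^-1 <= 1 by rewrite invf_le1 ?ltr0n// ler1n.
  by rewrite -(lerD2l 2) => /le_trans; apply; lra.
pose g n (z : C) : C := f z ^+ 2 / \prod_(j < n) (z - p j).
have dg n z : exists l, cdiff (g n) z l.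
  apply/derivable_cdiff.
  exact: derivable_sqr_div_prod.
(* A bounds every |z0 - p j|, and on the circle of radius 3A about z0 every |z - p j| is at least
   2A; each factor of the product thus gains a factor 2. *)
pose A : R := normc z0 + 3; have A0 : 0 < A by rewrite ltr_wpDl ?normc_ge0.
pose x := ln (3 * A).
have ex : expR x = 3 * A by rewrite lnK// posrE mulr_gt0.
have [M0 HM0] := @circle_bounded R f z0 df x.
pose M := Num.max M0 1.
have M1 : 0 < M by rewrite lt_max ltr01 orbT.
have HM t : 0 <= t <= pi *+ 2 -> normc (f (z0 + pol x t)) <= M.
  by move=> /HM0 /le_trans; apply; rewrite le_max lexx.
have normcX (w : C) k : normc (w ^+ k) = normc w ^+ k.
  by elim: k => [|k IH]; rewrite ?normc1// !exprS normcM IH.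
have normc_prod n (F : 'I_n -> C) : normc (\prod_i F i) = \prod_i normc (F i).
  by apply: (big_morph _ (@normcM R) (@normc1 R)).
have [//|fz0] := eqVneq (f z0) 0.
have nf : 0 < normc (f z0).
  by rewrite lt_neqAle normc_ge0 eq_sym andbT; apply: contra fz0 => /eqP/eq0_normc/eqP.
have zp j : z0 - p j != 0.
  by apply: contra fz0; rewrite subr_eq0 => /eqP ->; rewrite fp.
have key n : normc (f z0) ^+ 2 <= M ^+ 2 / 2 ^+ n.
  have G : normc (g n z0) <= M ^+ 2 / (2 * A) ^+ n.
    apply: (@mean_value_le R (g n) z0 x _ (dg n)) => t t0.
    rewrite /g normcM normcV normcX normc_prod.
    rewrite ler_pM ?exprn_ge0 ?normc_ge0 ?invr_ge0 ?prodr_ge0//.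
    - by move=> i _; exact: normc_ge0.
    - by rewrite ler_pXn2r ?nnegrE ?normc_ge0 ?HM// ltW.
    have A2 : 0 < 2 * A by rewrite mulr_gt0.
    have b j : 2 * A <= normc (z0 + pol x t - p j).
      have : normc (pol x t) <= normc (z0 + pol x t - p j) + normc (p j - z0).
        by apply: le_trans (le_normcD _ _); rewrite le_eqVlt; apply/orP; left; apply/eqP; congr normc; ring.
      rewrite normc_pol ex.
      have := normcB (p j) z0; have := pn j; rewrite /A; lra.
    rewrite lef_pV2 ?posrE ?exprn_gt0//; last first.
      by apply: prodr_gt0 => i _; exact: lt_le_trans (b i).
    rewrite -[n in leLHS]card_ord -prodr_const; apply: ler_prod => i _.
    by rewrite b ltW.
  have : normc (f z0) ^+ 2 = normc (g n z0) * \prod_(j < n) normc (z0 - p j).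
    rewrite /g normcM normcV normcX normc_prod mulfVK//.
    by apply/prodf_neq0 => i _; apply: contra (zp i) => /eqP/eq0_normc ->.
  move=> ->.
  have pA : \prod_(j < n) normc (z0 - p j) <= A ^+ n.
    rewrite -[n in leRHS]card_ord -prodr_const; apply: ler_prod => i _.
    by rewrite normc_ge0; apply: le_trans (normcB _ _) _; rewrite lerD2l.
  apply: (le_trans (ler_pM _ _ G pA)); rewrite ?normc_ge0//.
    by apply: prodr_ge0 => i _; exact: normc_ge0.
  rewrite exprMn le_eqVlt; apply/orP; left; apply/eqP; field.
  by rewrite !expf_neq0// ?gt_eqF.
have cv : M ^+ 2 / 2 ^+ n @[n --> \oo] --> (0 : R).
  rewrite -(mulr0 (M ^+ 2)); apply: cvgM; first exact: cvg_cst.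
  under eq_fun do rewrite -exprVn.
  by apply: cvg_expr; rewrite ger0_norm; lra.
have : normc (f z0) ^+ 2 <= 0.
  rewrite -(cvg_lim (@Rhausdorff R) cv); apply: limr_ge; first by apply/cvg_ex; exists 0.
  by near=> n; exact: key.
by rewrite leNgt exprn_gt0.
Unshelve. all: by end_near. Qed.

End IdentityTheorem.

(** * Jacobi's theta identity *)

Section PolyaIdentity.
Variable R : realType.
Local Notation C := R[i].
Implicit Types (x : R) (n l m p : nat).

Let cis x : C := cos x +i* sin x.

Let cisD x y : cis (x + y) = cis x * cis y.
Proof. by rewrite /cis; simpc; rewrite cosD sinD; congr (_ +i* _); ring. Qed.

Let cisX x n : cis x ^+ n = cis (n%:R * x).
Proof.
elim: n => [|n IH]; first by rewrite mul0r /cis cos0 sin0.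
by rewrite exprS IH -cisD -natr1 mulrDl mul1r addrC.
Qed.

Lemma expr_cos2 x n : (2 * cos x) ^+ n =
  \sum_(j < n.+1) 'C(n, j)%:R * cos ((n%:R - 2 * j%:R) * x).
Proof.
have h : cis x + cis (- x) = (2 * cos x)%:C.
  by apply/eqP; rewrite /cis cosN sinN eq_complex/= subrr eqxx andbT; apply/eqP; ring.
apply: complexI; rewrite rmorphXn/= -h exprDn.
pose S : C := \sum_(j < n.+1) cis ((n%:R - 2 * j%:R) * x) *+ 'C(n, j).
rewrite (_ : \sum_(i < n.+1) _ = S); last first.
  apply: eq_bigr => j _; rewrite !cisX -cisD; congr (cis _ *+ _).
  by rewrite natrB; [ring|rewrite -ltnS].
have ReS (I : Type) (r : seq I) (F : I -> C) : complex.Re (\sum_(i <- r) F i) = \sum_(i <- r) complex.Re (F i).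
  by apply: (big_morph (@complex.Re R)) => // -[? ?] [? ?].
have re : complex.Re S = \sum_(j < n.+1) 'C(n, j)%:R * cos ((n%:R - 2 * j%:R) * x).
  rewrite ReS; apply: eq_bigr => j _.
  elim: 'C(n, j) => [|k IH]; first by rewrite mul0r.
  have e (c : R) : k.+1%:R * c = k%:R * c + c by rewrite -natr1; ring.
  rewrite e -IH mulrSr.
  by case: (cis _ *+ k).
have im : complex.Im S = 0.
  have : S = (2 * cos x)%:C ^+ n.
    rewrite -h exprDn; apply: eq_bigr => j _; rewrite !cisX -cisD; congr (cis _ *+ _).
    by rewrite natrB; [ring|rewrite -ltnS].
  by move=> ->; rewrite -rmorphXn.
by rewrite -re; apply/eqP; rewrite eq_complex/= im !eqxx.
Qed.

Lemma sum_cos_telescope x n :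
  2 * sin x * (\sum_(k < n) cos (2 * k%:R * x)) = sin ((2 * n%:R - 1) * x) + sin x.
Proof.
elim: n => [|n IH]; first by rewrite big_ord0 !mulr0 sub0r mulN1r sinN addNr.
rewrite big_ord_recr/= mulrDr IH.
have -> : (2 * n%:R - 1) * x = 2 * n%:R * x - x by ring.
have -> : (2 * n.+1%:R - 1) * x = 2 * n%:R * x + x by rewrite -addn1 natrD; ring.
by rewrite sinB sinD; ring.
Qed.

Lemma sin_piM n : sin (n%:R * pi) = 0 :> R.
Proof.
elim: n => [|n IH]; first by rewrite mul0r sin0.
by rewrite -natr1 mulrDl mul1r sinDpi IH oppr0.
Qed.

Lemma cos2_piM n : cos (n%:R * pi) ^+ 2 = 1 :> R.
Proof. by rewrite cos2sin2 sin_piM expr0n subr0. Qed.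

Lemma sin_pi_div_neq0 n l : (0 < l)%N -> ~~ (l %| n)%N -> sin (n%:R / l%:R * pi) != 0 :> R.
Proof.
move=> l0 ln; rewrite {1}(divn_eq n l) natrD natrM mulrDl mulfK ?pnatr_eq0 -?lt0n// mulrDl.
rewrite sinD sin_piM mul0r add0r mulf_neq0//.
  by rewrite -sqrf_eq0 cos2_piM oner_eq0.
rewrite gt_eqF// sin_gt0_pi//; apply/andP; split.
  by rewrite mulr_gt0 ?pi_gt0// divr_gt0 ?ltr0n// lt0n.
rewrite gtr_pMl ?pi_gt0// ltr_pdivrMr ?ltr0n// mul1r ltr_nat.
by rewrite ltn_pmod.
Qed.

(** Orthogonality of the characters modulo l in real form: if l does not divide n, the telescoped
    sum is zero while its factor sin x is not. *)
Lemma sum_cos_roots n l : (0 < l)%N ->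
  \sum_(k < l) cos (2 * k%:R * (n%:R / l%:R * pi)) = if (l %| n)%N then l%:R else 0 :> R.
Proof.
move=> l0; have l0' : l%:R != 0 :> R by rewrite pnatr_eq0 -lt0n.
case: ifPn => ln.
  have -> : n%:R / l%:R = (n %/ l)%:R :> R.
    by rewrite -{1}(divnK ln) natrM mulfK.
  rewrite (eq_bigr (fun=> 1)) ?big_const_ord ?iter_addr_0// => k _.
  have -> : 2 * k%:R * ((n %/ l)%:R * pi) = ((k * (n %/ l))%:R * pi) *+ 2 :> R.
    by rewrite natrM -mulr_natl; ring.
  by rewrite cos_mulr2n cos2_piM; ring.
have s0 := sin_pi_div_neq0 l0 ln.
have := sum_cos_telescope (n%:R / l%:R * pi) l.
set x := n%:R / l%:R * pi in s0 *.
have -> : (2 * l%:R - 1) * x = (n%:R * pi) *+ 2 - x by rewrite /x -mulr_natl; field.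
rewrite sinB sin_mulr2n sin_piM mulr0 mul0rn mul0r sub0r cos_mulr2n cos2_piM.
rewrite (_ : 1 *+ 2 - 1 = 1); last by ring.
rewrite mul1r addNr => /eqP; rewrite !mulf_eq0 (negbTE s0) pnatr_eq0/= => /eqP.
exact.
Qed.

Lemma sum_multiples (f : nat -> R) l n : (0 < l)%N ->
  \sum_(i < n * l | (l %| i.+1)%N) f i.+1 = \sum_(k < n) f (k.+1 * l)%N.
Proof.
case: l => // l _; elim: n => [|n IH]; first by rewrite !big_ord0.
rewrite big_ord_recr/= -IH -(big_mkord (fun i => (l.+1 %| i.+1)%N) (fun i => f i.+1)).
rewrite (@big_cat_nat _ _ _ (n * l.+1)%N)//=; last by rewrite leq_mul2r leqnSn orbT.
rewrite big_mkord; congr (_ + _).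
rewrite -{1}[(n * l.+1)%N]add0n big_addn mulSn addnK big_mkord big_mkcond big_ord_recr/=.
rewrite big1 ?add0r; last first.
  move=> i _; apply: ifN; apply/negP; move: i => i; rewrite -addSn dvdn_addl ?dvdn_mull// => /dvdn_leq.
  by move=> /(_ isT); rewrite ltnS leqNgt ltn_ord.
by rewrite -addSn dvdn_addl ?dvdn_mull// dvdnn.
Qed.

Lemma sum_odd_symmetric (F : nat -> R) p :
  (forall k, (k < p)%N -> F (p.*2 - k)%N = F k.+1) ->
  \sum_(k < p.*2.+1) F k = F 0%N + 2 * \sum_(k < p) F k.+1.
Proof.
move=> Fsym; rewrite big_ord_recl/=; congr (_ + _).
rewrite -(big_mkord xpredT (fun k => F k.+1)) (@big_cat_nat _ _ _ p)//=; last by rewrite -addnn leq_addr.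
rewrite big_mkord mulr2n mulrDl !mul1r; congr (_ + _).
rewrite -{1}[p]add0n big_addn -addnn addnK big_mkord (reindex_inj rev_ord_inj)/=.
apply: eq_bigr => k _; rewrite -[RHS]Fsym//; congr (F _).
by have := ltn_ord k; rewrite -addnn; lia.
Qed.

(** Sum (2 cos (k pi / l))^(2m) over k modulo l. By [expr_cos2] and [sum_cos_roots] only the
    binomials with l dividing m - j survive. As l is odd, the indices k and l - k pair off and leave
    k = 0 alone, so both sides take the shape of a one-sided theta series. *)
Lemma polya_identity p m : let l := p.*2.+1 in
  4 ^+ m * (1 + 2 * \sum_(k < p) cos (k.+1%:R / l%:R * pi) ^+ (2 * m)%N) =
  l%:R * ('C(2 * m, m)%:R + 2 * \sum_(k < m) 'C(2 * m, m + k.+1 * l)%:R) :> R.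
Proof.
move=> l; have l0 : (0 < l)%N by [].
have l0' : l%:R != 0 :> R by rewrite pnatr_eq0.
pose F k : R := cos (k%:R / l%:R * pi) ^+ (2 * m).
have F0 : F 0%N = 1 by rewrite /F !mul0r cos0 expr1n.
have Fs k : (k < p)%N -> F (p.*2 - k)%N = F k.+1.
  move=> kp; rewrite /F !exprM; congr (_ ^+ m).
  have -> : (p.*2 - k)%:R / l%:R * pi = pi - k.+1%:R / l%:R * pi :> R.
    have -> : (p.*2 - k)%:R = l%:R - k.+1%:R :> R.
      by rewrite -natrB; [congr _%:R|]; rewrite /l -addnn; lia.
    by field.
  by rewrite cosB cospi sinpi mul0r addr0 mulN1r sqrrN.
have := sum_odd_symmetric Fs; rewrite F0 => <-; rewrite -/l mulr_sumr.
transitivity (\sum_(k < l) (2 * cos (k%:R / l%:R * pi)) ^+ (2 * m) : R).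
  apply: eq_bigr => k _; rewrite exprMn [2 ^+ (2 * m)]exprM; congr (_ ^+ m * _).
  by rewrite -natrX.
under eq_bigr do rewrite expr_cos2.
rewrite exchange_big/=.
pose dist j := ((m - j) + (j - m))%N.
pose G j : R := if (l %| dist j)%N then 'C(2 * m, j)%:R else 0.
transitivity (\sum_(j < (2 * m).+1) l%:R * G j).
  apply: eq_bigr => j _; rewrite -mulr_sumr.
  rewrite (_ : \sum_(i < l) _ = if (l %| dist j)%N then l%:R else 0).
    by rewrite /G; case: ifP => _; rewrite ?mulr0// mulrC.
  rewrite -sum_cos_roots//; apply: eq_bigr => k _.
  have [mj|jm] := leqP m j.
    rewrite -cosN; congr cos; rewrite /dist (_ : (m - j + (j - m) = j - m)%N); last by lia.
    by rewrite natrB// natrM; ring.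
  by congr cos; rewrite /dist (_ : (m - j + (j - m) = m - j)%N); [rewrite natrB ?(ltnW jm)// natrM; ring|lia].
rewrite -mulr_sumr mul2n; congr (_ * _).
have Gs k : (k <= m)%N -> G (m - k)%N = G (m + k)%N.
  move=> km; rewrite /G -(@bin_sub _ (m + k)); last by lia.
  have -> : (2 * m - (m + k) = m - k)%N by lia.
  by have -> : (dist (m - k) = dist (m + k))%N by rewrite /dist; lia.
rewrite -(big_mkord xpredT G) (@big_cat_nat _ _ _ m)//=; last by lia.
rewrite (@big_cat_nat _ _ _ m.+1 m)//=; last by lia.
rewrite big_nat1 addrCA.
have Gm : G m = 'C(2 * m, m)%:R by rewrite /G /dist subnn dvdn0.
rewrite Gm mul2n; congr (_ + _).
have Q : \sum_(m.+1 <= i < (m.*2).+1) G i = \sum_(k < m) 'C(2 * m, m + k.+1 * l)%:R.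
  rewrite -(@sum_multiples (fun i => 'C(2 * m, m + i)%:R))//.
  rewrite -{1}[m.+1]add0n big_addn big_mkord.
  have -> : (m.*2.+1 - m.+1 = m)%N by rewrite -addnn; lia.
  rewrite -(big_mkord xpredT (fun i => G (i + m.+1)%N)).
  rewrite -(big_mkord (fun i => (l %| i.+1)%N) (fun i => 'C(2 * m, m + i.+1)%:R)).
  rewrite [RHS](@big_cat_nat _ _ _ m)//=; last by rewrite leq_pmulr.
  rewrite [X in _ + X]big_nat_cond [X in _ + X]big1 ?addr0; last first.
    by move=> i /andP[/andP[mi _] _]; rewrite bin_small//; lia.
  rewrite [RHS]big_mkcond/=; apply: eq_big_nat => i /andP[_ im].
  rewrite /G (_ : dist (i + m.+1) = i.+1)%N; last by rewrite /dist; lia.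
  by rewrite (_ : (i + m.+1 = m + i.+1)%N)//; lia.
rewrite mulr2n mulrDl !mul1r -mul2n -Q mul2n; congr (_ + _).
rewrite -[in RHS](add0n m.+1) big_addn.
have -> : (m.*2.+1 - m.+1 = m)%N by rewrite -addnn; lia.
rewrite !big_mkord (reindex_inj rev_ord_inj)/=; apply: eq_bigr => k _.
by rewrite Gs; [congr G; lia|exact: ltn_ord].
Qed.

End PolyaIdentity.

(** * Limits of series under a common geometric majorant *)

Section Tannery.
Variable R : realType.
Implicit Types (c : nat -> R) (B q : R).

Lemma geo_dominated_sum c B q K n : 0 <= q -> q < 1 -> (forall k, `|c k| <= B * q ^+ k) ->
  `|series c (K + n)%N - series c K| <= B * (q ^+ K - q ^+ (K + n)) / (1 - q).
Proof.
move=> q0 q1 cB; have q1' : 0 < 1 - q by rewrite subr_gt0.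
elim: n => [|n IH]; first by rewrite addn0 !subrr normr0 mulr0 mul0r.
rewrite addnS seriesSr addrAC.
apply: le_trans (ler_normD _ _) _; apply: le_trans (lerD IH (cB _)) _.
rewrite le_eqVlt; apply/orP; left; apply/eqP; rewrite exprS; field.
by rewrite gt_eqF.
Qed.

Lemma geo_dominated_cvg c B q : 0 <= q -> q < 1 -> (forall k, `|c k| <= B * q ^+ k) ->
  cvgn (series c).
Proof.
move=> q0 q1 cB; apply: normed_cvg.
apply: (@series_le_cvg _ _ (fun k => B * q ^+ k)) => //.
- by move=> k /=.
- by move=> k; apply: le_trans (cB k).
- by apply: is_cvg_geometric_series; rewrite ger0_norm.
Qed.

Lemma geo_dominated_tail c B q K : 0 <= q -> q < 1 -> (forall k, `|c k| <= B * q ^+ k) ->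
  `|limn (series c) - series c K| <= B * q ^+ K / (1 - q).
Proof.
move=> q0 q1 cB; have cc := geo_dominated_cvg q0 q1 cB.
have B0 : 0 <= B by have := cB 0%N; rewrite expr0 mulr1; exact: le_trans.
have : `|series c n - series c K| @[n --> \oo] --> `|limn (series c) - series c K|.
  by apply: cvg_norm; apply: cvgB => //; exact: cvg_cst.
move=> cv; rewrite -(cvg_lim (@Rhausdorff R) cv); apply: limr_le; first by apply/cvg_ex; eexists; exact: cv.
near=> n; have Kn : (K <= n)%N by near: n; exists K.
rewrite -(subnKC Kn); apply: le_trans (geo_dominated_sum _ _ q0 q1 cB) _.
rewrite ler_pM2r ?invr_gt0 ?subr_gt0// ler_wpM2l// gerBl exprn_ge0//.
Unshelve. all: by end_near. Qed.

(** The majorant makes both tails beyond some K at most e / 3, uniformly in p; the finite part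
    converges term by term. *)
Lemma tannery (a : nat -> nat -> R) (b : nat -> R) B q : 0 <= q -> q < 1 ->
  (\forall p \near \oo, forall k, `|a p k| <= B * q ^+ k) ->
  (forall k, a p k @[p --> \oo] --> b k) ->
  limn (series (a p)) @[p --> \oo] --> limn (series b).
Proof.
move=> q0 q1 aB ab.
have bB k : `|b k| <= B * q ^+ k.
  have cv : `|a p k| @[p --> \oo] --> `|b k| by apply: cvg_norm; exact: ab.
  rewrite -(cvg_lim (@Rhausdorff R) cv); apply: limr_le; first by apply/cvg_ex; eexists; exact: cv.
  by near=> p; near: p; apply: filterS aB => p; exact.
have B0 : 0 <= B by have := bB 0%N; rewrite expr0 mulr1; exact: le_trans.
apply/cvgrPdist_le => e e0.
have tl : B * q ^+ K / (1 - q) @[K --> \oo] --> (0 : R).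
  rewrite -(mul0r ((1 - q)^-1)) -(mulr0 B); apply: cvgM; last exact: cvg_cst.
  by apply: cvgM; [exact: cvg_cst|apply: cvg_expr; rewrite ger0_norm].
have [K HK] : exists K, B * q ^+ K / (1 - q) <= e / 3.
  have e3 : 0 < e / 3 by rewrite divr_gt0.
  move/cvgrPdist_le : tl => /(_ _ e3)[N _ HN]; exists N.
  have := HN N (leqnn N); rewrite /= sub0r normrN; apply: le_trans; exact: ler_norm.
have sK : series (a p) K @[p --> \oo] --> series b K.
  rewrite /series/=; apply: cvg_big => [|k _]; last exact: ab.
  exact: add_continuous.
have e3 : 0 < e / 3 by rewrite divr_gt0.
near=> p.
have h1 : `|series b K - series (a p) K| <= e / 3.
  by near: p; move/cvgrPdist_le : sK; exact.
have h2 : forall k, `|a p k| <= B * q ^+ k by near: p.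
have h3 := geo_dominated_tail K q0 q1 h2.
have h4 := geo_dominated_tail K q0 q1 bB.
have -> : limn (series b) - limn (series (a p)) =
  (limn (series b) - series b K) + (series b K - series (a p) K) - (limn (series (a p)) - series (a p) K).
  by ring.
apply: le_trans (ler_normB _ _) _; apply: le_trans (lerD (ler_normD _ _) (lexx _)) _.
by lra.
Unshelve. all: by end_near. Qed.

Lemma limn_series_finite c N : (forall k, (N <= k)%N -> c k = 0) ->
  limn (series c) = \sum_(k < N) c k.
Proof.
move=> c0; apply: cvg_lim; first exact: Rhausdorff.
apply: cvg_near_cst; near=> n.
have Nn : (N <= n)%N by near: n; exists N.
rewrite /series/= (@big_cat_nat _ _ _ N)//= big_mkord [X in _ + X]big_nat_cond.
by rewrite [X in _ + X]big1 ?addr0// => k /andP[/andP[+ _] _]; exact: c0.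
Unshelve. all: by end_near. Qed.

End Tannery.

(** * Gaussian bounds for binomial coefficients near the centre *)

Section CentralBinomial.
Variable R : realType.
Implicit Types m r s : nat.

Lemma binS_central m r : ('C(2 * m, m + r.+1) * (m + r.+1) = 'C(2 * m, m + r) * (m - r))%N.
Proof.
rewrite addnS mulnC mul_bin_left mulnC; congr (_ * _)%N.
by rewrite mul2n -addnn subnDl.
Qed.

Definition binratio m r : R := 'C(2 * m, m + r)%:R / 'C(2 * m, m)%:R.

Lemma central_gt0 m : 0 < 'C(2 * m, m)%:R :> R.
Proof. by rewrite ltr0n bin_gt0; lia. Qed.

Lemma binratioS m r : (r < m)%N ->
  binratio m r.+1 = binratio m r * ((m%:R - r%:R) / (m%:R + r.+1%:R)).
Proof.
move=> rm; have h : 'C(2 * m, m + r.+1)%:R * (m%:R + r.+1%:R) = 'C(2 * m, m + r)%:R * (m%:R - r%:R) :> R.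
  by rewrite -natrD -natrB ?(ltnW rm)// -!natrM binS_central.
rewrite /binratio; have c0 := central_gt0 m.
have m0 : 0 < m%:R + r.+1%:R :> R by rewrite -natrD ltr0n; lia.
apply: (@mulIf _ (m%:R + r.+1%:R)); first by rewrite gt_eqF.
move: h m0 c0; set X := (m%:R + _ : R); set Y := ('C(2 * m, m)%:R : R) => h m0 c0.
by rewrite mulrAC h; field; rewrite !gt_eqF.
Qed.

Lemma binratio_ge0 m r : 0 <= binratio m r. Proof. by rewrite divr_ge0. Qed.

(** Each ratio (m - r) / (m + r + 1) is 1 - (2r + 1) / (m + r + 1), hence at most exp(- (2r + 1) /
    (m + s)) as long as r + 1 <= s. The odd numbers add up to a square. *)
Lemma binratio_le m s r : (r <= s)%N -> (s <= m)%N ->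
  binratio m r <= expR (- (r%:R ^+ 2 / (m%:R + s%:R))).
Proof.
move=> rs sm; elim: r rs => [|r IH] rs.
  by rewrite /binratio addn0 divff ?gt_eqF ?central_gt0// expr0n mul0r oppr0 expR0.
have rm : (r < m)%N by apply: leq_trans sm.
have m0 : 0 < m%:R + r.+1%:R :> R by rewrite -natrD ltr0n; lia.
have ms0 : 0 < m%:R + s%:R :> R by rewrite -natrD ltr0n; lia.
rewrite binratioS// -[in leRHS]natr1.
have -> : - ((r%:R + 1) ^+ 2 / (m%:R + s%:R)) = - (r%:R ^+ 2 / (m%:R + s%:R)) - (r%:R + r%:R + 1) / (m%:R + s%:R) :> R.
  by field; rewrite gt_eqF.
rewrite expRD; apply: ler_pM; rewrite ?binratio_ge0 ?IH ?(ltnW rs)//.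
  by rewrite divr_ge0 ?(ltW m0)// subr_ge0 ler_nat ltnW.
have -> : (m%:R - r%:R) / (m%:R + r.+1%:R) = 1 + - ((r%:R + r%:R + 1) / (m%:R + r.+1%:R)) :> R.
  by rewrite -natr1; rewrite -natr1 in m0; field; rewrite gt_eqF.
apply: le_trans (expR_ge1Dx _) _; rewrite ler_expR lerN2 ler_pM2l; last first.
  by rewrite ltr_wpDl// addr_ge0.
by rewrite lef_pV2 ?posrE// lerD2l ler_nat.
Qed.

(** The mirror of [binratio_le]: the same ratio is the inverse of 1 + (2r + 1) / (m - r), and m - r
    >= m - s + 1. *)
Lemma binratio_ge m s r : (r <= s)%N -> (s <= m)%N ->
  expR (- (r%:R ^+ 2 / (m%:R - s%:R + 1))) <= binratio m r.
Proof.
move=> rs sm; elim: r rs => [|r IH] rs.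
  by rewrite /binratio addn0 divff ?gt_eqF ?central_gt0// expr0n mul0r oppr0 expR0.
have rm : (r < m)%N by apply: leq_trans sm.
have m0 : 0 < m%:R + r.+1%:R :> R by rewrite -natrD ltr0n; lia.
have ms0 : 0 < m%:R - s%:R + 1 :> R by rewrite ltr_wpDl// subr_ge0 ler_nat.
have mr0 : 0 < m%:R - r%:R :> R by rewrite subr_gt0 ltr_nat.
rewrite binratioS// -[in leLHS]natr1.
have -> : - ((r%:R + 1) ^+ 2 / (m%:R - s%:R + 1)) = - (r%:R ^+ 2 / (m%:R - s%:R + 1)) - (r%:R + r%:R + 1) / (m%:R - s%:R + 1) :> R.
  by field; rewrite gt_eqF.
rewrite expRD; apply: ler_pM; rewrite ?expR_ge0 ?IH ?(ltnW rs)//.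
have -> : (m%:R - r%:R) / (m%:R + r.+1%:R) = (1 + (r%:R + r%:R + 1) / (m%:R - r%:R))^-1 :> R.
  rewrite -natr1; rewrite -natr1 in m0; field.
  rewrite (gt_eqF mr0)/= (_ : m%:R - r%:R + (_ + 1) = m%:R + (r%:R + 1)); last by ring.
  by rewrite gt_eqF.
have r0 : 0 < r%:R + r%:R + 1 :> R by rewrite ltr_wpDl// addr_ge0.
rewrite expRN lef_pV2 ?posrE ?expR_gt0//; last by rewrite addr_gt0// divr_gt0.
apply: le_trans (expR_ge1Dx _) _; rewrite ler_expR ler_pM2l//.
rewrite lef_pV2 ?posrE//.
by move: rs; rewrite -(ler_nat R) -natr1; lra.
Qed.

(** The Wallis quotient, with limit 1 / pi. Here only a positive limit is established; its value
    follows from the theta identity itself in [jtheta_inv]. *)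
Definition wallis m : R := m%:R * ('C(2 * m, m)%:R / 4 ^+ m) ^+ 2.

Lemma central_S m : 'C(2 * m.+1, m.+1)%:R / 4 ^+ m.+1 =
  'C(2 * m, m)%:R / 4 ^+ m * ((2 * m%:R + 1) / (2 * m%:R + 2)) :> R.
Proof.
have h : ('C(2 * m.+1, m.+1) * m.+1 = 'C(2 * m, m) * (2 * (2 * m + 1)))%N.
  have h1 := mul_bin_diag (2 * m.+1) m.
  have h2 := mul_bin_down (2 * m).+1 m.
  rewrite (_ : ((2 * m.+1).-1 = (2 * m).+1)%N) in h1; last by lia.
  rewrite (_ : ((2 * m).+1 - m = m.+1)%N) in h2; last by lia.
  rewrite /= in h2.
  move: h1 h2; set a := 'C(_, _); set b := 'C(_, _); set c := 'C(_, _); lia.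
have h' : 'C(2 * m.+1, m.+1)%:R * (m%:R + 1) = 'C(2 * m, m)%:R * (2 * (2 * m%:R + 1)) :> R.
  by rewrite natr1 -natrM h !natrM natrD natrM.
have m0 : 0 < m%:R + 1 :> R by rewrite natr1.
apply: (@mulIf _ (m%:R + 1)); first by rewrite gt_eqF.
rewrite mulrAC h' exprS; field.
by rewrite expf_neq0// andbT gt_eqF//; lra.
Qed.

Lemma wallis_nd : nondecreasing_seq wallis.
Proof.
apply/nondecreasing_seqP => m; rewrite /wallis central_S (_ : m.+1%:R = m%:R + 1 :> R); last by rewrite -addn1 natrD.
set b : R := (_ / 4 ^+ m); set x : R := m%:R.
have x0 : 0 <= x by rewrite /x.
have e : (x + 1) * (b * ((2 * x + 1) / (2 * x + 2))) ^+ 2 = b ^+ 2 * ((2 * x + 1) ^+ 2 / (4 * (x + 1))).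
  by field; rewrite !gt_eqF//; lra.
rewrite e mulrC ler_wpM2l ?sqr_ge0// ler_pdivlMr; last by lra.
by nra.
Qed.

(** The shift by 1/2 turns the increasing sequence [wallis] into a decreasing one that starts at
    1/2. *)
Lemma wallis_ub m : (m%:R + 1 / 2) * ('C(2 * m, m)%:R / 4 ^+ m) ^+ 2 <= 1 / 2 :> R.
Proof.
elim: m => [|m IH]; first by rewrite bin0 expr0 divr1 expr1n add0r mulr1.
rewrite central_S; apply: le_trans IH.
rewrite (_ : m.+1%:R = m%:R + 1 :> R); last by rewrite -addn1 natrD.
set b : R := (_ / 4 ^+ m); set x : R := m%:R.
have x0 : 0 <= x by rewrite /x.
have e : (x + 1 + 1 / 2) * (b * ((2 * x + 1) / (2 * x + 2))) ^+ 2 =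
   b ^+ 2 * ((x + 1 + 1 / 2) * (2 * x + 1) ^+ 2 / (4 * (x + 1) ^+ 2)).
  by field; rewrite !gt_eqF//; lra.
rewrite e [leRHS]mulrC ler_wpM2l ?sqr_ge0// ler_pdivrMr; last by nra.
by nra.
Qed.

Lemma wallis_cvg : exists2 A : R, 0 < A & wallis m @[m --> \oo] --> A.
Proof.
have ub m : wallis m <= 1 / 2.
  apply: le_trans (wallis_ub m); rewrite /wallis ler_wpM2r ?sqr_ge0//; lra.
have cv : cvgn wallis.
  apply: nondecreasing_is_cvgn; first exact: wallis_nd.
  by exists (1 / 2) => _ [m _ <-].
exists (limn wallis) => //.
apply: (@lt_le_trans _ _ (wallis 1)).
  by rewrite /wallis muln1 bin1 mul1r exprn_gt0// divr_gt0.
exact: (nondecreasing_cvgn_le wallis_nd).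
Qed.

End CentralBinomial.

(** * Gaussian bounds for powers of the cosine *)

Section CosineBounds.
Variable R : realType.
Implicit Types x : R.

Lemma le_tan x : 0 <= x -> x < pi / 2 -> x <= tan x.
Proof.
rewrite le_eqVlt => /predU1P[<-|x0] xpi; first by rewrite tan0.
have cpos y : 0 <= y <= x -> 0 < cos y.
  by move=> /andP[y0 yx]; apply: cos_gt0_pihalf; apply/andP; split; have := pi_gt0 R; lra.
have [||c cx] := @MVT R tan (fun x => (cos x) ^- 2) 0 x x0.
- move=> y; rewrite in_itv/= => /andP[y0 yx]; apply: is_derive_tan.
  by rewrite gt_eqF// cpos// !ltW.
- apply: continuous_in_subspaceT => y; rewrite inE/= in_itv/= => yx.
  by apply: continuous_tan; rewrite gt_eqF// cpos.
move: cx; rewrite in_itv/= => /andP[c0 cx].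
rewrite tan0 !subr0 => ->; rewrite ler_peMl ?(ltW x0)//.
have ? : 0 < cos c by rewrite cpos// !ltW.
by rewrite invf_ge1 ?exprn_gt0// exprn_ile1 ?cos_le1// ltW.
Qed.

(** Since tan x >= x, cos^2 x is at most 1 / (1 + x^2) = 1 - x^2 / (1 + x^2), which the exponential
    dominates. *)
Lemma cosX_le x m : 0 <= x -> x < pi / 2 ->
  cos x ^+ (2 * m) <= expR (- (m%:R * x ^+ 2 / (1 + x ^+ 2))).
Proof.
move=> x0 xpi; have tx := le_tan x0 xpi.
have c0 : 0 < cos x by apply: cos_gt0_pihalf; apply/andP; split; have := pi_gt0 R; lra.
have p0 : 0 < 1 + x ^+ 2 by rewrite ltr_pwDl// sqr_ge0.
rewrite exprM -mulrA -mulrN expRM_natl.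
apply: lerXn2r; rewrite ?nnegrE ?sqr_ge0 ?expR_ge0//.
have h : cos x ^+ 2 <= (1 + x ^+ 2)^-1.
  rewrite -[leLHS]invrK lef_pV2 ?posrE ?invr_gt0 ?exprn_gt0// cos2_tan2 ?gt_eqF//.
  by rewrite lerD2l ler_pXn2r// nnegrE// (le_trans x0).
apply: le_trans h _; apply: le_trans (expR_ge1Dx _).
by rewrite le_eqVlt; apply/orP; left; apply/eqP; field; rewrite gt_eqF.
Qed.

(** Here cos^2 x >= 1 - x^2, and 1 / (1 - x^2) = 1 + x^2 / (1 - x^2) is at most an exponential. *)
Lemma cosX_ge x m : x ^+ 2 < 1 ->
  expR (- (m%:R * x ^+ 2 / (1 - x ^+ 2))) <= cos x ^+ (2 * m).
Proof.
move=> x1; have p0 : 0 < 1 - x ^+ 2 by rewrite subr_gt0.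
rewrite exprM -mulrA -mulrN expRM_natl.
apply: lerXn2r; rewrite ?nnegrE ?sqr_ge0 ?expR_ge0//.
have h : 1 - x ^+ 2 <= cos x ^+ 2.
  rewrite cos2sin2 lerB// -[leLHS]real_normK ?num_real// -[leRHS]real_normK ?num_real//.
  by rewrite ler_pXn2r ?nnegrE// normr_sin_le.
apply: le_trans h; rewrite expRN -[leRHS]invrK lef_pV2 ?posrE ?invr_gt0 ?expR_gt0//.
apply: le_trans (expR_ge1Dx _).
by rewrite le_eqVlt; apply/orP; left; apply/eqP; field; rewrite gt_eqF.
Qed.

End CosineBounds.

Lemma squeeze_seq (R : realType) (f h g : R^nat) (l : R) :
  (\forall p \near \oo, f p <= g p <= h p) ->
  f p @[p --> \oo] --> l -> h p @[p --> \oo] --> l -> g p @[p --> \oo] --> l.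
Proof. move=> fgh fl hl; exact: (squeeze_cvgr fgh fl hl). Qed.

(** * The limit of the finite identity as m / l^2 tends to c *)

Section JacobiPolya.
Variable R : realType.

Variable c : R.
Hypothesis c0 : 0 < c.
Let l (p : nat) := p.*2.+1.
Let m (p : nat) := Num.truncn (c * (l p)%:R ^+ 2).
Let i p : R := (l p)%:R^-1.
Let u p : R := (m p)%:R * i p ^+ 2.

Let l0 p : 0 < (l p)%:R :> R. Proof. by rewrite ltr0n. Qed.

Let m_itv p : (m p)%:R <= c * (l p)%:R ^+ 2 < (m p)%:R + 1.
Proof.
have := @truncn_itv R (c * (l p)%:R ^+ 2); rewrite mulr_ge0 ?(ltW c0) ?sqr_ge0// => /(_ isT).
by rewrite /m natr1.
Qed.

Let i_cvg : i p @[p --> \oo] --> (0 : R).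
Proof.
apply: (@squeeze_seq _ (cst 0) (fun p => p.+1%:R^-1)).
- near=> p; rewrite /i invr_ge0 ler0n/= lef_pV2 ?posrE ?ltr0n// ler_nat /l -addnn.
  by rewrite ltnS leq_addr.
- exact: cvg_cst.
- exact: cvg_harmonic.
Unshelve. all: by end_near. Qed.

Let u_cvg : u p @[p --> \oo] --> c.
Proof.
apply: (@squeeze_seq _ (fun p => c - i p ^+ 2) (cst c)).
- near=> p; have /andP[h1 h2] := m_itv p; rewrite /u /i.
  have L := l0 p; rewrite exprVn.
  have L2 : 0 < (l p)%:R ^+ 2 :> R by rewrite exprn_gt0.
  apply/andP; split; last by rewrite ler_pdivrMr.
  by rewrite ler_pdivlMr// mulrBl mulVf ?gt_eqF// lerBlDr ltW.
- rewrite -[X in _ --> X]subr0; apply: cvgB; first exact: cvg_cst.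
  rewrite -(mulr0 0); under eq_fun do rewrite expr2; exact: cvgM.
- exact: cvg_cst.
Unshelve. all: by end_near. Qed.

Let m_cvg : m p @[p --> \oo] --> \oo.
Proof.
apply/cvgnyPge => N.
near=> p; have /andP[_ h2] := m_itv p.
rewrite natr1 in h2; rewrite -ltnS -(ltr_nat R); apply: le_lt_trans h2.
have h3 : N%:R / c <= p%:R by near: p; exact: nbhs_infty_ger.
rewrite ler_pdivrMr// in h3; apply: (le_trans h3); rewrite mulrC ler_pM2l// -natrX ler_nat /l -addnn.
by nia.
Unshelve. all: by end_near. Qed.

(** Both finite sums are read as series for [tannery]: [cosT] is cut off at p, while [binT] vanishes
    by itself once (k + 1) l exceeds m. *)
Let cosT p k : R := if (k < p)%N then cos (k.+1%:R / (l p)%:R * pi) ^+ (2 * m p) else 0.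
Let binT p k : R := binratio R (m p) (k.+1 * l p).

Let u_half : \forall p \near \oo, c / 2 < u p.
Proof. by apply: (cvgr_gt c u_cvg); rewrite ltr_pdivrMr// ltr_pMr// ltr1n. Qed.

(** The 5 bounds 1 + x^2, since x < pi / 2 < 2. Replacing u by c / 2 removes the dependence on p,
    and (k + 1)^2 >= k makes the Gaussian geometric. *)
Let cosT_le p k : c / 2 < u p -> `|cosT p k| <= 1 * expR (- (c / 2 * pi ^+ 2 / 5)) ^+ k.
Proof.
move=> up; rewrite /cosT mul1r; case: ifP => kp; last by rewrite normr0 exprn_ge0// expR_ge0.
rewrite ger0_norm; last by rewrite exprM exprn_ge0// sqr_ge0.
set x := (_ / _ * pi).
have x0 : 0 <= x by rewrite mulr_ge0 ?pi_ge0// divr_ge0.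
have xp : x < pi / 2.
  rewrite /x mulrC ltr_pM2l ?pi_gt0// ltr_pdivrMr// mulrC ltr_pdivlMr// -natrM ltr_nat.
  by rewrite /l -addnn; lia.
apply: le_trans (cosX_le _ x0 xp) _; rewrite -expRM_natl ler_expR mulrN lerN2.
have x2 : 1 + x ^+ 2 <= 5.
  have : x < 2 by apply: lt_trans xp _; exact: pihalf_lt2.
  rewrite (_ : 5 = 1 + 2 ^+ 2); last by ring.
  by move=> /ltW x2; rewrite lerD2l lerXn2r ?nnegrE.
have e : (m p)%:R * x ^+ 2 = u p * (k.+1%:R * pi) ^+ 2 by rewrite /x /u /i; field; rewrite gt_eqF.
have p1 : 0 < 1 + x ^+ 2 by rewrite ltr_pwDl// sqr_ge0.
rewrite ler_pdivlMr// e [X in _ <= _ * X]exprMn.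
have k1 : k%:R <= k.+1%:R ^+ 2 :> R by rewrite -natrX ler_nat; nia.
have P0 : 0 < pi ^+ 2 :> R by rewrite exprn_gt0// pi_gt0.
have s1 : k%:R * (c / 2 * pi ^+ 2 / 5) * (1 + x ^+ 2) <= k%:R * (c / 2 * pi ^+ 2 / 5) * 5.
  by rewrite ler_wpM2l// mulr_ge0// divr_ge0// mulr_ge0 ?(ltW P0)// divr_ge0// ltW.
apply: (le_trans s1).
have -> : k%:R * (c / 2 * pi ^+ 2 / 5) * 5 = (c / 2) * (k%:R * pi ^+ 2) by field.
have q1 : 0 <= c / 2 by rewrite divr_ge0// ltW.
have q2 : 0 <= k%:R * pi ^+ 2 :> R by rewrite mulr_ge0// ltW.
by apply: (ler_pM q1 q2 (ltW up)); rewrite ler_pM2r.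
Qed.

Let cosT_dom : \forall p \near \oo, forall k, `|cosT p k| <= 1 * expR (- (c / 2 * pi ^+ 2 / 5)) ^+ k.
Proof. by apply: filterS u_half => p up k; exact: cosT_le. Qed.

(** The signs are written as factors -1 and 1 so that one limit with a parameter serves both ends of
    the squeeze; [binT_itv] is shaped likewise. *)
Let cosT_itv p k (y := k.+1%:R * pi) : (k < p)%N -> (y * i p) ^+ 2 < 1 ->
  expR (- (u p * y ^+ 2 / (1 + -1 * (y * i p) ^+ 2))) <= cosT p k <=
  expR (- (u p * y ^+ 2 / (1 + 1 * (y * i p) ^+ 2))).
Proof.
move=> kp y1; rewrite /cosT kp.
have ex : k.+1%:R / (l p)%:R * pi = y * i p by rewrite /y /i mulrAC.
have e : u p * y ^+ 2 = (m p)%:R * (y * i p) ^+ 2 by rewrite /u; ring.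
rewrite ex e mulN1r mul1r; apply/andP; split; first exact: cosX_ge.
apply: cosX_le; first by rewrite !mulr_ge0 ?pi_ge0// invr_ge0.
rewrite -ex mulrC ltr_pM2l ?pi_gt0// ltr_pdivrMr// mulrC ltr_pdivlMr// -natrM ltr_nat.
by rewrite /l -addnn; lia.
Qed.

Let cosT_cvg k : cosT p k @[p --> \oo] --> expR (- (pi ^+ 2 * k.+1%:R ^+ 2 * c)).
Proof.
pose y : R := k.+1%:R * pi.
have iy2 : (y * i p) ^+ 2 @[p --> \oo] --> (0 : R).
  have iy : y * i p @[p --> \oo] --> (0 : R).
    by rewrite -(mulr0 y); apply: cvgM; [exact: cvg_cst|exact: i_cvg].
  by rewrite -(mulr0 0); under eq_fun do rewrite expr2; exact: (cvgM iy iy).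
have lim (s : R) : expR (- (u p * y ^+ 2 / (1 + s * (y * i p) ^+ 2))) @[p --> \oo] -->
    expR (- (pi ^+ 2 * k.+1%:R ^+ 2 * c)).
  apply: continuous_cvg; first exact: continuous_expR.
  apply: cvgN; have -> : pi ^+ 2 * k.+1%:R ^+ 2 * c = c * y ^+ 2 / (1 + s * 0) by rewrite /y mulr0 addr0 divr1; ring.
  apply: cvgM; first by apply: cvgM; [exact: u_cvg|exact: cvg_cst].
  apply: cvgV; first by rewrite mulr0 addr0 oner_eq0.
  by apply: cvgD; [exact: cvg_cst|apply: cvgM; [exact: cvg_cst|exact: iy2]].
apply: (squeeze_seq _ (lim (-1)) (lim 1)).
near=> p.
apply: cosT_itv; first by near: p; exists k.+1.
by near: p; apply: (cvgr_lt 0 iy2); exact: ltr01.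
Unshelve. all: by end_near. Qed.

(** When (k + 1) l <= m, the denominator m + (k + 1) l in [binratio_le] is at most 2 m <= 2 c
    l^2. *)
Let binT_dom p k : `|binT p k| <= 1 * expR (- (1 / (2 * c))) ^+ k.
Proof.
rewrite mul1r ger0_norm ?binratio_ge0// /binT.
have [km|mk] := leqP (k.+1 * l p) (m p); last first.
  by rewrite /binratio bin_small ?mul0r ?exprn_ge0 ?expR_ge0//; lia.
apply: le_trans (binratio_le _ (leqnn _) km) _.
rewrite -expRM_natl ler_expR mulrN lerN2.
have M0 : 0 < (m p)%:R :> R by rewrite ltr0n; apply: leq_trans km; rewrite muln_gt0.
rewrite ler_pdivlMr ?ltr_pwDl//.
have /andP[h1 _] := m_itv p.
have h2 : (m p)%:R + (k.+1 * l p)%:R <= 2 * c * (l p)%:R ^+ 2 :> R.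
  by have : (k.+1 * l p)%:R <= (m p)%:R :> R; [rewrite ler_nat|lra].
have s1 : k%:R * (1 / (2 * c)) * ((m p)%:R + (k.+1 * l p)%:R) <= k%:R * (1 / (2 * c)) * (2 * c * (l p)%:R ^+ 2).
  by rewrite ler_wpM2l// mulr_ge0// divr_ge0// mulr_ge0// ltW.
apply: (le_trans s1).
have -> : k%:R * (1 / (2 * c)) * (2 * c * (l p)%:R ^+ 2) = k%:R * (l p)%:R ^+ 2 by field; rewrite gt_eqF.
by rewrite natrM exprMn ler_pM2r ?exprn_gt0// -natrX ler_nat; nia.
Qed.

Let binT_itv p k (y := k.+1%:R) : y * i p < u p ->
  expR (- (y ^+ 2 / (u p + - y * i p + 1 * (i p * i p)))) <= binT p k <=
  expR (- (y ^+ 2 / (u p + y * i p + 0 * (i p * i p)))).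
Proof.
move=> yu.
have km : (k.+1 * l p <= m p)%N.
  move: yu.
  rewrite /u /i -(ltr_pM2r (exprn_gt0 2 (l0 p))) exprVn mulfVK ?expf_neq0 ?gt_eqF//.
  have -> : y / (l p)%:R * (l p)%:R ^+ 2 = (k.+1 * l p)%:R by rewrite natrM /y; field; rewrite gt_eqF.
  by rewrite ltr_nat => /ltnW.
have L := l0 p.
have M0 : 0 < (m p)%:R :> R by rewrite ltr0n; apply: leq_trans km; rewrite muln_gt0.
apply/andP; split.
  apply: le_trans (binratio_ge _ (leqnn _) km); rewrite le_eqVlt; apply/orP; left; apply/eqP.
  congr (expR (- _)); rewrite /u /i natrM -/y.
  have d : 0 < (m p)%:R - y * (l p)%:R + 1.
    by rewrite ltr_wpDl// subr_ge0 -natrM ler_nat.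
  have -> : (m p)%:R * (l p)%:R^-1 ^+ 2 + - y * (l p)%:R^-1 + 1 * ((l p)%:R^-1 * (l p)%:R^-1) =
     ((m p)%:R - y * (l p)%:R + 1) / (l p)%:R ^+ 2 by field; rewrite gt_eqF.
  by rewrite invf_div exprMn mulrA.
apply: le_trans (binratio_le _ (leqnn _) km) _; rewrite le_eqVlt; apply/orP; left; apply/eqP.
congr (expR (- _)); rewrite /u /i natrM -/y mul0r addr0.
have d : 0 < (m p)%:R + y * (l p)%:R by rewrite ltr_pwDl// mulr_ge0// ltW.
have -> : (m p)%:R * (l p)%:R^-1 ^+ 2 + y * (l p)%:R^-1 = ((m p)%:R + y * (l p)%:R) / (l p)%:R ^+ 2.
  by field; rewrite gt_eqF.
by rewrite [in RHS]invf_div exprMn -mulrA.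
Qed.

Let binT_cvg k : binT p k @[p --> \oo] --> expR (- (k.+1%:R ^+ 2 / c)).
Proof.
pose y : R := k.+1%:R.
have lim (s t : R) : expR (- (y ^+ 2 / (u p + s * i p + t * (i p * i p)))) @[p --> \oo] -->
    expR (- (y ^+ 2 / c)).
  apply: continuous_cvg; first exact: continuous_expR.
  apply: cvgN; apply: cvgM; first exact: cvg_cst.
  apply: cvgV; first by rewrite gt_eqF.
  have -> : c = c + s * 0 + t * (0 * 0) by ring.
  by apply: cvgD; [apply: cvgD; [exact: u_cvg|]|]; apply: cvgM; rewrite ?mulr0; do ?[exact: cvg_cst|exact: i_cvg]; rewrite -(mulr0 0); exact: cvgM.
apply: (squeeze_seq _ (lim (- y) 1) (lim y 0)).
have h : u p - y * i p @[p --> \oo] --> c - y * 0.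
  by apply: cvgB; [exact: u_cvg|apply: cvgM; [exact: cvg_cst|exact: i_cvg]].
near=> p; apply: binT_itv.
have : 0 < u p - y * i p by near: p; apply: (cvgr_gt _ h); rewrite mulr0 subr0.
by rewrite subr_gt0.
Unshelve. all: by end_near. Qed.

(** Dividing [polya_identity] by 4^m leaves the prefactor l C(2m, m) / 4^m, whose square is [wallis]
    over m / l^2 and therefore has a limit. *)
Let polya_terms p : (0 < m p)%N -> 1 + 2 * limn (series (cosT p)) =
   Num.sqrt (wallis R (m p) / u p) * (1 + 2 * limn (series (binT p))).
Proof.
move=> m0; have L := l0 p; have M0 : 0 < (m p)%:R :> R by rewrite ltr0n.
rewrite (@limn_series_finite _ _ p); last by move=> k pk; rewrite /cosT ltnNge pk.
rewrite (@limn_series_finite _ _ (m p)); last first.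
  move=> k mk; have kl : (k.+1 <= k.+1 * l p)%N by rewrite leq_pmulr.
  by rewrite /binT /binratio bin_small ?mul0r//; lia.
rewrite (eq_bigr (fun k : 'I_p => cos (k.+1%:R / (l p)%:R * pi) ^+ (2 * m p))); last first.
  by move=> k _; rewrite /cosT ltn_ord.
have e4 : 0 < 4 ^+ m p :> R by rewrite exprn_gt0.
apply: (@mulfI _ (4 ^+ m p)); first by rewrite gt_eqF.
rewrite polya_identity -/(l p).
have -> : wallis R (m p) / u p = ((l p)%:R * ('C(2 * m p, m p)%:R / 4 ^+ m p)) ^+ 2.
  by rewrite /wallis /u /i; field; rewrite !gt_eqF.
rewrite sqrtr_sqr ger0_norm; last by rewrite mulr_ge0 ?(ltW L)// divr_ge0// ltW.
have C0 := central_gt0 R (m p).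
rewrite (_ : 4 ^+ m p * _ = (l p)%:R * ('C(2 * m p, m p)%:R * (1 + 2 * \sum_(k < m p) binT p k))); last first.
  by field; rewrite gt_eqF.
congr (_ * _); rewrite [RHS]mulrDr mulr1 [X in _ = _ + X]mulrCA [in RHS]mulr_sumr.
congr (_ + 2 * _).
by apply: eq_bigr => k _; rewrite /binT /binratio mulrC mulfVK// gt_eqF.
Qed.

Lemma polya_limit (A : R) : 0 < A -> wallis R m @[m --> \oo] --> A ->
  1 + 2 * limn (series (fun k => expR (- (pi ^+ 2 * k.+1%:R ^+ 2 * c)))) =
  Num.sqrt (A / c) * (1 + 2 * limn (series (fun k => expR (- (k.+1%:R ^+ 2 / c))))).
Proof.
move=> A0 wA.
have q1 (x : R) : 0 < x -> expR (- x) < 1 by move=> x0; rewrite expR_lt1 oppr_lt0.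
have c1 : 0 < c / 2 * pi ^+ 2 / 5 by rewrite divr_gt0// mulr_gt0 ?divr_gt0// exprn_gt0// pi_gt0.
have c2 : 0 < 1 / (2 * c) by rewrite divr_gt0// mulr_gt0.
have T1 := tannery (expR_ge0 _) (q1 _ c1) cosT_dom cosT_cvg.
have T2 : limn (series (binT p)) @[p --> \oo] --> limn (series (fun k => expR (- (k.+1%:R ^+ 2 / c)))).
  by apply: (tannery (expR_ge0 _) (q1 _ c2) _ binT_cvg); apply: nearW => p k; exact: binT_dom.
have S1 : 1 + 2 * limn (series (cosT p)) @[p --> \oo] -->
   1 + 2 * limn (series (fun k => expR (- (pi ^+ 2 * k.+1%:R ^+ 2 * c)))).
  by apply: cvgD; [exact: cvg_cst|apply: cvgM; [exact: cvg_cst|exact: T1]].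
have S2 : Num.sqrt (wallis R (m p) / u p) * (1 + 2 * limn (series (binT p))) @[p --> \oo] -->
   Num.sqrt (A / c) * (1 + 2 * limn (series (fun k => expR (- (k.+1%:R ^+ 2 / c))))).
  apply: cvgM; last by apply: cvgD; [exact: cvg_cst|apply: cvgM; [exact: cvg_cst|exact: T2]].
  apply: continuous_cvg; first exact: sqrt_continuous.
  apply: cvgM; last by apply: cvgV; [rewrite gt_eqF|exact: u_cvg].
  exact: (cvg_comp _ _ m_cvg wA).
have S3 : Num.sqrt (wallis R (m p) / u p) * (1 + 2 * limn (series (binT p))) @[p --> \oo] -->
   1 + 2 * limn (series (fun k => expR (- (pi ^+ 2 * k.+1%:R ^+ 2 * c)))).
  apply: cvg_trans S1; apply: near_eq_cvg; near=> p; apply: polya_terms.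
  by near: p; move/cvgnyPge : m_cvg; apply.
exact: (cvg_unique _ S3 S2).
Unshelve. all: by end_near. Qed.

End JacobiPolya.

(** * The theta function and its inversion formula *)

Section JacobiTheta.
Variable R : realType.

(** Jacobi's theta function, the sum of exp(- pi n^2 t) over all integers n, folded onto n >= 0. *)
Definition jtheta (t : R) : R :=
  1 + 2 * limn (series (fun k => expR (- (pi * k.+1%:R ^+ 2 * t)))).

Lemma jtheta_cvg (t : R) : 0 < t -> cvgn (series (fun k => expR (- (pi * k.+1%:R ^+ 2 * t)))).
Proof.
move=> t0; apply: (@geo_dominated_cvg _ _ 1 (expR (- (pi * t)))).
- exact: expR_ge0.
- by rewrite expR_lt1 oppr_lt0 mulr_gt0// pi_gt0.
- move=> k; rewrite mul1r -expRM_natl ger0_norm ?expR_ge0// ler_expR mulrN lerN2 mulrAC.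
  rewrite [leRHS]mulrC ler_pM2r ?mulr_gt0 ?pi_gt0// -natrX ler_nat; nia.
Qed.

Lemma jtheta_ge1 (t : R) : 0 < t -> 1 <= jtheta t.
Proof.
move=> t0; rewrite lerDl mulr_ge0//; apply: limr_ge; first exact: jtheta_cvg.
by apply: nearW => n; apply: sumr_ge0 => k _; exact: expR_ge0.
Qed.

Lemma jtheta_inv (t : R) : 0 < t -> jtheta t^-1 = Num.sqrt t * jtheta t.
Proof.
have [A A0 wA] := wallis_cvg R.
have P0 := pi_gt0 R.
have F s : 0 < s -> jtheta s = Num.sqrt (A * pi / s) * jtheta s^-1.
  move=> s0; have := @polya_limit R (s / pi) (divr_gt0 s0 P0) A A0 wA.
  have -> : A / (s / pi) = A * pi / s by rewrite invf_div mulrA.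
  rewrite (_ : (fun k => _) = (fun k => expR (- (pi * k.+1%:R ^+ 2 * s)))); last first.
    apply/funext => k; congr (expR (- _)).
    transitivity (pi * k.+1%:R ^+ 2 * s * (pi / pi) : R); first by ring.
    by rewrite divff ?mulr1// gt_eqF.
  rewrite [in X in _ = X -> _](_ : (fun k => _) = (fun k => expR (- (pi * k.+1%:R ^+ 2 * s^-1)))); last first.
    by apply/funext => k; congr (expR (- _)); rewrite invf_div; ring.
  by [].
(* At s = 1 both sides contain the same nonzero theta value, which forces the unknown Wallis
   constant to be 1 / pi. *)
have A1 : A * pi = 1.
  have := F 1 ltr01; rewrite invr1 mulr1 -{1}[jtheta 1]mul1r => /mulIf.
  rewrite gt_eqF ?(lt_le_trans ltr01)// ?jtheta_ge1// => /(_ isT)/esym h.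
  by rewrite -[LHS]sqr_sqrtr ?h ?expr1n// mulr_ge0// ltW.
move=> t0; have ti : 0 < t^-1 by rewrite invr_gt0.
by rewrite (F _ ti) invrK A1 mul1r.
Qed.

End JacobiTheta.

(** * Integers, ideals and the zeta function of K *)

Section RingOfIntegers.
Variable R : realType.
Local Notation C := R[i].

Lemma rat_algint (q : rat) (p : {poly int}) : p \is monic ->
  (map_poly intr p).[q] = 0 -> exists n : int, q = n%:~R.
Proof.
move=> mp pq.
have A : (ratr q : algC) \in Aint.
  apply: (@root_monic_Aint (map_poly intr p)).
  - rewrite (_ : map_poly _ p = map_poly ratr (map_poly intr p : {poly rat})).
      by rewrite fmorph_root; apply/rootP.
    by rewrite -map_poly_comp; apply: eq_map_poly => n /=; rewrite ratr_int.
  - by rewrite monic_map.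
  - by apply/polyOverP => i; rewrite coef_map /= intr_int.
have := Cint_rat_Aint (Crat_rat q) A.
move=> /intrP[n Hn]; exists n; apply: (fmorph_inj (@ratr algC)).
exact: etrans Hn (esym (ratr_int _ n)).
Qed.

Lemma sqr_rat_int (q : rat) (N : int) : q ^+ 2 = N%:~R -> exists n : int, q = n%:~R.
Proof.
move=> qN; apply: (@rat_algint q ('X^2 - N%:P)); first by rewrite monicXnsubC.
by rewrite rmorphB/= map_polyXn map_polyC/= !hornerE qN subrr.
Qed.

Lemma algebraic_integerE (z : C) : algebraic_integer z <-> integralOver (intr : int -> C) z.
Proof.
split=> [[p [mp pz]]|[p mp /rootP pz]]; first by exists p => //; apply/rootP.
by exists p.
Qed.

Lemma ratr_algebraic_integer (q : rat) : algebraic_integer (ratr q : C) ->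
  exists n : int, q = n%:~R.
Proof.
move=> [p [mp pq]]; apply: (rat_algint mp); apply: (fmorph_inj (@ratr C)).
rewrite rmorph0 -horner_map -[RHS]pq; congr (_.[_]).
by rewrite -map_poly_comp; apply: eq_map_poly => n /=; rewrite ratr_int.
Qed.

Lemma conjc_algebraic_integer (z : C) : algebraic_integer z -> algebraic_integer z^*%C.
Proof.
move=> [p [mp pz]]; exists p; split=> //.
rewrite -[RHS](@conjc0 R) -pz -horner_map; congr (_.[_]).
by rewrite -map_poly_comp; apply: eq_map_poly => n /=; rewrite rmorph_int.
Qed.

(** A and n are the trace and norm of a + b sqrt(-d). The integer d (4n - A^2) is the square of 2db,
    so 2b is an integer B; then 4 divides A^2 + d B^2, which for d = 1, 2 forces A and B to be
    even. *)
Lemma integral_halves (a b : rat) (d : int) (d12 : d = 1 \/ d = 2) (A n : int) :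
  a + a = A%:~R -> a ^+ 2 + d%:~R * b ^+ 2 = n%:~R ->
  exists a' b' : int, a = a'%:~R /\ b = b'%:~R.
Proof.
move=> aA abn.
have E1 : (d%:~R * (b + b)) ^+ 2 = (d * (4 * n - A ^+ 2))%:~R :> rat.
  by rewrite rmorphM rmorphB rmorphM/= rmorphXn/= -aA -abn; ring.
have [e He] := sqr_rat_int E1.
have E2 : e ^+ 2 = d * (4 * n - A ^+ 2).
  by apply: (@intr_inj rat); rewrite -E1 He rmorphXn.
have [B HB] : exists B : int, b + b = B%:~R.
  case: d12 => d1; rewrite d1 in He E2; first by exists e; rewrite -He mul1r.
  have e2 : (2 %| e)%Z.
    have : (2 %| e ^+ 2)%Z by rewrite E2 dvdz_mulr.
    by rewrite !dvdzE abszX Euclid_dvdX// => /andP[].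
  exists (e %/ 2)%Z; apply: (@mulfI _ 2%:~R) => //.
  by rewrite He -rmorphM/= mulrC divzK.
have E3 : A ^+ 2 + d * B ^+ 2 = 4 * n.
  apply: (@intr_inj rat).
  have -> : (A ^+ 2 + d * B ^+ 2)%:~R = A%:~R ^+ 2 + d%:~R * B%:~R ^+ 2 :> rat.
    by rewrite rmorphD rmorphXn rmorphM rmorphXn.
  have -> : (4 * n)%:~R = 4 * n%:~R :> rat by rewrite rmorphM.
  by rewrite -HB -aA -abn; ring.
have [a' [b' [Ha Hb]]] : exists a' b' : int, A = a' + a' /\ B = b' + b'.
  have hA := divz_eq A 2; have hB := divz_eq B 2.
  have mA := modz_ge0 A (isT : (2 : int) != 0); have mA' := ltz_pmod A (isT : (0 : int) < 2).
  have mB := modz_ge0 B (isT : (2 : int) != 0); have mB' := ltz_pmod B (isT : (0 : int) < 2).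
  exists (A %/ 2)%Z, (B %/ 2)%Z.
  move: hA hB mA mA' mB mB'.
  move: (A %/ 2)%Z (A %% 2)%Z (B %/ 2)%Z (B %% 2)%Z => qa ra qb rb hA hB ? ? ? ?.
  have ra01 : ra = 0 \/ ra = 1 by lia.
  have rb01 : rb = 0 \/ rb = 1 by lia.
  rewrite hA hB in E3.
  case: d12 => d1; rewrite d1 in E3; case: ra01 => hr; case: rb01 => hs; subst ra rb; try lia.
exists a', b'; split.
  by apply: (@mulfI _ 2%:~R) => //; rewrite -rmorphM/= (_ : 2 * a' = A)// -?aA; [ring|rewrite Ha; ring].
by apply: (@mulfI _ 2%:~R) => //; rewrite -rmorphM/= (_ : 2 * b' = B)// -?HB; [ring|rewrite Hb; ring].
Qed.

(** For K = Q the second coordinate is lost, as [qgen] is 0 there; the map is injective for the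
    quadratic fields only. *)
Definition qemb (K : qfield) (u : int * int) : C := u.1%:~R + u.2%:~R * qgen R K.

(** K is Q(sqrt(-d)), with d = 0 coding Q; the formula for products of pairs then covers all three
    fields at once. *)
Definition qd (K : qfield) : nat := match K with FQ => 0 | FQi => 1 | FQsqrtm2 => 2 end.

Lemma qgen_sqr K : qgen R K ^+ 2 = - (qd K)%:R.
Proof.
case: K => /=; first by rewrite expr0n oppr0.
  by rewrite sqr_i.
rewrite expr2; apply/eqP; rewrite eq_complex/= !mul0r !mulr0 !addr0 oppr0 sub0r.
rewrite -expr2 sqr_sqrtr// !eqxx.
by [].  
Qed.

(** z plus its conjugate and z times its conjugate are rational algebraic integers, hence integers,
    and [integral_halves] makes both coordinates integral. *)
Lemma OKP K z : OK K z <-> exists u, z = qemb K u.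
Proof.
have gi : algebraic_integer (qgen R K).
  exists ('X^2 + (qd K)%:R%:P); split; first by rewrite monicXnaddC.
  by rewrite rmorphD/= map_polyXn map_polyC/= !hornerE qgen_sqr rmorph_nat addNr.
split=> [[[a [b ->]] ai]|[u ->]]; last first.
  split.
    by exists u.1%:~R, u.2%:~R; rewrite !ratr_int.
  apply/algebraic_integerE; apply: integral_add; first exact: (integral_id (intr : {rmorphism int -> C})).
  apply: integral_mul; first exact: (integral_id (intr : {rmorphism int -> C})).
  exact/algebraic_integerE.
have [K0|K0] := eqVneq (qd K) 0%N.
  have g0 : qgen R K = 0 by case: K K0 {gi ai}.
  rewrite g0 mulr0 addr0 in ai *; have [n ->] := ratr_algebraic_integer ai.
  by exists (n, 0); rewrite /qemb ratr_int/= g0 mulr0 addr0.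
have d12 : (qd K)%:Z = 1 \/ (qd K)%:Z = 2 by case: K K0 {gi ai}; [|left|right].
have gc : (qgen R K)^*%C = - qgen R K.
  by case: K {ai gi d12} K0 => //= _; apply/eqP; rewrite eq_complex/= oppr0 !eqxx.
have rc (q : rat) : (ratr q : C)^*%C = ratr q by apply: fmorph_rat.
clear z; set z := _ + _ in ai *.
have zc : z^*%C = ratr a - ratr b * qgen R K.
  have cD (x y : C) : (x + y)^*%C = x^*%C + y^*%C by apply: rmorphD.
  have cM (x y : C) : (x * y)^*%C = x^*%C * y^*%C by apply: rmorphM.
  have e : (ratr b * qgen R K)^*%C = ratr b * - qgen R K := etrans (cM _ _) (congr2 *%R (rc b) gc).
  rewrite -mulrN; exact: (etrans (cD _ _) (congr2 +%R (rc a) e)).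
have ci := conjc_algebraic_integer ai.
have [A HA] : exists A : int, a + a = A%:~R.
  apply: ratr_algebraic_integer; rewrite rmorphD/=.
  rewrite (_ : ratr a + ratr a = z + z^*%C); last by rewrite zc /z; ring.
  by apply/algebraic_integerE; apply: integral_add; exact/algebraic_integerE.
have [n Hn] : exists n : int, a ^+ 2 + (qd K)%:Z%:~R * b ^+ 2 = n%:~R.
  apply: ratr_algebraic_integer; rewrite rmorphD rmorphXn rmorphM rmorphXn/= ratr_int.
  rewrite (_ : _ + _ = z * z^*%C); last first.
    rewrite zc /z; move: (ratr a) (ratr b) => x y.
    transitivity (x ^+ 2 - y ^+ 2 * qgen R K ^+ 2); last by ring.
    by rewrite qgen_sqr mulrN opprK mulrC.
  by apply/algebraic_integerE; apply: integral_mul; exact/algebraic_integerE.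
have [a' [b' [ea eb]]] := integral_halves d12 HA Hn.
by exists (a', b'); rewrite /qemb /z ea eb !ratr_int.
Qed.

End RingOfIntegers.

(** * Ideals and primes of a Euclidean ring of integers *)

Section EuclideanIdeals.
Variable R : realType.
Local Notation C := R[i].
Variable K : qfield.
Local Notation O := (@OK R K).
Implicit Types (x y z : C) (I P Q : set C).

Lemma OKB x y : O x -> O y -> O (x - y).
Proof.
move=> /OKP[u ->] /OKP[v ->]; apply/OKP; exists (u.1 - v.1, u.2 - v.2).
by rewrite /qemb/= !rmorphB/=; ring.
Qed.

Lemma OK0 : O 0.
Proof. by apply/OKP; exists (0, 0); rewrite /qemb/= mul0r addr0. Qed.

Lemma OK1 : O 1.
Proof. by apply/OKP; exists (1, 0); rewrite /qemb/= mul0r addr0. Qed.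

Lemma OKD x y : O x -> O y -> O (x + y).
Proof. by move=> Ox Oy; rewrite -[y]opprK -[- y]sub0r; do !apply: OKB => //; exact: OK0. Qed.

Lemma OKM x y : O x -> O y -> O (x * y).
Proof.
move=> /OKP[u ->] /OKP[v ->]; apply/OKP.
exists (u.1 * v.1 - (qd K)%:Z * (u.2 * v.2), u.1 * v.2 + u.2 * v.1).
rewrite /qemb/= !(rmorphB, rmorphD, rmorphM)/=.
transitivity (u.1%:~R * v.1%:~R + u.2%:~R * v.2%:~R * qgen R K ^+ 2 + (u.1%:~R * v.2%:~R + u.2%:~R * v.1%:~R) * qgen R K : C).
  by ring.
by rewrite qgen_sqr; ring.
Qed.

Variable nm : C -> nat.

Definition principal x : set C := [set x * y | y in O].

(** The interface between the norm and ideal theory: [nm_div] makes ideals principal, [nm_index]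
    identifies the norm of a generator with the index of its ideal, and [nm_fin] makes the partial
    Euler products finite. *)
Record euclidean_norm : Prop := {
  nmM : forall x y, O x -> O y -> nm (x * y) = (nm x * nm y)%N;
  nm_eq0 : forall x, O x -> (nm x == 0%N) = (x == 0);
  nm1V : forall x, O x -> nm x = 1%N -> O x^-1;
  nm_div : forall x y, O x -> O y -> y != 0 -> exists2 q, O q & (nm (x - y * q)%R < nm y)%N;
  nm_fin : forall n, finite_set [set x | O x /\ (nm x <= n)%N];
  nm_index : forall x, O x -> x != 0 -> has_index K (principal x) (nm x) }.

Hypothesis N : euclidean_norm.

Lemma nm_one : nm 1 = 1%N.
Proof.
have h := nmM N OK1 OK1; rewrite mulr1 in h.
have := nm_eq0 N OK1; rewrite oner_eq0; case: (nm 1) h => // -[//|n]; nia.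
Qed.

Lemma nm_gt0 x : O x -> x != 0 -> (0 < nm x)%N.
Proof. by move=> Ox x0; rewrite lt0n nm_eq0. Qed.

Lemma principal_ideal x : O x -> is_ideal K (principal x).
Proof.
move=> Ox; split.
- by move=> _ [y Oy <-]; exact: OKM.
- by exists 0; [exact: OK0|rewrite mulr0].
- by move=> _ _ [y Oy <-] [z Oz <-]; exists (y - z); [exact: OKB|rewrite mulrBr].
- by move=> a _ Oa [y Oy <-]; exists (a * y); [exact: OKM|rewrite mulrCA].
Qed.

Lemma principal_mem x : principal x x.
Proof. by exists 1; [exact: OK1|rewrite mulr1]. Qed.

(** Sending a representative of the first system to its class in the second is injective. By
    symmetry the index is unique, so the [xget] in [ideal_norm] has no freedom. *)
Lemma has_index_le I m n : is_ideal K I -> has_index K I m -> has_index K I n -> (m <= n)%N.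
Proof.
move=> [IO I0 IB IM] [f [fO fu]] [g [gO gu]].
have s (k : 'I_m) : {j : 'I_n | I (f k - g j)}.
  by apply: cid; have [j [Ij _]] := gu _ (fO k); exists j.
have si : injective (fun k => sval (s k)).
  move=> k k' e.
  have h1 := svalP (s k); have h2 := svalP (s k'); rewrite /= e in h1.
  have [j [_ ju]] := fu _ (fO k).
  have a : j = k by apply: ju; rewrite subrr.
  have b : j = k'.
    apply: ju.
    have h3 := IB _ _ h1 h2.
    by rewrite (_ : _ - _ = (f k - g (sval (s k'))) - (f k' - g (sval (s k')))) //; ring.
  by rewrite -a -b.
by have := leq_card _ si; rewrite !card_ord.
Qed.

Lemma ideal_norm_index I n : is_ideal K I -> has_index K I n -> ideal_norm K I = n.
Proof.
move=> iI hn; rewrite /ideal_norm; case: xgetP => [m _ hm|/(_ n)//].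
by apply/eqP; rewrite eqn_leq !(has_index_le iI).
Qed.

Lemma ideal_norm_principal x : O x -> x != 0 -> ideal_norm K (principal x) = nm x.
Proof. by move=> Ox x0; apply: ideal_norm_index; [exact: principal_ideal|exact: nm_index]. Qed.

Lemma ideal_principal I : is_ideal K I -> (exists x, I x /\ x != 0) ->
  exists x, [/\ O x, x != 0, I x & I = principal x].
Proof.
move=> [IO I0 IB IM] [x0 [Ix0 x00]].
have [n [x [[Ix xn0 xn] min]]] : exists n x, [/\ I x, x != 0 & nm x = n] /\
    (forall y, I y -> y != 0 -> (n <= nm y)%N).
  pose p n := `[< exists x, [/\ I x, x != 0 & nm x = n] >].
  have ex : exists n, p n by exists (nm x0); apply/asboolP; exists x0.
  case: (ex_minnP ex) => n /asboolP[x hx] min; exists n, x; split => // y Iy y0.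
  by apply: min; apply/asboolP; exists y.
exists x; split => //; first exact: IO.
apply/seteqP; split => [y Iy|_ [y Oy <-]]; last by rewrite mulrC; exact: IM.
have [q Oq qlt] := nm_div N (IO _ Iy) (IO _ Ix) xn0.
have [yq|yq] := eqVneq (y - x * q) 0.
  by exists q => //; apply/esym/eqP; rewrite -subr_eq0 yq.
have Iyq : I (y - x * q) by apply: IB => //; rewrite mulrC; exact: IM.
by have := min _ Iyq yq; rewrite -xn leqNgt qlt.
Qed.

Lemma prime_ideal_generator P : prime_ideal K P ->
  exists x, [/\ O x, x != 0, P x, P = principal x & ideal_norm K P = nm x].
Proof.
move=> [iP P0 _ _]; have [x [Ox x0 Px PE]] := ideal_principal iP P0.
by exists x; split => //; rewrite PE ideal_norm_principal.
Qed.

(** Nonzero primes are maximal: write x = y z with y a generator of Q. Either y lies in P and the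
    ideals agree, or z = x v, which makes y v = 1 and Q improper. *)
Lemma prime_ideal_inj P Q x : prime_ideal K P -> prime_ideal K Q ->
  O x -> x != 0 -> P = principal x -> Q x -> P = Q.
Proof.
move=> [iP _ P1 Pp] pQ Ox x0 PE Qx.
have [y [Oy y0 Qy QE _]] := prime_ideal_generator pQ.
case: pQ => [[QO _ _ QM] _ Q1 _].
have := Qx; rewrite {1}QE => -[z Oz yz].
have Px : P x by rewrite PE; exact: principal_mem.
have [|Py|] := Pp y z Oy Oz; first by rewrite yz.
- apply/seteqP; split => w.
    by rewrite PE => -[v Ov <-]; rewrite mulrC; exact: QM.
  by rewrite QE => -[v Ov <-]; rewrite mulrC; case: iP => _ _ _; apply.
- rewrite PE => -[v Ov zv]; exfalso; apply: Q1.
  have : x * (y * v) = x * 1 by rewrite mulr1 -[RHS]yz -zv; ring.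
  by move=> /(mulfI x0) <-; rewrite mulrC; exact: QM.
Qed.

(** A divisor y of x of least norm above 1 generates a prime. If a b lies in (y) and a does not, a
    generator of (y, a) divides y; by minimality it is a unit, which puts b in (y), or an associate
    of y, which would put a in (y). *)
Lemma exists_prime_ideal x : O x -> (1 < nm x)%N ->
  exists P, [/\ prime_ideal K P, P x & (ideal_norm K P <= nm x)%N].
Proof.
move=> Ox x1.
have x0 : x != 0 by rewrite -nm_eq0// -lt0n (ltn_trans _ x1).
pose p n := `[< exists y, [/\ O y, (1 < nm y)%N, nm y = n & exists2 z, O z & x = y * z] >].
have ex : exists n, p n.
  by exists (nm x); apply/asboolP; exists x; split => //; exists 1; [exact: OK1|rewrite mulr1].
case: (ex_minnP ex) => n /asboolP[y [Oy y1 yn [z Oz xyz]]] min.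
have y0 : y != 0 by rewrite -nm_eq0// -lt0n (ltn_trans _ y1).
have z0 : z != 0 by apply: contraNneq x0 => z0; rewrite xyz z0 mulr0.
have iP := principal_ideal Oy; have [PO P0 PB PM] := iP.
exists (principal y); split; last 2 first.
- by exists z.
- by rewrite ideal_norm_principal// xyz nmM// leq_pmulr// nm_gt0.
split => //.
- by exists y; split => //; exact: principal_mem.
- move=> [v Ov yv]; have := nmM N Oy Ov; rewrite yv nm_one => /esym/eqP.
  by rewrite muln_eq1 => /andP[/eqP yy _]; rewrite yy in y1.
move=> a b Oa Ob Pab.
have [Pa|nPa] := pselect (principal y a); first by left.
right; pose J : set C := [set w | exists u v, [/\ O u, O v & w = y * u + a * v]].
have iJ : is_ideal K J.
  split.
  - by move=> _ [u [v [Ou Ov ->]]]; apply: OKD; exact: OKM.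
  - by exists 0, 0; split; [exact: OK0|exact: OK0|rewrite !mulr0 addr0].
  - move=> _ _ [u [v [Ou Ov ->]]] [u' [v' [Ou' Ov' ->]]].
    by exists (u - u'), (v - v'); split; [exact: OKB|exact: OKB|ring].
  - move=> c _ Oc [u [v [Ou Ov ->]]].
    by exists (c * u), (c * v); split; [exact: OKM|exact: OKM|ring].
have Jy : J y by exists 1, 0; split; [exact: OK1|exact: OK0|ring].
have Ja : J a by exists 0, 1; split; [exact: OK0|exact: OK1|ring].
have [dl [Od d0 Jd JE]] := ideal_principal iJ (ex_intro _ y (conj Jy y0)).
have := Jy; rewrite JE => -[w Ow ydw].
have w0 : w != 0 by apply: contraNneq y0 => w0; rewrite -ydw w0 mulr0.
have [d1|d1] := leqP (nm dl) 1.
  have {}d1 : nm dl = 1%N by apply/eqP; rewrite eqn_leq d1 nm_gt0.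
  have : J 1 by rewrite JE; exists dl^-1; [exact: nm1V|rewrite mulfV].
  move=> [u [v [Ou Ov e]]].
  have -> : b = (u * b) * y + v * (a * b) by rewrite -[LHS]mul1r e; ring.
  have m1 : principal y (u * b * y) by apply: PM; [exact: OKM|exact: principal_mem].
  have m2 : principal y (v * (a * b)) by exact: PM.
  rewrite -[v * _]opprK; apply: (PB _ _ m1); rewrite -[- _]sub0r; exact: (PB _ _ P0 m2).
exfalso; apply: nPa.
have nd : (nm y <= nm dl)%N.
  rewrite yn; apply: min; apply/asboolP; exists dl; split => //.
  by exists (w * z); [exact: OKM|rewrite mulrA ydw].
have w1 : nm w = 1%N.
  have := nmM N Od Ow; rewrite ydw => e; rewrite e in nd.
  apply/eqP; rewrite eqn_leq nm_gt0// andbT -(leq_pmul2l (nm_gt0 Od d0)) muln1//.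
have := Ja; rewrite JE => -[t Ot <-].
exists (w^-1 * t); first by apply: OKM => //; exact: nm1V.
by rewrite -ydw; field.
Qed.

Lemma finite_prime_ideals n : finite_set [set P : set C | prime_ideal K P /\ (ideal_norm K P <= n)%N].
Proof.
apply: (sub_finite_set _ (finite_image principal (nm_fin N n))) => P [pP].
have [x [Ox x0 Px -> ->]] := prime_ideal_generator pP.
by move=> xn; exists x.
Qed.

End EuclideanIdeals.

(** For an infinite set the list is empty by default, whence the finiteness side condition in
    [mem_elems]. *)
Definition elems (T : choiceType) (X : set T) : seq T := finmap.enum_fset (fset_set X).

Lemma mem_elems (T : choiceType) (X : set T) x : finite_set X -> (x \in elems X) = (x \in X).
Proof. by move=> fX; rewrite -(in_fset_set fX). Qed.

Lemma elems_uniq (T : choiceType) (X : set T) : uniq (elems X).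
Proof. exact: finmap.fset_uniq. Qed.

Lemma esum_subset (R : realType) (T : choiceType) (A B : set T) (a : T -> \bar R) :
  A `<=` B -> (forall x, 0 <= a x)%E ->
  (\esum_(x in A) a x <= \esum_(x in B) a x)%E.
Proof.
move=> AB a0; rewrite [leRHS](esumID A)// (setIidr AB) leeDl// esum_ge0//.
Qed.

Lemma esumZl (R : realType) (T : choiceType) (A : set T) (a : T -> \bar R) (c : R) :
  0 < c -> (forall x, 0 <= a x)%E ->
  (\esum_(x in A) (c%:E * a x) = c%:E * \esum_(x in A) a x)%E.
Proof.
have le (d : R) (b : T -> \bar R) : 0 < d -> (forall x, 0 <= b x)%E ->
    (\esum_(x in A) (d%:E * b x) <= d%:E * \esum_(x in A) b x)%E.
  move=> d0 b0; apply: ge_ereal_sup => _ [X [finX XA] <-].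
  rewrite -ge0_mule_fsumr//; apply: lee_wpmul2l; first by rewrite lee_fin ltW.
  by apply: ereal_sup_ubound; exists X.
move=> c0 a0; apply/eqP; rewrite eq_le le//=.
have c1 : 0 < c^-1 by rewrite invr_gt0.
have ca x : (0 <= c%:E * a x)%E by rewrite mule_ge0// lee_fin ltW.
have := le _ _ c1 ca.
rewrite (eq_esum (b := a)); last first.
  by move=> x _; rewrite muleA -EFinM mulVf ?mul1e// gt_eqF.
move=> /(lee_wpmul2l (ltW c0 : (0 <= c%:E)%E)).
by rewrite muleA -EFinM mulfV ?mul1e// gt_eqF.
Qed.

(** * The Euler product as a sieve on elements *)

Section EulerProduct.
Variable R : realType.
Local Notation C := R[i].
Variables (K : qfield) (nm : C -> nat).
Hypothesis N : euclidean_norm K nm.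
Local Notation O := (@OK R K).
Variable s : R.
Hypothesis s0 : 0 < s.
Implicit Types (x y : C) (P : set C).
Local Open Scope ereal_scope.

Let F x : \bar R := (powR (nm x)%:R (- s))%:E.

Let F0 x : 0 <= F x. Proof. by rewrite lee_fin powR_ge0. Qed.

Let FM x y : O x -> O y -> F (x * y)%R = F x * F y.
Proof. by move=> Ox Oy; rewrite /F (nmM N)// natrM powRM. Qed.

(** What survives sieving by the primes in l. Elements are summed instead of ideals, so the units
    appear as a final factor. *)
Let A (l : seq (set C)) : set C := [set x | [/\ O x, x != 0%R & forall P, P \in l -> ~ P x]].

Let dirichlet := \esum_(x in A [::]) F x.
Hypothesis Ffin : dirichlet < +oo.

Let AS l l' : {subset l <= l'} -> A l' `<=` A l.
Proof. by move=> ll x [Ox x0 xl]; split => // P /ll; exact: xl. Qed.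

Let A_fin l : \esum_(x in A l) F x \is a fin_num.
Proof.
rewrite ge0_fin_numE; last by apply: esum_ge0.
apply: le_lt_trans Ffin; rewrite /dirichlet (esumID (A l) (A [::]))//.
by rewrite (setIidr (@AS [::] l _))// leeDl// esum_ge0.
Qed.

(** The elements of A l lying in P are exactly z (A l), with z a generator of P; they carry the
    fraction N(P)^(-s) of the sum. *)
Let sieve_step P l : (forall Q, Q \in P :: l -> prime_ideal K Q) -> P \notin l ->
  fine (\esum_(x in A (P :: l)) F x) =
  (fine (\esum_(x in A l) F x) * (1 - powR (ideal_norm K P)%:R (- s)))%R.
Proof.
move=> pl Pl; have pP := pl P (mem_head _ _).
have [z [Oz z0 Pz PE nP]] := prime_ideal_generator N pP.
have -> : A (P :: l) = A l `&` ~` P.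
  apply/seteqP; split => x.
    move=> [Ox x0 xP]; split; last exact: xP (mem_head _ _).
    by split => // Q Ql; apply: xP; rewrite inE Ql orbT.
  by move=> [[Ox x0 xl] nPx]; split => // Q; rewrite inE => /orP[/eqP->//|]; exact: xl.
have E : A l `&` P = (fun x => (z * x)%R) @` A l.
  apply/seteqP; split => x.
    move=> [[Ox x0 xl] Px]; move: (Px); rewrite {1}PE => -[y Oy zy]; exists y => //.
    split => //; first by apply: contraNneq x0 => y0; rewrite -zy y0 mulr0.
    move=> Q Ql Qy; apply: (xl Q Ql); rewrite -zy.
    have [[_ _ _ QM] _ _ _] := pl Q (mem_behead (s:=P :: l) Ql); exact: QM.
  move=> [y [Oy y0 yl] <-]; split; last first.
    by rewrite mulrC; case: pP => -[_ _ _ PM] _ _ _; exact: PM.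
  split; [exact: OKM|by rewrite mulf_neq0|move=> Q Ql Qzy].
  have pQ := pl Q (mem_behead (s:=P :: l) Ql).
  have [_ _ _ Qp] := pQ; have [Qz|Qy] := Qp _ _ Oz Oy Qzy; last exact: yl Ql Qy.
  by move: Pl; rewrite (prime_ideal_inj N pP pQ Oz z0 PE Qz) Ql.
have := esumID P (A l) F (fun x _ => F0 x).
rewrite E esum_image; last by move=> x y _ _; exact: mulfI.
have Fz0 : (0 < powR (nm z)%:R (- s))%R by rewrite powR_gt0// ltr0n (nm_gt0 N).
rewrite (_ : \esum_(i in A l) F (z * i)%R = F z * \esum_(i in A l) F i); last first.
  by rewrite -esumZl//; apply: eq_esum => x [Ox _ _]; rewrite FM.
have B_fin : \esum_(i in A l `&` ~` P) F i \is a fin_num.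
  rewrite ge0_fin_numE; last exact: esum_ge0.
  have := A_fin l; rewrite ge0_fin_numE; last exact: esum_ge0.
  by apply: le_lt_trans; rewrite [leRHS](esumID P)// leeDr// esum_ge0.
move: (A_fin l) B_fin; move: (\esum_(i in A l) F i) (\esum_(i in A l `&` ~` P) F i) => [a| |] [b| |]//= _ _.
rewrite /F nP -EFinM -EFinD => -[ab]; lra.
Qed.

Let sieve l : (forall Q, Q \in l -> prime_ideal K Q) -> uniq l ->
  fine (\esum_(x in A l) F x) =
  (fine dirichlet * \prod_(P <- l) (1 - powR (ideal_norm K P)%:R (- s)))%R.
Proof.
elim: l => [_ _|P l IH pl /= /andP[Pl ul]]; first by rewrite big_nil mulr1.
rewrite sieve_step// big_cons IH//; first by ring.
by move=> Q Ql; apply: pl; rewrite inE Ql orbT.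
Qed.

Let tail n := \esum_(x in [set x | O x /\ (n < nm x)%N]) F x.

Let tail_cvg (e : R) : (0 < e)%R -> exists n0, forall n, (n0 <= n)%N -> tail n <= e%:E.
Proof.
move=> e0.
have Tfin : dirichlet \is a fin_num by exact: A_fin.
have [_ [X [finX XA] <-] HX] := ub_ereal_sup_adherent e0 Tfin.
have [n0 Hn0] : exists n0, forall x, X x -> (nm x <= n0)%N.
  exists (\max_(x <- elems X) nm x)%N => x Xx.
  by apply: leq_bigmax_seq => //; rewrite mem_elems// inE.
exists n0 => n n0n.
have XE : \sum_(x \in X) F x = \esum_(x in X) F x by rewrite esum_fset.
have h : \esum_(x in X) F x + tail n <= dirichlet.
  rewrite /dirichlet (esumID X (A [::]))// (setIidr XA) leeD2l// /tail.
  apply: esum_subset => // x [Ox nx]; split; last by move=> /Hn0; rewrite leqNgt (leq_ltn_trans n0n).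
  by split => //; rewrite -(nm_eq0 N)// -lt0n (leq_ltn_trans _ nx).
have t0 : 0 <= tail n by exact: esum_ge0.
have HX' : dirichlet - e%:E < \esum_(x in X) F x by rewrite -XE.
move: HX' h t0 Tfin {HX}.
have : 0 <= \esum_(x in X) F x by exact: esum_ge0.
move: (\esum_(x in X) F x) (tail n) dirichlet => [a| |] [b| |] [c| |]//= _.
rewrite -EFinB -EFinD !lee_fin !lte_fin => h1 h2 _ _; lra.
Qed.

Let units : set C := [set x | O x /\ nm x = 1%N].

Let units_fin : finite_set units.
Proof. by apply: sub_finite_set (nm_fin N 1) => x [Ox x1]; split; rewrite ?x1. Qed.

Let unitsE : \esum_(x in units) F x = ((size (elems units))%:R)%:E.
Proof.
rewrite esum_fset// fsbig_finite//= (eq_big_seq (fun=> 1%:E)); last first.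
  by move=> x; rewrite mem_elems// inE => -[_ x1]; rewrite /F x1 powR1.
by rewrite sumEFin big_const_seq count_predT iter_addr_0.
Qed.

Let primes n : set (set C) := [set P | prime_ideal K P /\ (ideal_norm K P <= n)%N].

(** Units lie in no prime and always survive; a surviving nonunit has norm above n, for otherwise
    [exists_prime_ideal] would have removed it. *)
Let sieve_bounds n (l := elems (primes n)) :
  ((size (elems units))%:R)%:E <= \esum_(x in A l) F x <= ((size (elems units))%:R)%:E + tail n.
Proof.
have lP P : P \in l -> prime_ideal K P /\ (ideal_norm K P <= n)%N.
  by rewrite mem_elems ?inE//; exact: finite_prime_ideals N n.
rewrite -unitsE; apply/andP; split.
  apply: esum_subset => // x [Ox x1]; split => //.
    by rewrite -(nm_eq0 N)// x1.
  move=> P /lP[pP _] Px; case: (pP) => -[_ _ _ PM] _ P1 _; apply: P1.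
  rewrite -(@mulVf _ x); first by apply: PM => //; exact: (nm1V N).
  by rewrite -(nm_eq0 N)// x1.
rewrite (esumID units (A l))//; apply: leeD; apply: esum_subset => // x.
move=> [[Ox x0 xl] nu]; split => //; rewrite ltnNge; apply/negP => xn.
have x1 : (1 < nm x)%N.
  by rewrite ltn_neqAle (nm_gt0 N)// andbT eq_sym; apply/eqP => x1; apply: nu.
have [P [pP Px Pn]] := exists_prime_ideal N Ox x1.
apply: (xl P) => //; rewrite mem_elems ?inE//; last exact: finite_prime_ideals N n.
by split => //; exact: leq_trans xn.
Qed.

(** The sieved sum is the full sum divided by the partial Euler product, and it tends to the number
    w of units since the tail beyond norm n tends to 0. *)
Lemma dedekind_zeta_dirichlet : (0 < size (elems [set x | O x /\ nm x = 1%N]))%N ->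
  dedekind_zeta K s =
  (fine (\esum_(x in [set x | O x /\ x != 0%R]) F x) / (size (elems [set x | O x /\ nm x = 1%N]))%:R)%R.
Proof.
move=> w0; set w : R := (size _)%:R; have {}w0 : (0 < w)%R by rewrite ltr0n.
have -> : \esum_(x in [set x | O x /\ x != 0%R]) F x = dirichlet.
  rewrite /dirichlet; congr (esum _ _); apply/seteqP; split => x; first by move=> [].
  by move=> [].
pose Z n := fine (\esum_(x in A (elems (primes n))) F x).
have Zb n : (w <= Z n)%R /\ (Z n)%:E <= w%:E + tail n.
  have /andP[h1 h2] := sieve_bounds n.
  have Zf := A_fin (elems (primes n)).
  by split; [rewrite -lee_fin|]; rewrite /Z fineK.
have Zw : Z n @[n --> \oo] --> w.
  apply/cvgrPdist_le => e e0; have [n0 Hn0] := tail_cvg e0.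
  exists n0 => // n /= n0n; have [h1 h2] := Zb n.
  have h3 : (Z n)%:E <= w%:E + e%:E by apply: le_trans h2 _; rewrite leeD2l// Hn0.
  rewrite -EFinD lee_fin in h3.
  by rewrite distrC ger0_norm ?subr_ge0// lerBlDl.
apply/cvg_lim => //.
rewrite (_ : euler_partial K s = fun n => (fine dirichlet / Z n)%R).
  by apply: cvgM; [exact: cvg_cst|apply: cvgV => //; rewrite gt_eqF].
apply/funext => n; have [h1 _] := Zb n.
have finP : finite_set (primes n) by exact: finite_prime_ideals N n.
have e := @sieve (elems (primes n)) _ (elems_uniq _).
rewrite /Z e; last by move=> Q; rewrite mem_elems ?inE// => -[].
rewrite /euler_partial fsbig_finite//= prodfV invfM mulrA mulfV ?mul1r//.
(* The full sum is nonzero: otherwise the sieved sum would vanish, although it is at least w. *)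
apply/eqP => d0; move: h1; rewrite /Z e; last by move=> Q; rewrite mem_elems ?inE// => -[].
by rewrite d0 mul0r leNgt w0.
Qed.


End EulerProduct.

(** * The norm of the three fields is Euclidean *)

Section QuadraticNorm.
Variable R : realType.
Local Notation C := R[i].
Implicit Types (K : qfield) (x y z : C) (u v w : int * int).

Let qd_eq0 K : qd K = 0%N -> K = FQ. Proof. by case: K. Qed.

(** Real-valued on all of C, in order to measure the distance from a quotient x / y to its rounding.
    The truncation in [nmK] is exact on the ring of integers. *)
Definition normK K z : R :=
  if K is FQ then `|complex.Re z| else complex.Re z ^+ 2 + complex.Im z ^+ 2.

Lemma normKE K z : qd K != 0%N -> normK K z = complex.Re z ^+ 2 + complex.Im z ^+ 2.
Proof. by case: K. Qed.

Definition nmK K z : nat := Num.truncn (normK K z).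

Let sd K : R := Num.sqrt (qd K)%:R.

Let sd2 K : sd K ^+ 2 = (qd K)%:R. Proof. by rewrite sqr_sqrtr. Qed.

Lemma Re_qemb K u : complex.Re (qemb R K u) = u.1%:~R.
Proof.
rewrite /qemb; have -> : u.1%:~R = (u.1%:~R : R)%:C :> C by rewrite rmorph_int.
have -> : u.2%:~R = (u.2%:~R : R)%:C :> C by rewrite rmorph_int.
by case: K => /=; rewrite ?mulr0 ?mul0r ?subr0 ?addr0.
Qed.

Lemma Im_qemb K u : complex.Im (qemb R K u) = u.2%:~R * sd K.
Proof.
rewrite /qemb; have -> : u.1%:~R = (u.1%:~R : R)%:C :> C by rewrite rmorph_int.
have -> : u.2%:~R = (u.2%:~R : R)%:C :> C by rewrite rmorph_int.
by case: K => /=; rewrite ?mulr0 ?mul0r ?add0r ?addr0 /sd/= ?sqrtr0 ?sqrtr1 ?mulr0 ?mulr1.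
Qed.

Definition qnorm K u : nat := if K is FQ then absz u.1 else absz (u.1 ^+ 2 + (qd K)%:Z * u.2 ^+ 2).

Lemma qnormE K u : qd K != 0%N -> qnorm K u = absz (u.1 ^+ 2 + (qd K)%:Z * u.2 ^+ 2).
Proof. by case: K. Qed.

Lemma normK_qemb K u : normK K (qemb R K u) = (qnorm K u)%:R.
Proof.
have e : `|complex.Re (qemb R K u)| = (absz u.1)%:R :> R by rewrite Re_qemb -intr_norm -abszE.
have e2 : complex.Re (qemb R K u) ^+ 2 + complex.Im (qemb R K u) ^+ 2 =
    (absz (u.1 ^+ 2 + (qd K)%:Z * u.2 ^+ 2))%:R :> R.
  have absR (X : int) : 0 <= X -> (absz X)%:R = X%:~R :> R.
    by move=> X0; rewrite -[in RHS](gez0_abs X0).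
  rewrite absR; last by rewrite addr_ge0 ?sqr_ge0// mulr_ge0// sqr_ge0.
  by rewrite Re_qemb Im_qemb exprMn sd2 rmorphD rmorphXn rmorphM rmorphXn/= mulrC.
by case: K e e2 => /=.
Qed.

Lemma nmK_qemb K u : nmK K (qemb R K u) = qnorm K u.
Proof. by rewrite /nmK normK_qemb natrK. Qed.

Lemma nmKE K z : OK K z -> (nmK K z)%:R = normK K z.
Proof. by move=> /OKP[u ->]; rewrite nmK_qemb normK_qemb. Qed.

Lemma OK_FQ z : OK FQ z -> exists a : int, z = a%:~R.
Proof. by move=> /OKP[u ->]; exists u.1; rewrite /qemb/= mulr0 addr0. Qed.

Lemma Im_OK_FQ z : OK FQ z -> complex.Im z = 0.
Proof. by move=> /OKP[u ->]; rewrite Im_qemb /sd/= sqrtr0 mulr0. Qed.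

Lemma normK_ge0 K z : 0 <= normK K z.
Proof. by case: K => //=; rewrite addr_ge0// sqr_ge0. Qed.

Lemma normKM K x y : OK K x -> OK K y -> normK K (x * y) = normK K x * normK K y.
Proof.
have q (a b c e : R) : (a * c - b * e) ^+ 2 + (a * e + b * c) ^+ 2 = (a ^+ 2 + b ^+ 2) * (c ^+ 2 + e ^+ 2).
  by ring.
case: K => [Ox Oy|_ _|_ _]; last 2 first.
- by case: x y => a b [c e]; exact: q.
- by case: x y => a b [c e]; exact: q.
move: (Im_OK_FQ Ox) (Im_OK_FQ Oy); case: x y {Ox Oy} => a b [c e] /= -> ->.
by rewrite mulr0 subr0 normrM.
Qed.

Lemma normK_eq0 K x : OK K x -> normK K x = 0 -> x = 0.
Proof.
have q (a b : R) : a ^+ 2 + b ^+ 2 = 0 -> a +i* b = 0 :> C.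
  move/eqP; rewrite paddr_eq0 ?sqr_ge0// !sqrf_eq0 => /andP[/eqP-> /eqP->] //.
case: K => [Ox|_|_]; last 2 first.
- by case: x => a b; exact: q.
- by case: x => a b; exact: q.
by move: (Im_OK_FQ Ox); case: x {Ox} => a b /= -> /normr0_eq0 ->.
Qed.

Lemma exists_round (t : R) : exists n : int, `|t - n%:~R| <= 1 / 2.
Proof.
exists (Num.floor (t + 1 / 2)).
have /andP[] := floor_itv (t + 1 / 2); rewrite intrD => h1 h2.
by rewrite ler_norml; apply/andP; split; lra.
Qed.

(** Rounding both coordinates to nearest integers leaves norm at most 1/4 + d/4 <= 3/4 in the
    quadratic case, as d <= 2. *)
Lemma normK_round K z : (K = FQ -> complex.Im z = 0) -> exists2 q, OK K q & normK K (z - q) < 1.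
Proof.
move=> zK; have [a Ha] := exists_round (complex.Re z).
have [/qd_eq0 K0|K0] := eqVneq (qd K) 0%N.
  exists (qemb R K (a, 0)); first by apply/OKP; exists (a, 0).
  have := Re_qemb K (a, 0); rewrite K0 /=.
  case: (qemb _ _ _) => ? ?; case: z Ha {zK} => ? ? /= Ha ->.
  by apply: (le_lt_trans Ha); rewrite ltr_pdivrMr// mul1r ltr1n.
have d1 : (0 < qd K <= 2)%N by case: K K0 {zK}.
have d0 : 0 < sd K by rewrite sqrtr_gt0 ltr0n; case/andP: d1.
have [b Hb] := exists_round (complex.Im z / sd K).
exists (qemb R K (a, b)); first by apply/OKP; exists (a, b).
have E : complex.Re (z - qemb R K (a, b)) ^+ 2 + complex.Im (z - qemb R K (a, b)) ^+ 2 < 1.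
  have := Re_qemb K (a, b); have := Im_qemb K (a, b).
  case: (qemb _ _ _) => p q; case: z Ha Hb {zK} => X Y /= Ha Hb -> ->.
  have -> : (Y - b%:~R * sd K) ^+ 2 = (Y / sd K - b%:~R) ^+ 2 * (qd K)%:R.
    by rewrite -sd2 -exprMn mulrBl divfK// gt_eqF.
  have s2 (t : R) : `|t| <= 1 / 2 -> t ^+ 2 <= 1 / 4.
    move=> ht; rewrite -real_normK ?num_real//; have := normr_ge0 t; nra.
  have h1 := s2 _ Ha; have h2 := s2 _ Hb.
  have h3 : (qd K)%:R <= 2 :> R by rewrite ler_nat; case/andP: d1.
  have h4 : 0 <= (qd K)%:R :> R by [].
  have h5 := sqr_ge0 (Y / sd K - b%:~R).
  have := ler_pM h5 h4 h2 h3; lra.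
by move: (qemb _ _ _) E => y; case: K K0 {zK d1 d0 Hb}.
Qed.

Lemma conjc_OK K z : OK K z -> OK K z^*%C.
Proof.
move=> /OKP[u ->]; apply/OKP; exists (u.1, - u.2).
apply/eqP; rewrite eq_complex Re_qemb Im_qemb/=.
have := Re_qemb K u; have := Im_qemb K u; case: (qemb _ _ _) => a b /= -> ->.
by rewrite rmorphN mulNr !eqxx.
Qed.

Lemma qemb_inj K : qd K != 0%N -> injective (qemb R K).
Proof.
move=> K0 u v e; have := Re_qemb K u; have := Im_qemb K u; rewrite e Re_qemb Im_qemb.
have d0 : sd K != 0 by rewrite sqrtr_eq0 -ltNge ltr0n; case: K K0 {e}.
move=> /(mulIf d0)/intr_inj e2 /intr_inj e1.
by case: u v e1 e2 {e} => ? ? [? ?] /= -> ->.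
Qed.

Lemma finite_intbox (n : nat) : finite_set [set u : int * int | (`|u.1| <= n)%N /\ (`|u.2| <= n)%N].
Proof.
pose f (p : 'I_(n.*2.+1) * 'I_(n.*2.+1)) : int * int := (p.1%:Z - n%:Z, p.2%:Z - n%:Z).
apply: (@sub_finite_set _ _ (f @` setT)); last exact/finite_image/finite_finset.
move=> [a b] /= [an bn].
have ia : (absz (a + n%:Z)%R < n.*2.+1)%N by rewrite -addnn; lia.
have ib : (absz (b + n%:Z)%R < n.*2.+1)%N by rewrite -addnn; lia.
exists (Ordinal ia, Ordinal ib) => //; rewrite /f /=; congr (_, _); lia.
Qed.

Lemma finite_nmK K n : finite_set [set x | OK K x /\ (nmK K x <= n)%N].
Proof.
apply: sub_finite_set (finite_image (qemb R K) (finite_intbox n)) => x [Ox xn].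
have [/qd_eq0 K0|K0] := eqVneq (qd K) 0%N.
  rewrite K0 in Ox xn *; have [a xa] := OK_FQ Ox.
  have e : x = qemb R FQ (a, 0) by rewrite xa /qemb/= mul0r addr0.
  by exists (a, 0) => //; rewrite e nmK_qemb in xn.
have [u xu] := (OKP K x).1 Ox; exists u => //.
have h : (absz (u.1 ^+ 2 + (qd K)%:Z * u.2 ^+ 2)%R <= n)%N.
  by move: xn; rewrite xu nmK_qemb; case: K K0 {Ox xu}.
have [d hd] : exists d : nat, qd K = d.+1 by case: K K0 {Ox xn xu h} => // _; [exists 0%N|exists 1%N].
rewrite hd in h; case: u h {xu} => a b /=.
by rewrite !expr2; split; nia.
Qed.

Lemma has_index_FQ x : OK FQ x -> x != 0 -> has_index FQ (principal FQ x) (nmK FQ x).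
Proof.
move=> Ox x0; have [a xa] := OK_FQ Ox.
have e (b : int) : b%:~R = qemb R FQ (b, 0) by rewrite /qemb/= mul0r addr0.
have Oi (b : int) : OK FQ (b%:~R : C) by apply/OKP; exists (b, 0); rewrite e.
have n0 : nmK FQ x = `|a|%N by rewrite xa e nmK_qemb.
have a0 : a != 0 by apply: contraNneq x0 => a0; rewrite xa a0.
rewrite n0; exists (fun k => (k : nat)%:Z%:~R); split => // y Oy.
have [b yb] := OK_FQ Oy.
have mem (c : int) : principal FQ x c%:~R <-> (a %| c)%Z.
  split=> [[z Oz]|/dvdzP[q ->]].
    have [q ->] := OK_FQ Oz; rewrite xa -intrM => /intr_inj <-.
    by rewrite dvdz_mulr.
  by exists q%:~R => //; rewrite xa -intrM mulrC.
have b1 := modz_ge0 b a0; have b2 := ltz_mod b a0.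
have kl : (`|(b %% a)%Z| < `|a|)%N by lia.
exists (Ordinal kl); split.
  rewrite yb -rmorphB/=; apply/mem.
  by rewrite gez0_abs// {1}(divz_eq b a) addrK dvdz_mull.
move=> k; rewrite yb -rmorphB/= => /mem/dvdzP[q hq]; apply/val_inj => /=.
have kb : b = q * a + (k : nat)%:Z by lia.
rewrite kb modzMDl -modz_abs modz_small; first by lia.
by have := ltn_ord k; lia.
Qed.

Lemma qemb_mul K u v : qemb R K u * qemb R K v =
  qemb R K (u.1 * v.1 - (qd K)%:Z * (u.2 * v.2), u.1 * v.2 + u.2 * v.1).
Proof.
rewrite /qemb/= !(rmorphB, rmorphD, rmorphM)/=.
transitivity (u.1%:~R * v.1%:~R + u.2%:~R * v.2%:~R * qgen R K ^+ 2 + (u.1%:~R * v.2%:~R + u.2%:~R * v.1%:~R) * qgen R K : C).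
  by ring.
by rewrite qgen_sqr; ring.
Qed.

Lemma qemb_sub K u v : qemb R K u - qemb R K v = qemb R K (u.1 - v.1, u.2 - v.2).
Proof. by rewrite /qemb/= !rmorphB/=; ring. Qed.

Lemma dvdz_small (m c : int) : 0 < m -> (m %| c)%Z -> - m < c < m -> c = 0.
Proof.
move=> m0 /dvdzP[q ->] /andP[h1 h2].
have q1 : q < 1 by rewrite -(ltr_pM2r m0) mul1r.
have q2 : -1 < q by rewrite -(ltr_pM2r m0) mulN1r.
by rewrite (_ : q = 0) ?mul0r//; lia.
Qed.

Lemma subz_small (m a b : int) : 0 <= a < m -> 0 <= b < m -> - m < a - b < m.
Proof. lia. Qed.

(* Hermite normal form of the ideal: with x = g (a0 + b0 w) and a0, b0 coprime, the integers
   i + j w with 0 <= j < g and 0 <= i < g N(a0 + b0 w) represent every class once. *)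
Lemma has_index_quad K x : qd K != 0%N -> OK K x -> x != 0 -> has_index K (principal K x) (nmK K x).
Proof.
move=> K0 /[dup] Ox /OKP[[a b] xu] x0.
set d : int := (qd K)%:Z; have d0 : 0 < d by rewrite ltz_nat lt0n.
pose g := gcdz a b.
have g0 : 0 < g.
  rewrite lt_neqAle eq_sym gcdz_eq0 andbT; apply: contraNN x0 => /andP[/eqP a0 /eqP b0].
  by rewrite xu a0 b0 /qemb/= mul0r addr0.
have [a0 Ha] : exists a0, a = a0 * g by exact/dvdzP/dvdz_gcdl.
have [b0 Hb] : exists b0, b = b0 * g by exact/dvdzP/dvdz_gcdr.
have cop : coprimez a0 b0.
  have : gcdz (a0 * g) (b0 * g) = g by rewrite -Ha -Hb.
  rewrite -mulz_gcdl gtz0_abs// => /eqP; rewrite -[X in _ == X]mul1r.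
  by rewrite (inj_eq (mulIf _))// gt_eqF.
pose N0 := a0 ^+ 2 + d * b0 ^+ 2.
have N00 : 0 < N0.
  have s1 : 0 <= a0 ^+ 2 by exact: sqr_ge0.
  have s2 : 0 <= d * b0 ^+ 2 by rewrite mulr_ge0 ?sqr_ge0// ltW.
  rewrite lt_neqAle eq_sym addr_ge0// andbT.
  rewrite paddr_eq0// sqrf_eq0 mulf_eq0 sqrf_eq0 (gt_eqF d0)/=.
  apply/negP => /andP[/eqP a00 /eqP b00]; move: x0.
  by rewrite xu Ha Hb a00 b00 !mul0r /qemb/= mul0r addr0 eqxx.
pose M := g * N0; have M0 : 0 < M by rewrite mulr_gt0.
have nE : nmK K x = absz (g * M).
  by rewrite xu nmK_qemb qnormE//= -/d Ha Hb /M /N0; congr absz; ring.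
have mem (v : int * int) : principal K x (qemb R K v) <->
   exists c e : int, v = (a * c - d * (b * e), a * e + b * c).
  split=> [[z /OKP[w ->]]|[c [e ->]]].
    by rewrite xu qemb_mul => /(qemb_inj K0) <-; exists w.1, w.2.
  by exists (qemb R K (c, e)); [apply/OKP; exists (c, e)|rewrite xu qemb_mul].
have memB (v v' : int * int) : principal K x (qemb R K v) -> principal K x (qemb R K v') ->
    principal K x (qemb R K (v.1 - v'.1, v.2 - v'.2)).
  move=> h h'; rewrite -qemb_sub; have [_ _ PB _] := principal_ideal Ox; exact: PB.
rewrite nE; pose f (k : 'I_(absz (g * M))) := (((k : nat)%:Z %% M)%Z, ((k : nat)%:Z %/ M)%Z).
exists (fun k => qemb R K (f k)); split; first by move=> k; apply/OKP; exists (f k).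
move=> y /OKP[[v1 v2] ->].
have [p [q pq]] := Bezoutz a b.
have memM (t : int) : principal K x (qemb R K (M * t, 0)).
  (* The witness is t times the conjugate of x / g, so the product with x is g N0 t = M t. *)
  apply/mem; exists (a0 * t), (- b0 * t); congr (_, _); rewrite Ha Hb /M /N0; ring.
have gM0 : 0 < g * M by rewrite mulr_gt0.
pose t := (v2 %/ g)%Z; pose j := (v2 %% g)%Z.
have v2E : v2 = t * g + j by exact: divz_eq.
have j0 : 0 <= j by rewrite modz_ge0// gt_eqF.
have jg : j < g by rewrite ltz_pmod.
(* By Bezout the multiple of x with coefficients (q t, p t) has second coordinate t g; subtracting
   it reduces v2 to j and changes v1 into this value. *)
pose v1' := v1 - (a * (q * t) - d * (b * (p * t))).
pose i := (v1' %% M)%Z.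
have i0 : 0 <= i by rewrite modz_ge0// gt_eqF.
have iM : i < M by rewrite ltz_pmod.
have k0 : 0 <= i + j * M by rewrite addr_ge0// mulr_ge0// ltW.
have kl : i + j * M < g * M.
  have : (j + 1) * M <= g * M by rewrite ler_pM2r// lezD1.
  by rewrite mulrDl mul1r; lia.
have kN : (absz (i + j * M)%R < absz (g * M)%R)%N by lia.
have fk : f (Ordinal kN) = (i, j).
  rewrite /f /= gez0_abs//; congr (_, _).
    by rewrite addrC modzMDl modz_small// i0.
  by rewrite addrC divzMDl ?gt_eqF// divz_small ?addr0// i0 gtz0_abs.
have hij : principal K x (qemb R K (v1 - i, v2 - j)).
  have -> : (v1 - i, v2 - j) = ((v1 - i) - M * (v1' %/ M)%Z + M * (v1' %/ M)%Z, v2 - j).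
    by congr (_, _); ring.
  have h1 : principal K x (qemb R K (v1 - i - M * (v1' %/ M)%Z, v2 - j)).
    apply/mem; exists (q * t), (p * t); congr (_, _).
      have := divz_eq v1' M; rewrite -/i => e1.
      have -> : v1 - i - M * (v1' %/ M)%Z = v1 - ((v1' %/ M)%Z * M + i) by ring.
      by rewrite -e1 /v1' opprB addrC subrK.
    have : t * (p * a + q * b) = t * g by rewrite pq.
    by rewrite v2E; lia.
  have h2 := memM (- (v1' %/ M)%Z); have := memB _ _ h1 h2.
  by rewrite /= subr0 mulrN opprK.
exists (Ordinal kN); split; first by rewrite fk qemb_sub.
move=> k hk.
have hk' : principal K x (qemb R K (i - (f k).1, j - (f k).2)).
  rewrite qemb_sub/= in hk; have := memB _ _ hk hij.
  rewrite /f /=; move: (_ %% M)%Z (_ %/ M)%Z => A B.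
  by rewrite (_ : (_, _) = (i - A, j - B))//; congr (_, _); ring.
have fk1 : 0 <= (f k).1 < M by rewrite modz_ge0 ?gt_eqF// ltz_pmod.
have fk2 : 0 <= (f k).2 < g.
  rewrite divz_ge0//= ltz_divLR//; have := ltn_ord k; lia.
move: hk' => /mem[c [e [h1 h2]]].
have ej : j - (f k).2 = 0.
  apply: (@dvdz_small g) => //; last by apply: subz_small; rewrite ?j0.
  by rewrite h2 Ha Hb; apply/dvdzP; exists (a0 * e + b0 * c); ring.
have ei : i - (f k).1 = 0.
  apply: (@dvdz_small M) => //; last by apply: subz_small; rewrite ?i0.
  (* M divides the difference times a0 and, by [e2], times b0; these are coprime, so M divides the
     difference itself. *)
  have e1 : (i - (f k).1) * a0 = M * c.
    have : a0 * (i - (f k).1) + d * b0 * (j - (f k).2) = M * c by rewrite h1 h2 Ha Hb /M /N0; ring.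
    by rewrite ej mulr0 addr0 mulrC.
  have e2 : (i - (f k).1) * b0 = - (M * e).
    have : b0 * (i - (f k).1) - a0 * (j - (f k).2) = - (M * e) by rewrite h1 h2 Ha Hb /M /N0; ring.
    by rewrite ej mulr0 subr0 mulrC.
  have [p' [q' pq']] := Bezoutz a0 b0.
  move: cop; rewrite /coprimez => /eqP cop; rewrite cop in pq'.
  apply/dvdzP; exists (p' * c - q' * e).
  transitivity ((i - (f k).1) * (p' * a0 + q' * b0)); first by rewrite pq' mulr1.
  have -> : (i - (f k).1) * (p' * a0 + q' * b0) = p' * ((i - (f k).1) * a0) + q' * ((i - (f k).1) * b0) by ring.
  by rewrite e1 e2; ring.
apply/val_inj => /=.
have := divz_eq (k : nat)%:Z M; rewrite -/(f k).1 -/(f k).2.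
move: ei ej; rewrite /f /= => ei ej.
rewrite -(subr0_eq ei) -(subr0_eq ej) => kE; apply/eqP.
by rewrite -eqz_nat gez0_abs addrC -?kE.
Qed.

Lemma nmK_euclidean K : euclidean_norm K (nmK K).
Proof.
have nmM x y : OK K x -> OK K y -> nmK K (x * y) = (nmK K x * nmK K y)%N.
  move=> Ox Oy; apply/eqP; rewrite -(eqr_nat R) natrM !nmKE ?normKM//; exact: OKM.
split => //.
- move=> x Ox; apply/eqP/eqP => [x0|->].
    by apply: (normK_eq0 Ox); rewrite -nmKE// x0.
  have -> : 0 = qemb R K (0, 0) by rewrite /qemb/= mul0r addr0.
  by rewrite nmK_qemb; case: (K).
- move=> x Ox x1; have n1 : normK K x = 1 by rewrite -nmKE// x1.
  have [K0|K0] := eqVneq (qd K) 0%N.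
    rewrite (qd_eq0 K0) in Ox n1 *; suff -> : x^-1 = x by [].
    have := Im_OK_FQ Ox; case: x {x1} Ox n1 => a b _ /= a1 ->.
    have a2 : a ^+ 2 = 1 by rewrite -real_normK ?num_real// a1 expr1n.
    by apply/eqP; rewrite eq_complex/= expr0n addr0 a2 !divr1 oppr0 !eqxx.
  suff -> : x^-1 = x^*%C by exact: conjc_OK.
  have n1' : complex.Re x ^+ 2 + complex.Im x ^+ 2 = 1 by rewrite -(normKE _ K0).
  case: x n1' {Ox x1 n1} => a b /= ab.
  by apply/eqP; rewrite eq_complex/= ab !divr1 !eqxx.
- move=> x y Ox Oy y0.
  have [|q Oq qlt] := @normK_round K (x / y).
    move=> K0; rewrite K0 in Ox Oy.
    have := Im_OK_FQ Ox; have := Im_OK_FQ Oy.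
    by case: x y {Ox Oy y0} => a b [c e] /= -> ->; rewrite !(oppr0, mul0r, mulr0, addr0).
  exists q => //; rewrite -(ltr_nat R) !nmKE//; last by apply: OKB => //; exact: OKM.
  have -> : x - y * q = y * (x / y - q) by field.
  have y1 : 0 < normK K y.
    by rewrite lt_neqAle eq_sym normK_ge0 andbT; apply: contra y0 => /eqP/(normK_eq0 Oy)/eqP.
  suff -> : normK K (y * (x / y - q)) = normK K y * normK K (x / y - q).
    by rewrite gtr_pMr.
  (* The factor x / y - q is in general not integral, so [normKM] does not apply. For Q the
     imaginary part of y is zero, which is used instead. *)
  have mulK (z : C) : normK K (y * z) = normK K y * normK K z \/ qd K = 0%N /\ complex.Im y = 0.
    case: K Oy {Ox Oq qlt y1 nmM} => Oy; [right|left|left].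
    - by split => //; exact: Im_OK_FQ.
    - by case: y z {y0 Oy} => a b [c e] /=; ring.
    - by case: y z {y0 Oy} => a b [c e] /=; ring.
  have [//|[K0 y2]] := mulK (x / y - q).
  rewrite (qd_eq0 K0)/=; case: y y2 (x / y - q) {Oy y0 qlt y1 mulK} => a b /= -> [c e].
  by rewrite /= mul0r subr0 normrM.
- exact: finite_nmK.
- move=> x Ox x0; have [K0|K0] := eqVneq (qd K) 0%N.
    by rewrite (qd_eq0 K0) in Ox *; exact: has_index_FQ.
  exact: has_index_quad.
Qed.

Let size_elems (X : set C) (l : seq C) : uniq l -> X = [set` l] -> size (elems X) = size l.
Proof.
move=> ul Xl; apply/perm_size/uniq_perm => //; first exact: elems_uniq.
by move=> z; rewrite mem_elems ?Xl ?mem_setE//; exact: finite_seq.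
Qed.

Lemma units_count K : size (elems [set x | OK K x /\ nmK K x = 1%N]) = nroots_unity K.
Proof.
have O1 : OK K (1 : C) by exact: OK1.
have ON1 : OK K (- 1 : C) by rewrite -sub0r; apply: OKB; [exact: OK0|exact: OK1].
have n1 : nmK K (1 : C) = 1%N by exact: nm_one (nmK_euclidean K).
have nN1 : nmK K (- 1 : C) = 1%N.
  have := nmM (nmK_euclidean K) ON1 ON1; rewrite mulrNN mulr1 n1.
  by move/esym/eqP; rewrite muln_eq1 => /andP[/eqP].
have u2 : uniq [:: 1; -1 : C].
  by rewrite /= inE andbT eq_sym eqNr oner_eq0.
have two : (forall u : int * int, nmK K (qemb R K u) = 1%N -> qemb R K u = 1 \/ qemb R K u = - 1) ->
    size (elems [set x | OK K x /\ nmK K x = 1%N]) = 2%N.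
  move=> h; apply: (size_elems u2); apply/seteqP; split => x.
    move=> [/OKP[u ->] /h[] ->]; rewrite /= !inE eqxx ?orbT//.
  by rewrite /= !inE => /orP[/eqP->|/eqP->].
have pm (a : int) : (absz a = 1%N) -> a = 1 \/ a = -1 by lia.
case: K O1 ON1 n1 nN1 two => O1 ON1 n1 nN1 two /=.
- apply: two => u; rewrite nmK_qemb => /pm[] h; rewrite /qemb h /= mulr0 addr0; [left|right]; rewrite ?rmorphN ?rmorph1//.
- have gi : qgen R FQi = qemb R FQi (0, 1) by rewrite /qemb/= add0r mul1r.
  apply: (@size_elems _ [:: 1; -1; 'i; - 'i]).
    rewrite /= !inE !negb_or !eq_complex/= !oppr0 !eqxx ?andbT ?andTb.
    have h1 : 1 != - 1 :> R by rewrite -addr_eq0 (_ : 1 + 1 = 2%:R) ?pnatr_eq0.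
    by rewrite h1 oppr_eq0 oner_eq0.
  apply/seteqP; split => x.
    move=> [/OKP[[a b] ->]]; rewrite nmK_qemb /qnorm/= mul1r => h.
    have : [\/ a = 1 /\ b = 0, a = -1 /\ b = 0, a = 0 /\ b = 1 | a = 0 /\ b = -1].
      have a1 : (-1 <= a <= 1) by rewrite !expr2 in h; nia.
      have b1 : (-1 <= b <= 1) by rewrite !expr2 in h; nia.
      have a3 : a = 0 \/ a = 1 \/ a = -1 by lia.
      have b3 : b = 0 \/ b = 1 \/ b = -1 by lia.
      by case: a3 h => [->|[->|->]]; case: b3 => [->|[->|->]] //= _; [constructor 3|constructor 4|constructor 1|constructor 2].
    by case=> -[-> ->]; rewrite /qemb/= !inE ?rmorphN ?rmorph0 ?rmorph1 ?mul0r ?mul1r ?addr0 ?add0r ?mulN1r ?eqxx ?orbT.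
  have Oi : OK FQi ('i : C) by apply/OKP; exists (0, 1).
  have ni : nmK FQi ('i : C) = 1%N by rewrite -[X in nmK _ X]/(qgen R FQi) gi nmK_qemb.
  rewrite /= !inE => /or4P[] /eqP -> //; split.
    by rewrite -sub0r; apply: OKB => //; exact: OK0.
  by have := nmM (nmK_euclidean FQi) ON1 Oi; rewrite mulN1r nN1 ni.
- apply: two => -[a b]; rewrite nmK_qemb /qnorm/= => h.
  have b0 : b = 0 by rewrite !expr2 in h; nia.
  rewrite b0 expr0n/= mulr0 addr0 in h.
  have : (absz a = 1%N) by rewrite expr2 abszM in h; move/eqP : h; rewrite muln_eq1 => /andP[/eqP].
  by move=> /pm[] ->; rewrite b0 /qemb/= mul0r addr0; [left|right]; rewrite ?rmorphN.
Qed.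

End QuadraticNorm.

(** * Sums of nonnegative terms over N, over Z and over pairs *)

Section NonnegativeSums.
Variable R : realType.
Local Open Scope ereal_scope.

Lemma nneseries_EFin (f : nat -> R) : cvgn (series f) ->
  \sum_(n <oo) (f n)%:E = (limn (series f))%:E.
Proof.
move=> cf; rewrite -EFin_lim//; congr (limn _); apply/funext => n /=.
by rewrite sumEFin.
Qed.

Lemma nneseries_fin_cvg (f : nat -> R) : (forall n, (0 <= f n)%R) ->
  \sum_(n <oo) (f n)%:E < +oo -> cvgn (series f).
Proof.
move=> f0 fo; apply: nondecreasing_is_cvgn.
  by apply/nondecreasing_series => n _ _; exact: f0.
exists (fine (\sum_(n <oo) (f n)%:E)) => _ [n _ <-].
rewrite -lee_fin fineK; last by rewrite ge0_fin_numE// nneseries_ge0// => k _ _; rewrite lee_fin.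
rewrite /series/= -sumEFin; apply: nneseries_lim_ge => k _ _.
by rewrite lee_fin.
Qed.

Lemma esum_int_even (G : nat -> \bar R) : (forall n, 0 <= G n) ->
  \esum_(a in [set: int]) G (absz a) = \sum_(n <oo) G n + \sum_(n <oo) G n.+1.
Proof.
move=> G0; rewrite (esumID (Posz @` setT))// setTI.
have -> : ~` (Posz @` setT) = Negz @` setT.
  apply/seteqP; split => [[n|n] h|_ [n _ <-] [m _]//]; last by exists n.
  by exfalso; apply: h; exists n.
rewrite !setTI !esum_image; last 2 first.
- by move=> x y _ _ [].
- by move=> x y _ _ [].
by rewrite -!nneseries_esumT.
Qed.

Lemma esum_setX (T1 T2 : choiceType) (F : T1 -> \bar R) (G : T2 -> \bar R) (f g : R) :
  (forall x, 0 <= F x) -> (forall y, 0 <= G y) -> (0 < g)%R ->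
  \esum_(x in [set: T1]) F x = f%:E -> \esum_(y in [set: T2]) G y = g%:E ->
  \esum_(u in [set: T1 * T2]) (F u.1 * G u.2) = (f * g)%:E.
Proof.
move=> F0 G0 g0 Ff Gg.
rewrite (_ : [set: T1 * T2] = [set: T1] `*`` (fun _ => [set: T2])); last by apply/seteqP; split.
rewrite -(@esum_esum _ _ _ _ _ (fun x y => F x * G y)); last by move=> *; rewrite mule_ge0.
rewrite (eq_esum (b := fun x => g%:E * F x)).
  by rewrite esumZl// Ff -EFinM mulrC.
move=> x _; have := F0 x.
have Fx : F x < +oo.
  apply: (@le_lt_trans _ _ f%:E); last by rewrite ltry.
  rewrite -Ff -(@esum_set1 _ _ x F)//; exact: esum_subset.
case: (F x) Fx => [r| |]//= _; rewrite lee_fin le_eqVlt => /predU1P[<-|r0].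
  by rewrite mule0 (eq_esum (b := fun=> 0)) ?esum1// => y _; rewrite mul0e.
by rewrite esumZl// Gg muleC.
Qed.

(** With a = s - 1, the term (n + 2)^(-s) is bounded by a telescoping difference over a, because ((n
    + 2) / (n + 1))^a >= 1 + a / (n + 2). *)
Lemma nneseries_powRN (s : R) : (1 < s)%R -> \sum_(n <oo) (powR n.+1%:R (- s))%:E < +oo.
Proof.
move=> s1; pose a := (s - 1)%R; have a0 : (0 < a)%R by rewrite subr_gt0.
have step (n : nat) : (powR n.+2%:R (- s) <= a^-1 * (powR n.+1%:R (- a) - powR n.+2%:R (- a)))%R.
  rewrite mulrC ler_pdivlMr//.
  have -> : (- s = - a - 1)%R by rewrite /a; ring.
  have n2 : (0 < n.+2%:R :> R)%R by rewrite ltr0n.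
  have n1 : (0 < n.+1%:R :> R)%R by rewrite ltr0n.
  rewrite powRB; last by rewrite (gt_eqF n2) implybT.
  rewrite powRr1 ?(ltW n2)//.
  have E : (powR n.+1%:R (- a) = powR n.+2%:R (- a) * powR (n.+2%:R / n.+1%:R) a :> R)%R.
    rewrite powRM ?invr_ge0// mulrA -powRD; last by rewrite (gt_eqF n2) implybT.
    by rewrite addNr powRr0 mul1r -powR_inv1// -powRrM mulN1r.
  rewrite E -mulrA -[X in (_ <= _ - X)%R]mulr1 -mulrBr ler_wpM2l ?powR_ge0//.
  rewrite /powR gt_eqF ?divr_gt0//.
  apply: le_trans (_ : a * ln (n.+2%:R / n.+1%:R) <= _)%R; last first.
    by rewrite lerBrDl expR_ge1Dx.
  rewrite mulrC ler_pM2l//.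
  have -> : (n.+2%:R / n.+1%:R = (n.+1%:R / n.+2%:R)^-1 :> R)%R by rewrite invf_div.
  rewrite lnV ?posrE ?divr_gt0// lerNr.
  have -> : (n.+1%:R / n.+2%:R = 1 + - n.+2%:R^-1 :> R)%R.
    rewrite (_ : n.+1%:R = n.+2%:R - 1 :> R)%R; last by rewrite -[n.+2]addn1 natrD addrK.
    by rewrite mulrBl divff ?mul1r// (gt_eqF n2).
  by apply: le_ln1Dx; rewrite ltrN2 invf_lt1// ltr1n.
have bound n : (\sum_(0 <= k < n.+1) powR k.+1%:R (- s) <= 1 + a^-1 * (1 - powR n.+1%:R (- a)))%R.
  elim: n => [|n IH]; first by rewrite big_nat1 !powR1 subrr mulr0 addr0.
  rewrite big_nat_recr//=; apply: (le_trans (lerD IH (step n))); lra.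
apply: (@le_lt_trans _ _ (1 + a^-1)%:E); last by rewrite ltry.
apply: lime_le; first by apply: is_cvg_nneseries => k _ _; rewrite lee_fin powR_ge0.
apply: nearW => -[|n]; first by rewrite big_geq// lee_fin addr_ge0// invr_ge0 ltW.
rewrite sumEFin lee_fin; apply: le_trans (bound n) _.
by rewrite lerD2l ler_piMr ?invr_ge0 ?(ltW a0)// lerBlDr lerDl powR_ge0.
Qed.

End NonnegativeSums.

(** * Theta series and Dirichlet series of the norm form *)

Section NormCounts.
Variable R : realType.
Local Notation C := R[i].
Implicit Types (K : qfield) (x z : C).
Local Open Scope ereal_scope.

(* the exponent norm_exponent makes norm_form a quadratic form on the lattice O_K also when K = Q *)
Definition norm_exponent K : nat := if K is FQ then 2 else 1.
Definition norm_form K z : nat := (nmK K z ^ norm_exponent K)%N.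
Definition rep_count K k : nat := size (elems [set x : C | OK K x /\ norm_form K x = k]).

Lemma norm_exponent_gt0 K : (0 < norm_exponent K)%N. Proof. by case: K. Qed.

Lemma finite_fiber K k : finite_set [set x : C | OK K x /\ norm_form K x = k].
Proof.
apply: sub_finite_set (finite_nmK R K k) => x [Ox <-]; split => //.
by rewrite /norm_form; case: K {Ox} => /=; rewrite ?expn1// -{1}(expn1 (nmK _ _)); case: (nmK _ _) => // n; rewrite leq_pexp2l.
Qed.

Lemma esum_fibers K (G : nat -> R) : (forall k, (0 <= G k)%R) ->
  \esum_(x in OK K) (G (norm_form K x))%:E = \sum_(k <oo) ((rep_count K k)%:R * G k)%:E.
Proof.
move=> G0; have -> : @OK R K = \bigcup_k [set x : C | OK K x /\ norm_form K x = k].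
  by apply/seteqP; split => [x Ox|x [k _ []]//]; exists (norm_form K x).
rewrite nneseries_sum_bigcup; last 2 first.
- by move=> i j _ _ [x [[_ <-] [_ <-]]].
- by move=> x; rewrite lee_fin.
apply: eq_eseriesr => k _; have ff := finite_fiber K k.
rewrite esum_fset//; last by move=> x _; rewrite lee_fin.
rewrite fsbig_finite//= -/(elems _) (eq_big_seq (fun=> (G k)%:E)); last first.
  by move=> x; rewrite mem_elems// inE => -[_ ->].
by rewrite sumEFin big_const_seq count_predT iter_addr_0 mulr_natl.
Qed.

Lemma rep_count0 K : rep_count K 0 = 1%N.
Proof.
rewrite /rep_count (_ : [set x : C | _] = [set 0%R]).
  by rewrite /elems fset_set1; exact: finmap.cardfs1.
apply/seteqP; split => x.
  move=> [Ox /eqP]; rewrite expn_eq0 => /andP[+ _].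
  by rewrite (nm_eq0 (nmK_euclidean R K))// => /eqP.
have O0 := OK0 R K; move=> ->; split => //; apply/eqP.
by rewrite expn_eq0 (nm_eq0 (nmK_euclidean R K))// eqxx norm_exponent_gt0.
Qed.

Lemma esum_OK_quad K (G : int * int -> \bar R) (F : C -> \bar R) : qd K != 0%N ->
  (forall u, F (qemb R K u) = G u) -> \esum_(x in OK K) F x = \esum_(u in [set: int * int]) G u.
Proof.
move=> K0 FG; have -> : @OK R K = qemb R K @` setT.
  apply/seteqP; split => [x /OKP[u ->]|_ [u _ <-]]; first by exists u.
  by apply/OKP; exists u.
by rewrite esum_image; [apply: eq_esum => u _|move=> u v _ _; exact: qemb_inj].
Qed.

Lemma esum_OK_FQ (G : int -> \bar R) (F : C -> \bar R) :
  (forall a : int, F a%:~R = G a) -> \esum_(x in OK FQ) F x = \esum_(a in [set: int]) G a.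
Proof.
move=> FG; have -> : @OK R FQ = (fun a : int => a%:~R) @` setT.
  apply/seteqP; split => [x /OK_FQ[a ->]|_ [a _ <-]]; first by exists a.
  by apply/OKP; exists (a, 0%R); rewrite /qemb/= mul0r addr0.
by rewrite esum_image; [apply: eq_esum => u _|move=> u v _ _; exact: intr_inj].
Qed.

Lemma norm_form_FQ (a : int) : norm_form FQ (a%:~R : C) = (absz a ^ 2)%N.
Proof.
have -> : a%:~R = qemb R FQ (a, 0%R) by rewrite /qemb/= mul0r addr0.
by rewrite /norm_form nmK_qemb.
Qed.

Lemma norm_form_quad K (u : int * int) : qd K != 0%N ->
  norm_form K (qemb R K u) = (absz u.1 ^ 2 + qd K * absz u.2 ^ 2)%N.
Proof.
move=> K0; rewrite /norm_form (_ : norm_exponent K = 1%N); last by case: K K0.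
rewrite expn1 nmK_qemb qnormE//.
apply/eqP; rewrite -eqz_nat gez0_abs; last by rewrite addr_ge0 ?sqr_ge0// mulr_ge0// sqr_ge0.
by rewrite PoszD PoszM -!abszX !abszE !ger0_norm ?sqr_ge0.
Qed.

Definition theta_rate K : R := if K is FQ then pi else (2 * pi)%R.

(** For a quadratic field, 2 pi v (a^2 + d b^2) splits into pi a^2 (2v) and pi b^2 (2dv), so the
    lattice sum is a product of two values of [jtheta]. *)
Definition thetaK K (v : R) : R := match K with
  | FQ => jtheta v
  | FQi => (jtheta (2 * v) * jtheta (2 * v))%R
  | FQsqrtm2 => (jtheta (2 * v) * jtheta (4 * v))%R end.

Lemma esum_jtheta (t : R) : (0 < t)%R ->
  \esum_(a in [set: int]) (expR (- (pi * (absz a ^ 2)%N%:R * t)))%:E = (jtheta t)%:E.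
Proof.
move=> t0; pose f n : R := expR (- (pi * (n ^ 2)%N%:R * t)).
rewrite (esum_int_even (G := fun n => (f n)%:E)); last by move=> n; rewrite lee_fin expR_ge0.
rewrite nneseries_recl//; last by move=> n _; rewrite lee_fin expR_ge0.
rewrite -nneseries_addn; last by move=> n; rewrite lee_fin expR_ge0.
rewrite (eq_eseriesr (g := fun n => (f n.+1)%:E)); last by move=> n _; rewrite addn1.
have -> : \sum_(n <oo) (f n.+1)%:E = (limn (series (fun k => expR (- (pi * k.+1%:R ^+ 2 * t)))))%:E.
  rewrite -nneseries_EFin; last exact: jtheta_cvg.
  by apply: eq_eseriesr => n _; rewrite /f natrX.
rewrite /f exp0n// mulr0 mul0r oppr0 expR0 -!EFinD /jtheta; congr EFin; ring.
Qed.

Lemma theta_series K (v : R) : (0 < v)%R ->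
  \sum_(k <oo) ((rep_count K k)%:R * expR (- (theta_rate K * k%:R * v)))%:E = (thetaK K v)%:E.
Proof.
move=> v0; rewrite -(esum_fibers K (fun k => expR_ge0 _)).
have [K0|K0] := eqVneq (qd K) 0%N.
  have -> : K = FQ by case: K K0.
  rewrite (esum_OK_FQ (G := fun a => (expR (- (pi * (absz a ^ 2)%N%:R * v)))%:E)).
    exact: esum_jtheta.
  by move=> a; rewrite norm_form_FQ.
have v2 : (0 < 2 * v)%R by rewrite mulr_gt0.
have v4 : (0 < 2 * (qd K)%:R * v)%R by rewrite !mulr_gt0// ltr0n lt0n.
rewrite (esum_OK_quad (G := fun u => (expR (- (pi * (absz u.1 ^ 2)%N%:R * (2 * v))))%:E *
     (expR (- (pi * (absz u.2 ^ 2)%N%:R * (2 * (qd K)%:R * v))))%:E) K0); last first.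
  move=> u; rewrite norm_form_quad// -EFinM -expRD; congr (expR _)%:E.
  rewrite (_ : theta_rate K = 2 * pi)%R; last by case: K K0 {v4}.
  by rewrite natrD natrM; ring.
rewrite (esum_setX _ _ _ (esum_jtheta v2) (esum_jtheta v4)); first last.
- by rewrite (lt_le_trans ltr01)// jtheta_ge1.
- by move=> y; rewrite lee_fin expR_ge0.
- by move=> y; rewrite lee_fin expR_ge0.
move: K0; clear v4; case: K => // _; rewrite /thetaK /qd; first by rewrite mulr1.
by rewrite (_ : 2 * 2%:R = 4 :> R)%R//; ring.
Qed.

(** Half the rank of the lattice O_K, the weight of its theta function. *)
Definition theta_weight K : R := if K is FQ then (1 / 2)%R else 1%R.
Definition abs_discr K : R := match K with FQ => 1%R | FQi => 4%R | FQsqrtm2 => 8%R end.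

(** Under v -> 1 / (|D| v) the argument 2v of Q(i) is inverted, whereas for Q(sqrt(-2)) the
    arguments 2v and 4v are inverted and exchanged. *)
Lemma theta_inv K (v : R) : (0 < v)%R ->
  thetaK K (abs_discr K * v)^-1 = (powR (Num.sqrt (abs_discr K) * v) (theta_weight K) * thetaK K v)%R.
Proof.
move=> v0.
have P (x : R) : (0 < x)%R -> jtheta x^-1 = (Num.sqrt x * jtheta x)%R by exact: jtheta_inv.
case: K => /=.
- by rewrite mul1r P// sqrtr1 !mul1r powR12_sqrt// ltW.
- have -> : (2 * (4 * v)^-1 = (2 * v)^-1)%R by rewrite !invfM; field; rewrite gt_eqF.
  rewrite P ?mulr_gt0// powRr1; last by rewrite mulr_ge0 ?sqrtr_ge0// ltW.
  rewrite (_ : 4 = 2 ^+ 2 :> R)%R; last by ring.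
  rewrite sqrtr_sqr ger0_norm//.
  transitivity (Num.sqrt (2 * v) ^+ 2 * (jtheta (2 * v) * jtheta (2 * v)))%R; first by ring.
  by rewrite sqr_sqrtr// mulr_ge0// (ltW v0).
- have -> : (2 * (8 * v)^-1 = (4 * v)^-1)%R by rewrite !invfM; field; rewrite gt_eqF.
  have -> : (4 * (8 * v)^-1 = (2 * v)^-1)%R by rewrite !invfM; field; rewrite gt_eqF.
  rewrite !P ?mulr_gt0// powRr1; last by rewrite mulr_ge0 ?sqrtr_ge0// ltW.
  rewrite (_ : 8 = 4 * 2 :> R)%R; last by ring.
  rewrite !sqrtrM//.
  transitivity (Num.sqrt 4 * Num.sqrt 2 * Num.sqrt v ^+ 2 * (jtheta (2 * v) * jtheta (4 * v)))%R.
    by ring.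
  by rewrite sqr_sqrtr// (ltW v0).
Qed.

(** A nonzero element satisfies (|a| + 1)(|b| + 1) <= 4 (a^2 + d b^2), so the series is at most 4^s
    times a product of two one-dimensional series; for Q one uses |a| + 1 <= 4 |a|. *)
Lemma dirichlet_fin K (s : R) : (1 < s)%R ->
  \esum_(x in [set x : C | OK K x /\ x != 0%R]) (powR (nmK K x)%:R (- s))%:E < +oo.
Proof.
move=> s1; pose f n : R := powR n.+1%:R (- s).
have f0 n : (0 <= f n)%R by exact: powR_ge0.
have Sf : exists2 S : R, (0 < S)%R & \esum_(a in [set: int]) (f (absz a))%:E = S%:E.
  rewrite (esum_int_even (G := fun n => (f n)%:E)); last by move=> n; rewrite lee_fin.
  have T := nneseries_powRN s1; rewrite -/f in T.
  have T0 : 0 <= \sum_(n <oo) (f n)%:E by apply: nneseries_ge0 => n _ _; rewrite lee_fin.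
  have T1 : 0 <= \sum_(n <oo) (f n.+1)%:E by apply: nneseries_ge0 => n _ _; rewrite lee_fin.
  move: (T) T0 T1; rewrite nneseries_recl//; last by move=> k _; rewrite lee_fin.
  rewrite -nneseries_addn; last by move=> k; rewrite lee_fin.
  rewrite (eq_eseriesr (g := fun n => (f n.+1)%:E)); last by move=> n _; rewrite addn1.
  case: (\sum_(n <oo) (f n.+1)%:E) => [r| |]//= _ _; rewrite lee_fin => r0.
  by exists (f 0%N + r + r)%R => //; rewrite /f powR1; lra.
case: Sf => S S0 HS.
pose c : R := powR 4 s.
have c0 : (0 < c)%R by exact: powR_gt0.
have powle (n m : nat) : (0 < n)%N -> (m <= 4 * n)%N -> (0 < m)%N -> (powR n%:R (- s) <= c * powR m%:R (- s))%R.
  move=> n0 mn m0; rewrite !powRN ler_pdivlMr ?powR_gt0 ?ltr0n// mulrC ler_pdivrMr ?powR_gt0 ?ltr0n//.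
  rewrite /c -powRM//; apply: ge0_ler_powR => //; rewrite ?nnegrE ?mulr_ge0//; first by lra.
  by rewrite -natrM ler_nat.
have [K0|K0] := eqVneq (qd K) 0%N.
  have -> : K = FQ by case: K K0.
  apply: (@le_lt_trans _ _ (\esum_(x in OK FQ) (c * f (nmK FQ x))%:E)).
    apply: (@le_trans _ _ (\esum_(x in [set x : C | OK FQ x /\ x != 0%R]) (c * f (nmK FQ x))%:E)).
      apply: le_esum => x [Ox x0]; rewrite lee_fin.
      have n0 : (0 < nmK FQ x)%N by exact: (nm_gt0 (nmK_euclidean R _) Ox x0).
      by apply: powle => //; lia.
    by apply: esum_subset => [x []//|x]; rewrite lee_fin mulr_ge0// ltW.
  rewrite (esum_OK_FQ (G := fun a => c%:E * (f (absz a))%:E)).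
    rewrite esumZl//; last by move=> a; rewrite lee_fin.
    by rewrite HS -EFinM ltry.
  move=> a; rewrite -EFinM; congr (c * f _)%:E.
  have -> : a%:~R = qemb R FQ (a, 0%R) by rewrite /qemb/= mul0r addr0.
  by rewrite nmK_qemb.
(* The [xget] reads off the coordinates of x, which are unique by [qemb_inj]; the pair (0, 0) is a
   default that never occurs on O_K. *)
apply: (@le_lt_trans _ _ (\esum_(x in OK K) (c * (f (absz (xget (0%R, 0%R) [set u | qemb R K u = x]).1) *
   f (absz (xget (0%R, 0%R) [set u | qemb R K u = x]).2)))%:E)).
  apply: (@le_trans _ _ (\esum_(x in [set x : C | OK K x /\ x != 0%R]) (c * (f (absz (xget (0%R, 0%R) [set u | qemb R K u = x]).1) *
   f (absz (xget (0%R, 0%R) [set u | qemb R K u = x]).2)))%:E)).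
    apply: le_esum => x [Ox x0]; rewrite lee_fin.
    have n0 : (0 < nmK K x)%N by exact: (nm_gt0 (nmK_euclidean R _) Ox x0).
    have [u xu] := (OKP K x).1 Ox.
    have -> : xget (0%R, 0%R) [set u | qemb R K u = x] = u.
      case: xgetP => [y _ /= yx|/(_ u) h]; last by exfalso; apply: h; rewrite /= -xu.
      by apply: (@qemb_inj R K K0); rewrite yx.
    rewrite /f -powRM// -natrM; apply: powle => //.
    have q : nmK K x = (absz u.1 ^ 2 + qd K * absz u.2 ^ 2)%N.
      by have := norm_form_quad u K0; rewrite /norm_form (_ : norm_exponent K = 1%N) ?expn1 -?xu//; case: (K) K0.
    rewrite q in n0 *.
    have d0 : (0 < qd K)%N by rewrite lt0n.
    have dle (m : nat) : (m <= qd K * m)%N by rewrite leq_pmull.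
    move: n0 (dle (absz u.2 ^ 2)%N); move: (qd K * _)%N => D n0 D1.
    move: (absz u.1) (absz u.2) n0 D1 => a b; rewrite !expnS !expn0; nia.
  apply: esum_subset => [x []//|x]; rewrite lee_fin mulr_ge0// ?mulr_ge0// ltW//.
rewrite (esum_OK_quad (G := fun u => c%:E * ((f (absz u.1))%:E * (f (absz u.2))%:E)) K0); last first.
  move=> u; have -> : xget (0%R, 0%R) [set v | qemb R K v = qemb R K u] = u.
    case: xgetP => [y _ /= yu|/(_ u) h]; last by exfalso; apply: h.
    exact: (@qemb_inj R K K0).
  by rewrite -!EFinM.
rewrite esumZl//; last by move=> u; rewrite mule_ge0// lee_fin.
rewrite (esum_setX _ _ S0 HS HS) -?EFinM ?ltry//; by move=> y; rewrite lee_fin.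
Qed.

(** The series over elements grouped by norm form, w being the number of units. Dividing s by
    [norm_exponent] undoes the squaring of the norm for K = Q. *)
Lemma zeta_series K (s : R) : (1 < s)%R ->
  \sum_(k <oo) (if k is 0 then 0 else (rep_count K k)%:R * powR k%:R (- (s / (norm_exponent K)%:R)))%R%:E =
  ((nroots_unity K)%:R * dedekind_zeta K s)%:E.
Proof.
move=> s1; have fin := dirichlet_fin K s1.
have s0 : (0 < s)%R by lra.
rewrite (@dedekind_zeta_dirichlet R K (nmK K) (nmK_euclidean R K) s); first last.
- by rewrite units_count; case: (K).
- apply: le_lt_trans fin; apply: esum_subset => [x []//|x].
  by rewrite lee_fin powR_ge0.
rewrite units_count [X in _ = X%:E]mulrC divfK; last by rewrite pnatr_eq0; case: (K).
rewrite fineK; last by rewrite ge0_fin_numE// esum_ge0// => x _; rewrite lee_fin powR_ge0.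
pose G k : R := (if k is 0 then 0 else powR k%:R (- (s / (norm_exponent K)%:R)))%R.
transitivity (\sum_(k <oo) ((rep_count K k)%:R * G k)%:E).
  by apply: eq_eseriesr => -[|k] _; rewrite ?mulr0.
have G0 k : (0 <= G k)%R by case: k => // k; exact: powR_ge0.
rewrite -esum_fibers// [LHS](esumID [set x | x != 0%R])//; last first.
  by move=> x _; rewrite lee_fin.
have E0 : \esum_(x in OK K `&` ~` [set x : C | x != 0%R]) (G (norm_form K x))%:E = 0.
  rewrite esum1// => x [Ox /negP]; rewrite negbK => /eqP ->; rewrite /norm_form.
  have /eqP -> : nmK K (0%R : C) == 0%N by rewrite (nm_eq0 (nmK_euclidean R K))//; exact: OK0.
  by rewrite exp0n// norm_exponent_gt0.
rewrite E0 adde0.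
apply: eq_esum => x [Ox x0]; rewrite /norm_form.
have n0 : (0 < nmK K x)%N by exact: (nm_gt0 (nmK_euclidean R _) Ox x0).
have : (0 < nmK K x ^ norm_exponent K)%N by rewrite expn_gt0 n0.
rewrite /G; case E : (nmK K x ^ norm_exponent K)%N => [//|m] _; rewrite -E natrX -powR_mulrn// -powRrM.
congr (powR _ _)%:E; rewrite mulrN; congr (- _)%R; field.
by rewrite pnatr_eq0 -lt0n norm_exponent_gt0.
Qed.

End NormCounts.

(** * The Gamma function in logarithmic coordinates *)

Section RealLine.
Variable R : realType.
Local Notation mu := (@lebesgue_measure R).
Implicit Types (f g F : R -> R).

Definition sym_segment (n : nat) : set R := `[- n.+1%:R, n.+1%:R]%classic.

Lemma nondecreasing_segments : nondecreasing_seq sym_segment.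
Proof.
move=> m n mn; rewrite subsetEset => x; rewrite /sym_segment/= !in_itv/= => /andP[h1 h2].
have : m.+1%:R <= n.+1%:R :> R by rewrite ler_nat.
by move=> h; apply/andP; split; lra.
Qed.

Lemma bigcup_segments : \bigcup_n sym_segment n = [set: R].
Proof.
apply/seteqP; split => // x _; exists (Num.truncn `|x|) => //=.
have := truncnS_gt `|x|; rewrite /sym_segment/= in_itv/= -ler_norml; exact: ltW.
Qed.

Lemma integral_line_cvg g : continuous g -> (forall x, 0 <= g x) ->
  (\int[mu]_(x in sym_segment n) (g x)%:E @[n --> \oo] --> \int[mu]_x (g x)%:E)%E.
Proof.
move=> cg g0; rewrite -bigcup_segments; apply: ge0_nondecreasing_set_cvg_integral.
- exact: nondecreasing_segments.
- by move=> i; exact: measurable_itv.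
- by move=> i; apply/measurable_EFinP/measurable_funTS; exact: continuous_measurable_fun.
- by move=> i x _; rewrite lee_fin.
Qed.

Lemma FTC_segment (f F : R -> R) (a b : R) : a < b -> continuous f ->
  (forall x : R, is_derive x 1 F (f x)) ->
  (\int[mu]_(x in `[a, b]) (f x)%:E = (F b - F a)%:E)%E.
Proof.
move=> ab cf dF; rewrite EFinB; apply: continuous_FTC2 => //.
- exact: continuous_subspaceT.
- have cF x : {for x, continuous F}.
    by apply: differentiable_continuous; apply/derivable1_diffP; case: (dF x).
  split; first by move=> x _; case: (dF x).
  + by apply: cvg_at_right_filter; exact: cF.
  + by apply: cvg_at_left_filter; exact: cF.
- by move=> x _; rewrite derive1E; exact: derive_val.
Qed.

(** The derivative is split into nonnegative f and g so that monotone convergence on growing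
    segments handles each integral; it yields integration by parts for Gamma and the mass of the
    density. *)
Lemma integral_line_FTC f g F (l : R) : continuous f -> continuous g ->
  (forall x, 0 <= f x) -> (forall x, 0 <= g x) ->
  (\int[mu]_x (f x)%:E < +oo)%E -> (\int[mu]_x (g x)%:E < +oo)%E ->
  (forall x : R, is_derive x 1 F (f x - g x)) ->
  (F n.+1%:R - F (- n.+1%:R)) @[n --> \oo] --> l ->
  (\int[mu]_x (f x)%:E = \int[mu]_x (g x)%:E + l%:E)%E.
Proof.
move=> cf cg f0 g0 fo go dF Fl.
have ff : (\int[mu]_x (f x)%:E)%E \is a fin_num.
  by rewrite ge0_fin_numE// integral_ge0// => x _; rewrite lee_fin.
have gf : (\int[mu]_x (g x)%:E)%E \is a fin_num.
  by rewrite ge0_fin_numE// integral_ge0// => x _; rewrite lee_fin.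
have h1 := integral_line_cvg cf f0.
have h2 : (\int[mu]_(x in sym_segment n) (g x)%:E + (F n.+1%:R - F (- n.+1%:R))%:E
    @[n --> \oo] --> \int[mu]_x (g x)%:E + l%:E)%E.
  apply: cvgeD; first by rewrite fin_num_adde_defl.
    exact: integral_line_cvg.
  exact: cvg_comp Fl _.
have E : (fun n : nat => \int[mu]_(x in sym_segment n) (f x)%:E)%E =
   (fun n : nat => \int[mu]_(x in sym_segment n) (g x)%:E + (F n.+1%:R - F (- n.+1%:R))%:E)%E.
  apply/funext => n.
  rewrite -(@FTC_segment (fun x => f x - g x)%R)//; last first.
  - by move=> x; apply: continuousB; [exact: cf|exact: cg].
  - have : 0 < n.+1%:R :> R by rewrite ltr0n.
    lra.
  have If := continuous_itv_integrable (- n.+1%:R) n.+1%:R cf.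
  have Ig := continuous_itv_integrable (- n.+1%:R) n.+1%:R cg.
  have -> : (\int[mu]_(x in sym_segment n) (f x - g x)%:E =
     \int[mu]_(x in sym_segment n) (f x)%:E - \int[mu]_(x in sym_segment n) (g x)%:E)%E.
    by apply: integralB_EFin If Ig; exact: measurable_itv.
  have Ign : (\int[mu]_(x in sym_segment n) (g x)%:E)%E \is a fin_num.
    by apply: integrable_fin_num Ig; exact: measurable_itv.
  by rewrite addeC subeK.
rewrite E in h1.
by rewrite -(cvg_lim _ h1)// -(cvg_lim _ h2).
Qed.

Lemma integral_line_fin f F (B : R) : continuous f -> (forall x, 0 <= f x) ->
  (forall x : R, is_derive x 1 F (f x)) -> (forall x, `|F x| <= B) ->
  (\int[mu]_x (f x)%:E < +oo)%E.
Proof.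
move=> cf f0 dF FB; apply: (@le_lt_trans _ _ (B + B)%:E); last by rewrite ltry.
have h := integral_line_cvg cf f0; rewrite -(cvg_lim _ h)//.
apply: lime_le; first by apply/cvg_ex; eexists; exact: h.
apply: nearW => n; rewrite (@FTC_segment _ F)//.
  rewrite lee_fin (le_trans (ler_norm _))// (le_trans (ler_normB _ _))//.
  exact: lerD.
have : 0 < n.+1%:R :> R by rewrite ltr0n.
lra.
Qed.

Lemma integral_line_opp f : continuous f -> (forall x, 0 <= f x) ->
  (\int[mu]_x (f (- x))%:E = \int[mu]_x (f x)%:E)%E.
Proof.
move=> cf f0.
have cfN : continuous (fun x => f (- x)).
  by move=> x; apply: continuous_comp; [exact: opp_continuous|exact: cf].
rewrite -(cvg_lim _ (integral_line_cvg cf f0))//.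
rewrite -(cvg_lim _ (integral_line_cvg cfN (fun x => f0 (- x))))//.
congr (limn _); apply/funext => n.
have := @integration_by_substitution_oppr R (fun x => f (- x)) (- n.+1%:R) n.+1%:R.
rewrite opprK => ->.
- by apply: eq_integral => x _ /=; rewrite opprK.
- have : 0 < n.+1%:R :> R by rewrite ltr0n.
  lra.
- exact: continuous_subspaceT.
Qed.

End RealLine.

Section GammaLogarithmic.
Variable R : realType.
Local Notation mu := (@lebesgue_measure R).

(** The Gamma integrand after t = l e^x, up to the factor l^s. *)
Definition egam (l s x : R) : R := expR (s * x - l * expR x).

Lemma egam_ge0 l s x : 0 <= egam l s x. Proof. exact: expR_ge0. Qed.

Lemma egam_derive l s (x : R) : is_derive x 1 (egam l s) (s * egam l s x - l * egam l (s + 1) x).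
Proof.
rewrite /egam; apply: is_derive_eq; rewrite /GRing.scale/=.
rewrite (_ : (s + 1) * x - l * expR x = (s * x - l * expR x) + x); last by ring.
by rewrite (expRD _ x); ring.
Qed.

Lemma egam_continuous l s : continuous (egam l s).
Proof.
move=> x; apply: differentiable_continuous; apply/derivable1_diffP.
by case: (egam_derive l s x).
Qed.

Lemma powR_continuous_gt0 (a x : R) : 0 < x -> {for x, continuous (fun t => powR t a)}.
Proof.
move=> x0; apply: differentiable_continuous; apply/derivable1_diffP.
by case: (is_derive1_powR a x0).
Qed.

Lemma integral_exp_substitution (G : R -> R) (l : R) : 0 < l ->
  (forall t : R, 0 < t -> 0 <= G t) -> (forall t : R, 0 < t -> {for t, continuous G}) ->
  (\int[mu]_(t in `]0%R, +oo[) (G t)%:E = \int[mu]_x (G (l * expR x)%R * (l * expR x)%R)%:E)%E.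
Proof.
move=> l0 G0 cG; pose F x : R := l * expR x.
have F0 x : 0 < F x by rewrite mulr_gt0// expR_gt0.
have dF (x : R) : is_derive x 1 F (F x).
  by apply: is_derive_eq.
have DF : derive1 F = F by apply/funext => x; rewrite derive1E; exact: derive_val.
have cF : continuous F.
  by move=> x; apply: differentiable_continuous; apply/derivable1_diffP; case: (dF x).
have Fm (x y : R) : x < y -> F x < F y by move=> xy; rewrite ltr_pM2l// ltr_expR.
have cGF : continuous (fun x => G (F x) * F x).
  move=> x; apply: continuousM; last exact: cF.
  by apply: continuous_comp; [exact: cF|exact: cG].
have h := integral_line_cvg cGF (fun x => mulr_ge0 (G0 _ (F0 x)) (ltW (F0 x))).
rewrite -(cvg_lim _ h)//; apply/esym/cvg_lim => //.
pose S n : set R := `[F (- n.+1%:R), F n.+1%:R]%classic.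
have cS n : {within S n, continuous G}.
  apply: continuous_in_subspaceT => x; rewrite inE /S/= in_itv/= => /andP[h1 _].
  exact/cG/(lt_le_trans (F0 _) h1).
have -> : (fun n => \int[mu]_(x in sym_segment n) (G (F x) * F x)%:E)%E = (fun n => \int[mu]_(x in S n) (G x)%:E)%E.
  apply/funext => n; rewrite /S (@integration_by_substitution_increasing _ F G)//.
  - by rewrite DF.
  - have : 0 < n.+1%:R :> R by rewrite ltr0n.
    lra.
  - by move=> x y _ _; exact: Fm.
  - by rewrite DF => x _; exact: cF.
  - by rewrite DF; apply/cvg_ex; exists (F (- n.+1%:R)); apply: cvg_at_right_filter; exact: cF.
  - by rewrite DF; apply/cvg_ex; exists (F n.+1%:R); apply: cvg_at_left_filter; exact: cF.
  - split; first by move=> x _; case: (dF x).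
    + by apply: cvg_at_right_filter; exact: cF.
    + by apply: cvg_at_left_filter; exact: cF.
  - exact: (cS n).
have SE : \bigcup_n S n = `]0, +oo[%classic.
  apply/seteqP; split => t.
    by move=> [n _]; rewrite /S/= !in_itv/= andbT => /andP[h1 _]; exact: lt_le_trans h1.
  rewrite /= in_itv/= andbT => t0.
  have [n _] : (\bigcup_n sym_segment n) (ln (t / l)) by rewrite bigcup_segments.
  rewrite /sym_segment/= in_itv/= => /andP[h1 h2]; exists n => //.
  have tE : t = F (ln (t / l)).
    by rewrite /F lnK ?posrE ?divr_gt0// mulrC divfK// gt_eqF.
  rewrite /S/= in_itv/= tE /F !ler_pM2l// !ler_expR; exact/andP.
rewrite -SE; apply: ge0_nondecreasing_set_cvg_integral.
- move=> m n mn; rewrite subsetEset => x; rewrite /S/= !in_itv/= => /andP[h1 h2].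
  have mn' : m.+1%:R <= n.+1%:R :> R by rewrite ler_nat.
  apply/andP; split; [apply: le_trans h1|apply: (le_trans h2)]; rewrite ler_pM2l// ler_expR//.
  by rewrite lerN2.
- by move=> i; exact: measurable_itv.
- move=> i; apply/measurable_EFinP.
  by apply: subspace_continuous_measurable_fun; [exact: measurable_itv|exact: cS].
- move=> i x; rewrite /S/= in_itv/= => /andP[h1 _].
  by rewrite lee_fin; apply/G0/(lt_le_trans (F0 _) h1).
Qed.

(** This function serves as integrable majorant for [egam]: it decays like e^(-s|x|) and has the
    bounded primitive -1 / (s (1 + e^(s x))). *)
Lemma logistic_continuous (s : R) : continuous (fun x : R => expR (s * x) / (1 + expR (s * x)) ^+ 2).
Proof.
move=> x; have ce : expR (s * y) @[y --> x] --> expR (s * x).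
  by apply: continuous_comp; [exact: mulrl_continuous|exact: continuous_expR].
apply: cvgM => //; apply: cvgV; first by rewrite expf_neq0// gt_eqF// addr_gt0// expR_gt0.
apply: (@cvg_comp _ _ _ (fun x => 1 + expR (s * x)) (fun y => y ^+ 2)); last exact: exprn_continuous.
by apply: cvgD => //; exact: cvg_cst.
Qed.

Lemma logistic_fin (s : R) : 0 < s ->
  (\int[mu]_x (expR (s * x) / (1 + expR (s * x)) ^+ 2)%:E < +oo)%E.
Proof.
move=> s0.
have d0 (x : R) : 1 + expR (s * x) != 0 by rewrite gt_eqF// addr_gt0// expR_gt0.
have dE (x : R) : is_derive x 1 (fun x => 1 + expR (s * x)) (s * expR (s * x)).
  by apply: is_derive_eq; rewrite /GRing.scale/=; ring.
have dF (x : R) : is_derive x 1 (fun x => - s^-1 * (1 + expR (s * x))^-1)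
   (expR (s * x) / (1 + expR (s * x)) ^+ 2).
  have := @is_deriveV R (fun x => 1 + expR (s * x)) x _ 1 (d0 x) (dE x) => dV.
  apply: is_derive_eq; rewrite /GRing.scale/= -exprVn.
  by field; rewrite d0 gt_eqF.
apply: (@integral_line_fin _ _ _ s^-1 (@logistic_continuous s) _ dF).
  by move=> x; rewrite divr_ge0 ?expR_ge0// sqr_ge0.
move=> x; rewrite normrM normrN !ger0_norm ?invr_ge0 ?(ltW s0)//.
rewrite ler_piMr ?invr_ge0 ?(ltW s0)// invf_le1; last by rewrite addr_gt0// expR_gt0.
by rewrite lerDl expR_ge0.
Qed.

(** For x > 0 one has e^x >= x^2 / 4, and the resulting quadratic in x is bounded by completing the
    square. *)
Lemma egam_exponent_le (l s x : R) : 0 < l -> 0 <= s -> 2 * s * x - l * expR x <= 4 * s ^+ 2 / l.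
Proof.
move=> l0 s0; have [x0|x0] := leP x 0.
  apply: (@le_trans _ _ 0); last by rewrite divr_ge0 ?(ltW l0)// mulr_ge0// sqr_ge0.
  have := expR_gt0 x; have h : s * x <= 0 by rewrite mulr_ge0_le0.
  by move=> /(mulr_gt0 l0); lra.
have e1 : x ^+ 2 / 4 <= expR x.
  have -> : x = x / 2 + x / 2 by lra.
  rewrite expRD; have := expR_ge1Dx (x / 2) => h.
  have h2 : x / 2 <= expR (x / 2) by lra.
  have x2 : 0 <= x / 2 by lra.
  have := ler_pM x2 x2 h2 h2; lra.
rewrite ler_pdivlMr//.
apply: (@le_trans _ _ ((2 * s * x - l * (x ^+ 2 / 4)) * l)).
  by rewrite ler_wpM2r ?(ltW l0)// lerB// ler_wpM2l// ltW.
rewrite -subr_ge0.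
have -> : 4 * s ^+ 2 - (2 * s * x - l * (x ^+ 2 / 4)) * l = (2 * s - l * x / 2) ^+ 2 by field.
exact: sqr_ge0.
Qed.

Lemma egam_fin (l s : R) : 0 < l -> 0 < s -> (\int[mu]_x (egam l s x)%:E < +oo)%E.
Proof.
(* From (1 + E)^2 <= 2 + 2 E^2 with E = e^(s x); after multiplication by e^(-l e^x), the E^2 part is
   bounded by [egam_exponent_le]. *)
move=> l0 s0; pose c := 2 + 2 * expR (4 * s ^+ 2 / l).
have c0 : 0 <= c by rewrite addr_ge0// mulr_ge0// expR_ge0.
have cl := @logistic_continuous s.
apply: (@le_lt_trans _ _ (\int[mu]_x (c%:E * (expR (s * x) / (1 + expR (s * x)) ^+ 2)%:E))%E).
  apply: ge0_le_integral => //.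
  - by move=> x _; rewrite lee_fin egam_ge0.
  - by apply/measurable_EFinP; apply: continuous_measurable_fun; exact: egam_continuous.
  - apply/measurable_funeM/measurable_EFinP; exact: continuous_measurable_fun.
  - move=> x _; rewrite -EFinM lee_fin.
    rewrite mulrA ler_pdivlMr; last by rewrite exprn_gt0// addr_gt0// expR_gt0.
    have -> : egam l s x * (1 + expR (s * x)) ^+ 2 =
        (1 + expR (s * x)) ^+ 2 * expR (- (l * expR x)) * expR (s * x) by rewrite /egam expRD; ring.
    rewrite ler_pM2r ?expR_gt0//.
    have b1 : expR (- (l * expR x)) <= 1.
      by rewrite -expR0 ler_expR oppr_le0 mulr_ge0 ?expR_ge0// ltW.
    have b2 : expR (s * x) ^+ 2 * expR (- (l * expR x)) <= expR (4 * s ^+ 2 / l).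
      rewrite expr2 -!expRD ler_expR.
      have := @egam_exponent_le l s x l0 (ltW s0); lra.
    have b3 := sqr_ge0 (1 - expR (s * x)).
    apply: (@le_trans _ _ ((2 + 2 * expR (s * x) ^+ 2) * expR (- (l * expR x)))).
      by rewrite ler_wpM2r ?expR_ge0//; lra.
    by rewrite /c; lra.
rewrite ge0_integralZl//.
- by rewrite lte_mul_pinfty//; exact: logistic_fin.
- by apply/measurable_EFinP; exact: continuous_measurable_fun.
Qed.

Lemma Gamma_egam (l s : R) : 0 < l -> 0 < s ->
  (\int[mu]_x (egam l s x)%:E = (Gamma s * powR l (- s))%:E)%E.
Proof.
move=> l0 s0; rewrite /Gamma /Rintegral.
rewrite (@integral_exp_substitution _ l)//; first last.
- move=> t t0; apply: continuousM; first exact: powR_continuous_gt0.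
  by apply: continuous_comp; [exact: opp_continuous|exact: continuous_expR].
- by move=> t t0; rewrite mulr_ge0 ?powR_ge0 ?expR_ge0.
have E x : powR (l * expR x) (s - 1) * expR (- (l * expR x)) * (l * expR x) = powR l s * egam l s x.
  have e0 : 0 < l * expR x by rewrite mulr_gt0// expR_gt0.
  rewrite mulrAC -{2}[l * expR x](powRr1 (ltW e0)) -powRD; last by rewrite (gt_eqF e0) implybT.
  rewrite subrK powRM ?expR_ge0 ?(ltW l0)// -mulrA /egam expRD; congr (_ * (_ * _)).
  by rewrite /powR gt_eqF ?expR_gt0// expRK.
have -> : (\int[mu]_x (powR (l * expR x) (s - 1) * expR (- (l * expR x)) * (l * expR x))%R%:E =
    (powR l s)%:E * \int[mu]_x (egam l s x)%:E)%E.
  under eq_integral do rewrite E EFinM.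
  rewrite ge0_integralZl//; first last.
  - by rewrite lee_fin powR_ge0.
  - by move=> x _; rewrite lee_fin egam_ge0.
  - by apply/measurable_EFinP; apply: continuous_measurable_fun; exact: egam_continuous.
have : (\int[mu]_x (egam l s x)%:E)%E \is a fin_num.
  by rewrite ge0_fin_numE ?egam_fin// integral_ge0// => x _; rewrite lee_fin egam_ge0.
move=> /fineK <-; rewrite -EFinM/=; congr EFin.
by rewrite powRN mulrC mulKf// gt_eqF// powR_gt0.
Qed.

Lemma cvg_expRN_nat (a : R) : 0 < a -> expR (- (a * n.+1%:R)) @[n --> \oo] --> 0.
Proof.
move=> a0; have -> : (fun n : nat => expR (- (a * n.+1%:R))) = (fun n => expR (- a) ^+ n.+1).
  by apply/funext => n; rewrite -mulNr mulrC expRM_natl.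
have := @cvg_expr R (expR (- a)); rewrite ger0_norm ?expR_ge0// => h.
rewrite (cvg_shiftS (fun n => expR (- a) ^+ n)); apply: h.
by rewrite -expR0 ltr_expR oppr_lt0.
Qed.

(** The derivative of [egam] 1 s is s [egam] 1 s - [egam] 1 (s + 1), and its integral over the line
    vanishes. *)
Lemma GammaS (s : R) : 0 < s -> Gamma (s + 1) = s * Gamma s.
Proof.
move=> s0; have s1 : 0 < s + 1 by rewrite addr_gt0.
have c t : continuous (fun x => t * egam 1 s x).
  by move=> x; apply: continuousM; [exact: cst_continuous|exact: egam_continuous].
have fin : (\int[mu]_x (s * egam 1 s x)%:E = (s * Gamma s)%:E)%E.
  under eq_integral do rewrite EFinM.
  rewrite ge0_integralZl//; first last.
  - by rewrite lee_fin ltW.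
  - by move=> x _; rewrite lee_fin egam_ge0.
  - by apply/measurable_EFinP; apply: continuous_measurable_fun; exact: egam_continuous.
  by rewrite Gamma_egam// powR1 mulr1 -EFinM.
have := @integral_line_FTC R (fun x => s * egam 1 s x) (egam 1 (s + 1)) (egam 1 s) 0 (c s)
  (@egam_continuous _ _).
rewrite fin Gamma_egam// powR1 mulr1 adde0 => h; apply/esym/EFin_inj/h.
- by move=> x; rewrite mulr_ge0 ?egam_ge0// ltW.
- by move=> x; rewrite egam_ge0.
- by rewrite ltry.
- by rewrite ltry.
- by move=> x; have := egam_derive 1 s x; rewrite mul1r.
- have B (x : R) : egam 1 s x <= expR (4 * s ^+ 2) * expR (- s * `|x|).
    rewrite /egam -expRD ler_expR.
    have h1 := @egam_exponent_le 1 s x ltr01 (ltW s0).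
    have h2 := expR_ge0 x; have h3 := sqr_ge0 s.
    rewrite divr1 in h1; have [x0|x0] := ger0P x; lra.
  have cv (F : nat -> R) : (forall n, 0 <= F n <= expR (4 * s ^+ 2) * expR (- (s * n.+1%:R))) ->
      F @ \oo --> (0 : R).
    move=> Fb; apply: (@squeeze_cvgr _ _ _ _ (cst 0) (fun n => expR (4 * s ^+ 2) * expR (- (s * n.+1%:R)))).
    - exact: nearW.
    - exact: cvg_cst.
    - by rewrite -(mulr0 (expR (4 * s ^+ 2))); apply: cvgM; [exact: cvg_cst|exact: cvg_expRN_nat].
  have Bn (x : R) n : `|x| = n.+1%:R -> 0 <= egam 1 s x <= expR (4 * s ^+ 2) * expR (- (s * n.+1%:R)).
    by move=> xn; rewrite egam_ge0/= -mulNr -xn; exact: B.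
  rewrite -(subr0 0); apply: cvgB; apply: cv => n; apply: Bn.
    by rewrite ger0_norm.
  by rewrite normrN ger0_norm.
Qed.

End GammaLogarithmic.

(** * The density *)

Section ExponentialSeries.
Variable R : realType.
Implicit Types (a : nat -> R) (l u : R).

Lemma is_derive_quadratic (f : R -> R) (u d C e : R) : 0 < e ->
  (forall h : R, `|h| < e -> `|f (u + h) - f u - h * d| <= C * h ^+ 2) -> is_derive u 1 f d.
Proof.
move=> e0 fC.
have h : (k^-1 *: (f (k *: 1 + u) - f u)) @[k --> 0^'] --> d.
  apply/cvgrPdist_le => r r0.
  have C1 : 0 < `|C| + 1 by rewrite ltr_wpDl.
  near=> k.
  have k0 : k != 0 by near: k; exact: nbhs_dnbhs_neq.
  have ke : `|k| < Num.min e (r / (`|C| + 1)).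
    near: k; apply: dnbhs0_lt; rewrite lt_min e0/= divr_gt0//.
  move: ke; rewrite lt_min => /andP[ke kr].
  have := fC k ke; rewrite /GRing.scale/= mulr1 [k + u]addrC => H.
  have -> : d - k^-1 * (f (u + k) - f u) = - (k^-1 * (f (u + k) - f u - k * d)).
    by rewrite [in RHS]mulrBr mulKf// opprB.
  rewrite normrN normrM normfV ler_pdivrMl ?normr_gt0//.
  apply: (le_trans H); rewrite -real_normK ?num_real// expr2 mulrA mulrC ler_wpM2l//.
  rewrite ltr_pdivlMr// in kr.
  have := ler_norm C; have := normr_ge0 C; have := normr_ge0 k; move: kr (normr_ge0 k).
  move=> h1 h2 _ h3 h4.
  have := ler_wpM2r h2 h4; lra.
split; first by apply/cvg_ex; exists d.
by apply/cvg_lim.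
Unshelve. all: by end_near. Qed.

Definition eterm l a u (k : nat) : R := a k * expR (- (l * k%:R * u)).
Definition eser l a u : R := limn (series (eterm l a u)).
Definition ecvg l a : Prop := (forall k, 0 <= a k) /\ (forall u, 0 < u -> cvgn (series (eterm l a u))).
(** The coefficients of minus the derivative in u. *)
Definition emul l a (k : nat) : R := l * k%:R * a k.

Lemma eterm_ge0 l a u k : ecvg l a -> 0 <= eterm l a u k.
Proof. by move=> [a0 _]; rewrite mulr_ge0// expR_ge0. Qed.

(** With y = l k u / 2, the inequality y e^(-y) <= 1 trades the new factor for half of the
    exponent. *)
Lemma emul_ecvg l a : 0 < l -> ecvg l a -> ecvg l (emul l a).
Proof.
move=> l0 [a0 ca]; split.
  by move=> k; rewrite !mulr_ge0// ltW.
move=> u u0; have u2 : 0 < u / 2 by rewrite divr_gt0.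
apply: (@series_le_cvg _ _ (fun k => 2 / u * eterm l a (u / 2) k)).
- by move=> k; rewrite mulr_ge0 ?expR_ge0// !mulr_ge0// ltW.
- by move=> k; rewrite !mulr_ge0 ?expR_ge0 ?invr_ge0// ltW.
- move=> k; rewrite /eterm /emul.
  have E : expR (- (l * k%:R * u)) = expR (- (l * k%:R * (u / 2))) * expR (- (l * k%:R * (u / 2))).
    by rewrite -expRD; congr expR; field.
  have h : l * k%:R * (u / 2) * expR (- (l * k%:R * (u / 2))) <= 1.
    rewrite expRN ler_pdivrMr ?expR_gt0// mul1r.
    by have := expR_ge1Dx (l * k%:R * (u / 2)); lra.
  rewrite E; have -> : l * k%:R * a k * (expR (- (l * k%:R * (u / 2))) * expR (- (l * k%:R * (u / 2)))) =
     (2 / u * (a k * expR (- (l * k%:R * (u / 2))))) * (l * k%:R * (u / 2) * expR (- (l * k%:R * (u / 2)))).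
    by field; rewrite gt_eqF.
  by rewrite ler_piMr// !mulr_ge0 ?expR_ge0 ?invr_ge0// ltW.
- exact: is_cvg_seriesZ (ca _ u2).
Qed.

(** For |h| < u / 2 the second-order remainder of each term is at most h^2 times the term of the
    twice derived series at u / 2, so it can be summed. *)
Lemma eser_derive l a u : 0 < l -> ecvg l a -> 0 < u ->
  is_derive u 1 (eser l a) (- eser l (emul l a) u).
Proof.
move=> l0 ca u0.
have ca1 := emul_ecvg l0 ca; have ca2 := emul_ecvg l0 ca1.
have u2 : 0 < u / 2 by rewrite divr_gt0.
apply: (@is_derive_quadratic _ _ _ (eser l (emul l (emul l a)) (u / 2)) (u / 2)) => // h hu.
have uh : 0 < u + h by move: hu; rewrite ltr_norml => /andP[]; lra.
have c0 := ca.2 _ u0; have ch := ca.2 _ uh; have c1 := ca1.2 _ u0; have c2 := ca2.2 _ u2.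
pose t k := eterm l a (u + h) k - eterm l a u k + h * eterm l (emul l a) u k.
have tE : series t = fun n => series (eterm l a (u + h)) n - series (eterm l a u) n
    + h * series (eterm l (emul l a) u) n.
  by apply/funext => n; rewrite /series/= /t big_split/= sumrB mulr_sumr.
have Ct : series t @ \oo --> eser l a (u + h) - eser l a u + h * eser l (emul l a) u.
  rewrite tE; exact: (@cvgD _ _ _ _ _ _ _ _ _ (@cvgB _ _ _ _ _ _ _ _ _ ch c0)
    (@cvgM _ _ _ _ _ _ _ _ (cvg_cst h) c1)).
have ct : cvgn (series t) by apply/cvg_ex; eexists; exact: Ct.
have -> : eser l a (u + h) - eser l a u - h * - eser l (emul l a) u = limn (series t).
  by rewrite (cvg_lim _ Ct)// mulrN opprK.
have tb k : `|t k| <= h ^+ 2 * eterm l (emul l (emul l a)) (u / 2) k.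
  have -> : t k = a k * expR (- (l * k%:R * u)) * (expR (- (l * k%:R * h)) - 1 - - (l * k%:R * h)).
    by rewrite /t /eterm /emul mulrDr opprD expRD; ring.
  rewrite normrM ger0_norm; last by rewrite mulr_ge0 ?expR_ge0// ca.1.
  apply: le_trans (ler_wpM2l _ (normr_expRB1B_le _)) _.
    by rewrite mulr_ge0 ?expR_ge0// ca.1.
  rewrite sqrrN normrN /eterm /emul.
  have -> : a k * expR (- (l * k%:R * u)) * ((l * k%:R * h) ^+ 2 * expR `|l * k%:R * h|) =
     h ^+ 2 * (l * k%:R * (l * k%:R * a k) * (expR (- (l * k%:R * u)) * expR `|l * k%:R * h|)).
    by ring.
  rewrite ler_wpM2l ?sqr_ge0// ler_wpM2l//.
    have := ca.1 k => ak; rewrite !mulr_ge0// ltW//.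
  rewrite -expRD ler_expR normrM ger0_norm; last by rewrite mulr_ge0// ltW.
  have lk : 0 <= l * k%:R by rewrite mulr_ge0// ltW.
  have := ler_wpM2l lk (ltW hu); lra.
have cb : cvgn (series (fun k => h ^+ 2 * eterm l (emul l (emul l a)) (u / 2) k)).
  exact: is_cvg_seriesZ c2.
have cn : cvgn [normed series t].
  apply: series_le_cvg cb => [k|k|k]; [exact: normr_ge0| |exact: tb].
  by rewrite mulr_ge0 ?sqr_ge0// eterm_ge0.
apply: le_trans (lim_series_norm cn) _.
apply: le_trans (lim_series_le cn cb tb) _.
by rewrite lim_seriesZ// [leRHS]mulrC.
Qed.

End ExponentialSeries.

Lemma is_derive_compN (R : realType) (f : R -> R) (x d : R) :
  is_derive (- x) 1 f d -> is_derive x 1 (fun y => f (- y)) (- d).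
Proof.
move=> h; have hN : is_derive x 1 (fun y : R => - y) (- 1) by apply: is_derive_eq.
have := @is_derive1_comp R f (fun y => - y) x _ _ h hN.
by rewrite mulrN1.
Qed.

Lemma eser_ler (R : realType) (l c d u v : R) (a b : nat -> R) :
  cvgn (series (eterm l a u)) -> cvgn (series (eterm l b v)) ->
  (forall k, c * eterm l a u k <= d * eterm l b v k) -> c * eser l a u <= d * eser l b v.
Proof.
move=> ca cb ab.
have e1 : (fun n => c * series (eterm l a u) n) @ \oo --> c * eser l a u.
  exact: (@cvgM _ _ _ _ _ _ _ _ (cvg_cst c) ca).
have e2 : (fun n => d * series (eterm l b v) n) @ \oo --> d * eser l b v.
  exact: (@cvgM _ _ _ _ _ _ _ _ (cvg_cst d) cb).
rewrite -(cvg_lim _ e1)// -(cvg_lim _ e2)//; apply: ler_lim.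
- by apply/cvg_ex; eexists; exact: e1.
- by apply/cvg_ex; eexists; exact: e2.
- by apply: nearW => n; rewrite /series/= !mulr_sumr; apply: ler_sum => k _.
Qed.

Lemma is_derive_expM (R : realType) (w x df : R) (f : R -> R) : is_derive x 1 f df ->
  is_derive x 1 (fun y => expR (w * y) * f y) (expR (w * x) * (w * f x + df)).
Proof. by move=> h; apply: is_derive_eq; rewrite /GRing.scale/=; ring. Qed.

(** * The density attached to an abstract theta series *)

Section ThetaDensity.
Variable R : realType.
Local Notation mu := (@lebesgue_measure R).
Variables (lam w : R) (r : nat -> R).
Hypotheses (rc : ecvg lam r) (r0 : r 0 = 1) (w0 : 0 < w) (lamw : 1 + w < lam).
Hypothesis funeq : forall x : R,
  eser lam r (expR (- x)) = expR (w * x) * eser lam r (expR x).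
Hypothesis dirichlet_cvg : forall s : R, w < s ->
  (\sum_(k <oo) (if k is 0%N then 0 else r k * powR k%:R (- s))%R%:E < +oo)%E.

Let lam0 : 0 < lam. Proof. by move: w0 lamw; lra. Qed.
Let rc1 : ecvg lam (emul lam r). Proof. exact: emul_ecvg. Qed.
Let rc2 : ecvg lam (emul lam (emul lam r)). Proof. exact: emul_ecvg. Qed.
Let rc3 : ecvg lam (emul lam (emul lam (emul lam r))). Proof. exact: emul_ecvg. Qed.

Let T0 (x : R) : R := eser lam r (expR x).
Let T1 (x : R) : R := eser lam (emul lam r) (expR x).
Let T2 (x : R) : R := eser lam (emul lam (emul lam r)) (expR x).
Let T3 (x : R) : R := eser lam (emul lam (emul lam (emul lam r))) (expR x).

Lemma eser_expR_derive (a : nat -> R) (x : R) : ecvg lam a ->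
  is_derive x 1 (fun x => eser lam a (expR x)) (- expR x * eser lam (emul lam a) (expR x)).
Proof.
move=> ca; have d1 := eser_derive lam0 ca (expR_gt0 x).
have := @is_derive1_comp R (eser lam a) expR x _ _ d1 (is_derive_expR x).
by rewrite mulrC mulrN mulNr mulrC.
Qed.

Let dT0 (x : R) : is_derive x 1 T0 (- expR x * T1 x). Proof. exact: eser_expR_derive. Qed.
Let dT1 (x : R) : is_derive x 1 T1 (- expR x * T2 x). Proof. exact: eser_expR_derive. Qed.
Let dT2 (x : R) : is_derive x 1 T2 (- expR x * T3 x). Proof. exact: eser_expR_derive. Qed.

(** [th1] and [th2] are the first and second derivatives of [T0] in x. *)
Let th1 (x : R) : R := - expR x * T1 x.
Let th2 (x : R) : R := - expR x * T1 x + expR x * expR x * T2 x.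

Let dth1 (x : R) : is_derive x 1 th1 (th2 x).
Proof.
have e := is_derive_expR x; have h := dT1 x.
by apply: is_derive_eq; rewrite /GRing.scale/= /th2; ring.
Qed.

(** Both sides of the functional equation are differentiated, and the two values of the derivative
    compared; [funeq2] repeats this. *)
Let funeq1 (x : R) : th1 (- x) = - (expR (w * x) * (w * T0 x + th1 x)).
Proof.
have h0 := dT0 x.
have hN : is_derive x 1 (fun x => T0 (- x)) (- th1 (- x)).
  exact: (@is_derive_compN R T0 x _ (dT0 (- x))).
have hE : is_derive x 1 (fun x => expR (w * x) * T0 x) (expR (w * x) * (w * T0 x + th1 x)).
  exact: (is_derive_expM w h0).
have E : (fun x => T0 (- x)) = (fun x => expR (w * x) * T0 x) by apply/funext => y; exact: funeq.
rewrite E in hN; have := @derive_val _ _ _ _ _ _ _ hN; rewrite (@derive_val _ _ _ _ _ _ _ hE) => ->.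
by rewrite opprK.
Qed.

Let funeq2 (x : R) : th2 (- x) = expR (w * x) * (w ^+ 2 * T0 x + 2 * w * th1 x + th2 x).
Proof.
have h0 := dT0 x; have h1 := dth1 x.
have hN : is_derive x 1 (fun x => th1 (- x)) (- th2 (- x)).
  exact: (@is_derive_compN R th1 x _ (dth1 (- x))).
have hE : is_derive x 1 (fun x => - (expR (w * x) * (w * T0 x + th1 x)))
   (- (expR (w * x) * (w ^+ 2 * T0 x + 2 * w * th1 x + th2 x))).
  have hS : is_derive x 1 (fun y => w * T0 y + th1 y) (w * th1 x + th2 x).
    by apply: is_derive_eq.
  have -> : expR (w * x) * (w ^+ 2 * T0 x + 2 * w * th1 x + th2 x) =
      expR (w * x) * (w * (w * T0 x + th1 x) + (w * th1 x + th2 x)).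
    by move: (T0 x) (th1 x) (th2 x) => t u v; ring.
  by have := is_derive_expM w hS => hM; apply: is_deriveN.
have E : (fun x => th1 (- x)) = (fun x => - (expR (w * x) * (w * T0 x + th1 x))).
  by apply/funext => y; exact: funeq1.
rewrite E in hN; have := @derive_val _ _ _ _ _ _ _ hN; rewrite (@derive_val _ _ _ _ _ _ _ hE).
by move=> /oppr_inj.
Qed.

(** This is (T'' + w T') / w, expanded so that the sign of each term is visible. *)
Definition theta_density (x : R) : R :=
  w^-1 * (expR x * expR x * eser lam (emul lam (emul lam r)) (expR x)
          - (1 + w) * (expR x * eser lam (emul lam r) (expR x))).

Let denE (x : R) : theta_density x = w^-1 * (th2 x + w * th1 x).
Proof. by rewrite /theta_density /th2 /th1 /T1 /T2; ring. Qed.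

Lemma theta_densityN x : theta_density (- x) = expR (w * x) * theta_density x.
Proof. by rewrite !denE funeq2 funeq1; ring. Qed.

Lemma theta_density_continuous : continuous theta_density.
Proof.
move=> x; apply: differentiable_continuous; apply/derivable1_diffP.
have e := is_derive_expR x; have h1 := dT1 x; have h2 := dT2 x.
rewrite /theta_density -/T1 -/T2; exact: ex_derive.
Qed.

Let T1_ge0 (x : R) : 0 <= T1 x.
Proof.
apply: limr_ge; first exact: rc1.2 (expR_gt0 x).
by apply: nearW => n; apply: sumr_ge0 => k _; exact: eterm_ge0.
Qed.

(** The coefficient at k = 0 is killed by [emul], and for k >= 1 the extra factor lam k is at least
    lam. *)
Let T2_ge (x : R) : lam * T1 x <= T2 x.
Proof.
have c1 := rc1.2 _ (expR_gt0 x); have c2 := rc2.2 _ (expR_gt0 x).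
rewrite -[T2 x]mul1r; apply: eser_ler => // k; rewrite mul1r /eterm mulrA ler_wpM2r ?expR_ge0// {2}/emul -mulrA ler_wpM2l ?(ltW lam0)//.
by case: k => [|k]; rewrite ?mul0r /emul ?mulr0 ?mul0r// ler_peMl ?ler1n// (rc1.1 k.+1).
Qed.

Lemma theta_density_ge0 x : 0 <= theta_density x.
Proof.
suff H (y : R) : 0 <= y -> 0 <= theta_density y.
  have [x0|x0] := leP 0 x; first exact: H.
  have xN : 0 <= - x by rewrite oppr_ge0 ltW.
  by rewrite -[x]opprK theta_densityN mulr_ge0 ?expR_ge0// H.
move=> y0; rewrite /theta_density mulr_ge0 ?invr_ge0 ?(ltW w0)// -/(T1 y) -/(T2 y).
have -> : expR y * expR y * T2 y - (1 + w) * (expR y * T1 y) = expR y * (expR y * T2 y - (1 + w) * T1 y).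
  by ring.
rewrite mulr_ge0 ?expR_ge0// subr_ge0.
have e1 : 1 <= expR y by rewrite -expR0 ler_expR.
have t := T2_ge y; have t1 := T1_ge0 y.
apply: le_trans (_ : T2 y <= _); last by rewrite ler_peMl// (le_trans _ t)// mulr_ge0// ltW.
by apply: le_trans t; rewrite ler_wpM2r// ltW.
Qed.

Let T1_le (x : R) : 0 <= x -> T1 x <= expR (- (lam * x)) * T1 0.
Proof.
move=> x0; have c1 := rc1.2 _ (expR_gt0 x); have c2 := rc1.2 _ (expR_gt0 0).
rewrite -[T1 x]mul1r; apply: eser_ler => // -[|k]; rewrite mul1r.
  by rewrite /eterm /emul mulr0 !mul0r mulr0.
rewrite /eterm mulrCA ler_wpM2l ?(rc1.1 k.+1)// -expRD ler_expR expR0 mulr1.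
have h := expR_ge1Dx x; have k1 : 1 <= k.+1%:R :> R by rewrite ler1n.
have lk : lam <= lam * k.+1%:R by rewrite ler_peMr// ltW.
have lk0 : 0 <= lam * k.+1%:R by rewrite mulr_ge0// ltW.
have := ler_wpM2l lk0 h; have := ler_wpM2r x0 lk; lra.
Qed.

Let T0_ge1 (x : R) : 1 <= T0 x.
Proof.
have c0 := rc.2 _ (expR_gt0 x).
have -> : 1 = series (eterm lam r (expR x)) 1.
  by rewrite /series/= big_nat1 /eterm r0 mul1r mulr0 mul0r oppr0 expR0.
apply: nondecreasing_cvgn_le => //.
by apply/nondecreasing_series => n _ _; exact: eterm_ge0.
Qed.

Let T0_le (x : R) : T0 x <= 1 + T1 x.
Proof.
have c0 := rc.2 _ (expR_gt0 x); have c1 := rc1.2 _ (expR_gt0 x).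
apply: limr_le => //; apply: nearW => n.
have h : series (eterm lam (emul lam r) (expR x)) n <= T1 x.
  apply: nondecreasing_cvgn_le => //.
  by apply/nondecreasing_series => k _ _; exact: eterm_ge0.
apply: le_trans (lerD (lexx 1) h); rewrite /series/=.
case: n {h} => [|n]; first by rewrite !big_geq// addr0.
rewrite !big_nat_recl//= {1 3}/eterm r0 mul1r /emul mulr0 !mul0r oppr0 expR0 add0r lerD2l.
apply: ler_sum => k _; rewrite /eterm ler_wpM2r ?expR_ge0// /emul ler_peMl ?rc.1//.
have k1 : 1 <= k.+1%:R :> R by rewrite ler1n.
have lam1 : 1 <= lam by move: w0 lamw; lra.
by rewrite mulr_ege1.
Qed.

Let prim (x : R) : R := w^-1 * (w * T0 x + th1 x).

Let dprim (x : R) : is_derive x 1 prim (theta_density x).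
Proof.
have h0 := dT0 x; have h1 := dth1 x.
by apply: is_derive_eq; rewrite denE /GRing.scale/= /th1; ring.
Qed.

Let primN (x : R) : prim (- x) = w^-1 * (expR ((1 + w) * x) * T1 x).
Proof.
rewrite /prim funeq1 /T0 funeq -/(T0 x) /th1.
by rewrite (_ : (1 + w) * x = w * x + x) ?expRD; [ring|ring].
Qed.

(** Used for b = 0, 1 and 1 + w. The last one settles the limit of the primitive at -oo, and the
    hypothesis on lam lets the bound [T1_le] suffice. *)
Let cvg_small (b : R) : b < lam -> expR (b * n.+1%:R) * T1 n.+1%:R @[n --> \oo] --> 0.
Proof.
move=> bl.
apply: (@squeeze_cvgr _ _ _ _ (cst 0) (fun n => T1 0 * expR (- ((lam - b) * n.+1%:R)))).
- apply: nearW => n; rewrite mulr_ge0 ?expR_ge0//=.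
  apply: le_trans (ler_wpM2l (expR_ge0 _) (T1_le _)) _ => //.
  rewrite mulrA mulrC -expRD ler_wpM2l// ler_expR; lra.
- exact: cvg_cst.
- have lb : 0 < lam - b by rewrite subr_gt0.
  have := @cvgM _ _ _ _ _ _ _ _ (cvg_cst (T1 0)) (cvg_expRN_nat lb); rewrite mulr0; exact.
Qed.

Let cvg_prim : prim n.+1%:R - prim (- n.+1%:R) @[n --> \oo] --> (1 : R).
Proof.
have t1 : T1 n.+1%:R @[n --> \oo] --> (0 : R).
  have := cvg_small lam0; rewrite (_ : (fun n : nat => _) = fun n : nat => T1 n.+1%:R)//.
  by apply/funext => n; rewrite mul0r expR0 mul1r.
have et1 : expR n.+1%:R * T1 n.+1%:R @[n --> \oo] --> (0 : R).
  have := @cvg_small 1; rewrite (_ : (fun n : nat => _) = fun n : nat => expR n.+1%:R * T1 n.+1%:R).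
    by apply; move: w0 lamw; lra.
  by apply/funext => n; rewrite mul1r.
have t0 : T0 n.+1%:R @[n --> \oo] --> (1 : R).
  apply: (@squeeze_cvgr _ _ _ _ (cst 1) (fun n => 1 + T1 n.+1%:R)).
  - by apply: nearW => n; rewrite T0_ge1 T0_le.
  - exact: cvg_cst.
  - by rewrite -[X in _ --> X]addr0; apply: cvgD; [exact: cvg_cst|].
have pN : prim (- n.+1%:R) @[n --> \oo] --> (0 : R).
  rewrite -(mulr0 w^-1) (_ : (fun n : nat => _) = fun n : nat => w^-1 * (expR ((1 + w) * n.+1%:R) * T1 n.+1%:R)).
    by apply: cvgM; [exact: cvg_cst|exact: cvg_small].
  by apply/funext => n; rewrite primN.
have pE (n : nat) : prim n.+1%:R = w^-1 * (w * T0 n.+1%:R - expR n.+1%:R * T1 n.+1%:R).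
  by rewrite /prim /th1 mulNr.
have pP : prim n.+1%:R @[n --> \oo] --> w^-1 * (w * 1 - 0).
  under eq_fun do rewrite pE.
  apply: cvgM; first exact: cvg_cst.
  by apply: cvgB; [apply: cvgM; [exact: cvg_cst|exact: t0]|exact: et1].
have h : prim n.+1%:R - prim (- n.+1%:R) @[n --> \oo] --> w^-1 * (w * 1 - 0) - 0 by exact: cvgB.
by move: h; rewrite !subr0 mulr1 mulVf// gt_eqF.
Qed.

Lemma integral_eser (b : nat -> R) (t : R) : ecvg lam b -> b 0 = 0 -> 0 < t ->
  (\int[mu]_x (expR (t * x) * eser lam b (expR x))%:E =
   \sum_(k <oo) (b k * (Gamma t * powR (lam * k%:R) (- t)))%:E)%E.
Proof.
move=> bc b0 t0.
have E x : ((expR (t * x) * eser lam b (expR x))%:E =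
    \sum_(k <oo) (b k * egam (lam * k%:R) t x)%:E)%E.
  have c := bc.2 _ (expR_gt0 x).
  have e : (fun n => expR (t * x) * series (eterm lam b (expR x)) n) @ \oo --> expR (t * x) * eser lam b (expR x).
    exact: (@cvgM _ _ _ _ _ _ _ _ (cvg_cst _) c).
  have sE : series (fun k => b k * egam (lam * k%:R) t x) = (fun n => expR (t * x) * series (eterm lam b (expR x)) n).
    apply/funext => n; rewrite /series/= mulr_sumr; apply: eq_bigr => k _.
    by rewrite /eterm /egam expRD; ring.
  rewrite nneseries_EFin sE; first by rewrite (cvg_lim _ e).
  by apply/cvg_ex; eexists; exact: e.
under eq_integral do rewrite E.
rewrite integral_nneseries//; first last.
- by move=> k x _; rewrite lee_fin mulr_ge0 ?egam_ge0 ?bc.1.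
- move=> k; apply/measurable_EFinP/measurable_funM => //.
  by apply: continuous_measurable_fun; exact: egam_continuous.
apply: eq_eseriesr => -[|k] _.
  under eq_integral do rewrite b0 mul0r.
  by rewrite integral0 b0 mul0r.
under eq_integral do rewrite EFinM.
rewrite ge0_integralZl//; first last.
- by rewrite lee_fin bc.1.
- by move=> x _; rewrite lee_fin egam_ge0.
- by apply/measurable_EFinP; apply: continuous_measurable_fun; exact: egam_continuous.
by rewrite Gamma_egam ?mulr_gt0// -EFinM.
Qed.


(** j counts the applications of [emul]: the coefficient (lam k)^j cancels against the shift of the
    exponent from s to s + j. *)
Lemma mellin_eser (j : nat) (b : nat -> R) (s Z : R) : ecvg lam b -> b 0 = 0 ->
  (forall k, b k.+1 = (lam * k.+1%:R) ^+ j * r k.+1) -> w < s ->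
  (\sum_(k <oo) (if k is 0%N then 0 else r k * powR k%:R (- s))%R%:E = Z%:E)%E ->
  (\int[mu]_x (expR ((s + j%:R)%R * x)%R * eser lam b (expR x))%:E =
    (Gamma (s + j%:R)%R * powR lam (- s)%R * Z)%:E)%E.
Proof.
move=> bc b0 bE ws HZ; have s0 : 0 < s := lt_trans w0 ws.
rewrite integral_eser//; last by rewrite ltr_wpDr.
rewrite EFinM -HZ -nneseriesZl; last first.
  by case=> [|k] _; rewrite lee_fin// mulr_ge0 ?powR_ge0 ?rc.1.
apply: eq_eseriesr => -[|k] _; first by rewrite b0 mul0r mule0.
rewrite -EFinM bE; congr EFin.
have lk : 0 < lam * k.+1%:R by rewrite mulr_gt0.
rewrite opprD powRD; last by rewrite (gt_eqF lk) implybT.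
rewrite powR_invn ?(ltW lk)// powRM ?(ltW lam0)//.
have X : (lam * k.+1%:R) ^+ j != 0 by rewrite expf_neq0// gt_eqF.
transitivity ((lam * k.+1%:R) ^+ j / (lam * k.+1%:R) ^+ j *
  (Gamma (s + j%:R) * powR lam (- s) * (r k.+1 * powR k.+1%:R (- s)))); first by ring.
by rewrite divff// mul1r.
Qed.

Let expR_measurable (a : R) : measurable_fun [set: R] (fun x => expR (a * x)).
Proof.
apply: continuous_measurable_fun => x.
by apply: continuous_comp; [exact: mulrl_continuous|exact: continuous_expR].
Qed.

Let eser_measurable (a : R) (b : nat -> R) : ecvg lam b ->
  measurable_fun [set: R] (fun x => expR (a * x) * eser lam b (expR x)).
Proof.
move=> bc; apply: measurable_funM; first exact: expR_measurable.
apply: continuous_measurable_fun => x; apply: differentiable_continuous; apply/derivable1_diffP.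
by case: (eser_expR_derive x bc).
Qed.

Let eser_ge0 (b : nat -> R) (x : R) : ecvg lam b -> 0 <= eser lam b (expR x).
Proof.
move=> bc; apply: limr_ge; first exact: bc.2 (expR_gt0 x).
by apply: nearW => n; apply: sumr_ge0 => k _; exact: eterm_ge0.
Qed.

Let eser_integrable (a c : R) (b : nat -> R) (I : R) : ecvg lam b ->
  (\int[mu]_x (expR (a * x)%R * eser lam b (expR x))%:E = I%:E)%E ->
  mu.-integrable setT (EFin \o (fun x => c * (expR (a * x) * eser lam b (expR x)))).
Proof.
move=> bc HI; have -> : EFin \o (fun x => c * (expR (a * x) * eser lam b (expR x))) =
   (fun x => c%:E * (expR (a * x) * eser lam b (expR x))%:E)%E.
  by apply/funext => x /=; rewrite EFinM.
apply: integrableZl => //; apply/integrableP; split.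
  by apply/measurable_EFinP; exact: eser_measurable.
under eq_integral => x _ do rewrite gee0_abs ?lee_fin ?mulr_ge0 ?expR_ge0 ?eser_ge0//.
by rewrite HI ltry.
Qed.

(** The two parts give Gamma(s + 2) - (1 + w) Gamma(s + 1) = s (s - w) Gamma(s). *)
Lemma theta_density_mellin (s Z : R) : w < s ->
  (\sum_(k <oo) (if k is 0%N then 0 else r k * powR k%:R (- s))%R%:E = Z%:E)%E ->
  (\int[mu]_x (expR (s * x)%R * theta_density x)%:E =
   (w^-1 * s * (s - w) * Gamma s * powR lam (- s) * Z)%R%:E)%E.
Proof.
move=> ws HZ; have s0 : 0 < s := lt_trans w0 ws.
have I2 : (\int[mu]_x (expR ((s + 2)%R * x)%R * T2 x)%:E =
    (Gamma (s + 2)%R * powR lam (- s)%R * Z)%:E)%E.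
  apply: (@mellin_eser 2) => //; first by rewrite /emul mulr0 mul0r.
  by move=> k; rewrite /emul; ring.
have I1 : (\int[mu]_x (expR ((s + 1)%R * x)%R * T1 x)%:E =
    (Gamma (s + 1)%R * powR lam (- s)%R * Z)%:E)%E.
  apply: (@mellin_eser 1) => //; first by rewrite /emul mulr0 mul0r.
have J2 := eser_integrable w^-1 rc2 I2.
have J1 := eser_integrable (w^-1 * (1 + w)) rc1 I1.
have E (x : R) : expR (s * x) * theta_density x = w^-1 * (expR ((s + 2) * x) * T2 x)
    - w^-1 * (1 + w) * (expR ((s + 1) * x) * T1 x).
  have -> : (s + 2) * x = s * x + (x + x) by ring.
  have -> : (s + 1) * x = s * x + x by ring.
  by rewrite !expRD /theta_density /T1 /T2; ring.
under eq_integral do rewrite E EFinB.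
rewrite (integralB_EFin _ J2 J1)//.
have Z1 (c a I : R) (b : nat -> R) : ecvg lam b -> 0 <= c ->
   (\int[mu]_x (expR (a * x)%R * eser lam b (expR x))%:E = I%:E)%E ->
   (\int[mu]_x (c * (expR (a * x) * eser lam b (expR x)))%R%:E = (c * I)%:E)%E.
  move=> bc c0 HI; under eq_integral do rewrite EFinM.
  rewrite ge0_integralZl//; first by rewrite HI.
  - by apply/measurable_EFinP; exact: eser_measurable.
  - by move=> x _; rewrite lee_fin mulr_ge0 ?expR_ge0 ?eser_ge0.
have wV : 0 <= w^-1 by rewrite invr_ge0 ltW.
rewrite (Z1 _ _ _ _ rc2 wV I2) (Z1 _ _ _ _ rc1 _ I1); last by rewrite mulr_ge0// addr_ge0// ltW.
rewrite -EFinB; congr EFin.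
have -> : s + 2 = s + 1 + 1 by ring.
rewrite GammaS ?addr_gt0// GammaS//; field; rewrite gt_eqF//.
Qed.

Let moment_gt (s : R) : w < s -> (\int[mu]_x (expR (s * x)%R * theta_density x)%:E < +oo)%E.
Proof.
move=> ws; have := dirichlet_cvg ws; set S := (\sum_(k <oo) _)%E => Sf.
have Z0 : (0 <= S)%E.
  by apply: nneseries_ge0 => -[|k] _ _; rewrite lee_fin// mulr_ge0 ?powR_ge0 ?rc.1.
have HZ : S = (fine S)%:E by rewrite fineK// ge0_fin_numE.
by rewrite (theta_density_mellin ws HZ) ltry.
Qed.

Let expden_continuous (a : R) : continuous (fun x => expR (a * x) * theta_density x).
Proof.
move=> x; apply: cvgM; last exact: theta_density_continuous.
by apply: continuous_comp; [exact: mulrl_continuous|exact: continuous_expR].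
Qed.

(** Reflection x -> -x exchanges the exponents a and w - a, and w - a > w. *)
Let moment_lt0 (a : R) : a < 0 -> (\int[mu]_x (expR (a * x)%R * theta_density x)%:E < +oo)%E.
Proof.
move=> a0; have wa : w < w - a by lra.
apply: le_lt_trans (moment_gt wa).
have f0 (x : R) : 0 <= expR (a * x) * theta_density x by rewrite mulr_ge0 ?expR_ge0 ?theta_density_ge0.
have := @integral_line_opp R _ (@expden_continuous a) f0 => <-.
have E (x : R) : expR (a * - x) * theta_density (- x) = expR ((w - a) * x) * theta_density x.
  by rewrite theta_densityN mulrA -expRD; congr (expR _ * _); ring.
rewrite le_eqVlt; apply/orP; left; apply/eqP; apply: eq_integral => x _.
exact: (congr1 EFin (E x)).
Qed.

Lemma theta_density_moment (a : R) : (\int[mu]_x (expR (a * x)%R * theta_density x)%:E < +oo)%E.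
Proof.
(* Exponents in [0, w] are reached by domination: b > w, -b < 0 and e^(a x) <= e^(b x) + e^(-b
   x). *)
pose b := `|a| + w + 1.
have b1 : w < b by rewrite /b; have := normr_ge0 a; lra.
have b2 : - b < 0 by rewrite oppr_lt0 (lt_trans w0).
have h1 := moment_gt b1; have h2 := moment_lt0 b2.
apply: (@le_lt_trans _ _ (\int[mu]_x ((expR (b * x) * theta_density x)%:E + (expR (- b * x) * theta_density x)%:E))%E).
  apply: ge0_le_integral => //.
  - by move=> x _; rewrite lee_fin mulr_ge0 ?expR_ge0 ?theta_density_ge0.
  - by apply/measurable_EFinP; apply: continuous_measurable_fun; exact: expden_continuous.
  - by apply: emeasurable_funD; apply/measurable_EFinP; apply: continuous_measurable_fun; exact: expden_continuous.
  - move=> x _; rewrite -EFinD lee_fin -mulrDl ler_wpM2r ?theta_density_ge0//.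
    have h := ler_norm a; have h' := ler_norm (- a); rewrite normrN in h'.
    have ab : a <= b by rewrite /b; move: w0 h; lra.
    have ba : - b <= a by rewrite /b; move: w0 h'; lra.
    have [x0|x0] := leP 0 x.
      by apply: ler_wpDr; rewrite ?expR_ge0// ler_expR ler_wpM2r.
    by apply: ler_wpDl; rewrite ?expR_ge0// ler_expR ler_wnM2r// (ltW x0).
rewrite ge0_integralD//; first by rewrite lte_add_pinfty.
- by move=> x _; rewrite lee_fin mulr_ge0 ?expR_ge0 ?theta_density_ge0.
- by apply/measurable_EFinP; apply: continuous_measurable_fun; exact: expden_continuous.
- by move=> x _; rewrite lee_fin mulr_ge0 ?expR_ge0 ?theta_density_ge0.
- by apply/measurable_EFinP; apply: continuous_measurable_fun; exact: expden_continuous.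
Qed.

Lemma theta_density_mass : (\int[mu]_x (theta_density x)%:E = 1)%E.
Proof.
have fin : (\int[mu]_x (theta_density x)%:E < +oo)%E.
  by have := theta_density_moment 0; under eq_integral do rewrite mul0r expR0 mul1r.
have := @integral_line_FTC R theta_density (fun=> 0) prim 1 theta_density_continuous (@cst_continuous _ _ _).
rewrite integral0 add0e => h; apply: h => //.
- exact: theta_density_ge0.
- by move=> x; rewrite subr0.
Qed.

End ThetaDensity.

(** * Two-sided Laplace transforms *)

Section LaplaceTransform.
Variable R : realType.
Local Notation C := R[i].
Local Notation mu := (@lebesgue_measure R).
Variable p : R -> R.
Hypothesis mp : measurable_fun setT p.
Hypothesis p0 : forall x, 0 <= p x.
Hypothesis mom : forall a : R, (\int[mu]_x (expR (a * x)%R * p x)%:E < +oo)%E.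

Let Ip (f : R -> R) : R := \int[mu]_x (f x * p x).
Let Jp (f : R -> R) := mu.-integrable setT (EFin \o (fun x => f x * p x)).

Definition exp_bounded (f : R -> R) (c a b : R) : Prop :=
  measurable_fun setT f /\ forall x : R, `|f x| <= c * (expR (a * x) + expR (b * x)).

Let mexp (a : R) : measurable_fun [set: R] (fun x => expR (a * x)).
Proof.
apply: continuous_measurable_fun => x.
by apply: continuous_comp; [exact: mulrl_continuous|exact: continuous_expR].
Qed.

Let Jexp (a : R) : Jp (fun x => expR (a * x)).
Proof.
apply/integrableP; split.
  by apply/measurable_EFinP; apply: measurable_funM; [exact: mexp|exact: mp].
under eq_integral => x _ do rewrite gee0_abs ?lee_fin ?mulr_ge0 ?expR_ge0//.
exact: mom.
Qed.

Let JpD f g : Jp f -> Jp g -> Jp (fun x => f x + g x).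
Proof.
move=> Jf Jg; have := integrableD (@measurableT _ _) Jf Jg; rewrite /Jp.
by apply: eq_integrable => // x _ /=; rewrite mulrDl.
Qed.

Let JpZ c f : Jp f -> Jp (fun x => c * f x).
Proof.
move=> Jf; have := integrableZl (@measurableT _ _) c Jf; rewrite /Jp.
by apply: eq_integrable => // x _ /=; rewrite -EFinM mulrA.
Qed.

Let IpD f g : Jp f -> Jp g -> Ip (fun x => f x + g x) = Ip f + Ip g.
Proof. by move=> Jf Jg; rewrite -RintegralD//; apply: eq_Rintegral => x _; rewrite mulrDl. Qed.

Let IpZ c f : Jp f -> Ip (fun x => c * f x) = c * Ip f.
Proof. by move=> Jf; rewrite -RintegralZl//; apply: eq_Rintegral => x _; rewrite mulrA. Qed.

Let Jp_bounded f c a b : exp_bounded f c a b -> Jp f.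
Proof.
move=> [mf fb].
have J : Jp (fun x => c * (expR (a * x) + expR (b * x))) by apply: JpZ; apply: JpD; exact: Jexp.
apply: le_integrable J => //.
  by apply/measurable_EFinP; exact: measurable_funM.
move=> x _ /=; rewrite lee_fin !normrM ler_wpM2r//.
by apply: le_trans (fb x) _; rewrite -normrM ler_norm.
Qed.

Let Ip_bound f c a b : exp_bounded f c a b ->
  `|Ip f| <= c * (Ip (fun x => expR (a * x)) + Ip (fun x => expR (b * x))).
Proof.
move=> fb; have Jf := Jp_bounded fb; rewrite -IpD// -IpZ; last exact: JpD.
apply: le_trans (le_normr_Rintegral _ Jf) _ => //; apply: le_Rintegral => //.
- exact: integrable_norm Jf.
- by apply: JpZ; apply: JpD.
- by move=> x _; rewrite normrM (ger0_norm (p0 x)) ler_wpM2r//; case: fb.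
Qed.

Let Ip_lin f1 f2 f3 f4 (c3 c4 : R) : Jp f1 -> Jp f2 -> Jp f3 -> Jp f4 ->
  Ip f1 - Ip f2 - (c3 * Ip f3 + c4 * Ip f4) =
  Ip (fun x => f1 x + (-1 * f2 x + (- c3 * f3 x + - c4 * f4 x))).
Proof.
move=> J1 J2 J3 J4; rewrite IpD//; last by apply: JpD; [exact: JpZ|apply: JpD; exact: JpZ].
rewrite IpD; [|exact: JpZ|by apply: JpD; exact: JpZ].
by rewrite IpD ?IpZ//; try exact: JpZ; ring.
Qed.

Definition laplace (z : C) : C :=
  (\int[mu]_x (expR (complex.Re z * x) * cos (complex.Im z * x) * p x)) +i*
  (\int[mu]_x (expR (complex.Re z * x) * sin (complex.Im z * x) * p x)).

Let mcos (b : R) : measurable_fun [set: R] (fun x => cos (b * x)).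
Proof.
apply: continuous_measurable_fun => x.
by apply: continuous_comp; [exact: mulrl_continuous|exact: continuous_cos].
Qed.

Let msin (b : R) : measurable_fun [set: R] (fun x => sin (b * x)).
Proof.
apply: continuous_measurable_fun => x.
by apply: continuous_comp; [exact: mulrl_continuous|exact: continuous_sin].
Qed.

Let cos_le1_ (x : R) : `|cos x| <= 1. Proof. by rewrite ler_norml cos_geN1 cos_le1. Qed.
Let sin_le1_ (x : R) : `|sin x| <= 1. Proof. by rewrite ler_norml sin_geN1 sin_le1. Qed.

Let bounded_trig (a : R) (g : R -> R) : measurable_fun setT g -> (forall x, `|g x| <= 1) ->
  exp_bounded (fun x => expR (a * x) * g x) 1 a a.
Proof.
move=> mg g1; split; first exact: measurable_funM.
move=> x; rewrite normrM mul1r ger0_norm ?expR_ge0//.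
have := expR_ge0 (a * x) => e0; have := ler_wpM2l e0 (g1 x); lra.
Qed.

Let expR_abs_le (a x : R) : expR (a * x) * expR `|x| <= expR ((a + 1) * x) + expR ((a - 1) * x).
Proof.
rewrite -expRD; have h1 := expR_ge0 ((a + 1) * x); have h2 := expR_ge0 ((a - 1) * x).
have [x0|x0] := ger0P x.
  by rewrite (_ : a * x + x = (a + 1) * x); [lra|ring].
by rewrite (_ : a * x - x = (a - 1) * x); [lra|ring].
Qed.

Let bounded_xtrig (a : R) (g : R -> R) : measurable_fun setT g -> (forall x, `|g x| <= 1) ->
  exp_bounded (fun x => x * (expR (a * x) * g x)) 1 (a + 1) (a - 1).
Proof.
move=> mg g1; split; first by apply: measurable_funM => //; exact: measurable_funM.
move=> x; rewrite mul1r !normrM (ger0_norm (expR_ge0 _)).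
apply: le_trans (expR_abs_le a x).
rewrite mulrCA ler_wpM2l ?expR_ge0//.
have h := expR_ge1Dx `|x|; have h1 := ler_wpM2l (normr_ge0 x) (g1 x); lra.
Qed.

(** Two remainders of size 2 |h|^2 x^2 e^|h1 x| add up to 16 |h|^2 (x^2 / 4) e^|h1 x|, and both x^2
    / 4 and e^|h1 x| are at most e^|x|. *)
Let remainder_le (h1 h2 x : R) (u v : R) : `|u| <= 1 -> `|v| <= 1 -> `|h1| <= 1 ->
  `|u * (expR (h1 * x) * cos (h2 * x) - 1 - h1 * x) + v * (expR (h1 * x) * sin (h2 * x) - h2 * x)|
  <= 16 * (h1 ^+ 2 + h2 ^+ 2) * (expR (2 * `|x|)).
Proof.
move=> u1 v1 h11.
have c := expcos_bound (h1 * x) (h2 * x); have s := expsin_bound (h1 * x) (h2 * x).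
apply: le_trans (ler_normD _ _) _; rewrite !normrM.
have hc := ler_pM (normr_ge0 _) (normr_ge0 _) u1 c.
have hs := ler_pM (normr_ge0 _) (normr_ge0 _) v1 s.
apply: le_trans (lerD hc hs) _; rewrite !mul1r.
have -> : (h1 * x) ^+ 2 + (h2 * x) ^+ 2 = (h1 ^+ 2 + h2 ^+ 2) * x ^+ 2 by ring.
have -> : 2 * ((h1 ^+ 2 + h2 ^+ 2) * x ^+ 2) * expR `|h1 * x| + 2 * ((h1 ^+ 2 + h2 ^+ 2) * x ^+ 2) * expR `|h1 * x|
   = 16 * (h1 ^+ 2 + h2 ^+ 2) * (x ^+ 2 / 4 * expR `|h1 * x|) by field.
rewrite ler_wpM2l ?mulr_ge0 ?addr_ge0 ?sqr_ge0//.
have e1 : x ^+ 2 / 4 <= expR `|x|.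
  rewrite -[x ^+ 2]real_normK ?num_real//.
  have -> : expR `|x| = expR (`|x| / 2) * expR (`|x| / 2) by rewrite -expRD; congr expR; field.
  have h := expR_ge1Dx (`|x| / 2).
  have y2 : 0 <= `|x| / 2 by rewrite divr_ge0.
  have h3 : `|x| / 2 <= expR (`|x| / 2) by lra.
  have := ler_pM y2 y2 h3 h3; lra.
have e2 : expR `|h1 * x| <= expR `|x| by rewrite ler_expR normrM ler_piMl.
have -> : expR (2 * `|x|) = expR `|x| * expR `|x| by rewrite -expRD; congr expR; ring.
by apply: ler_pM => //; rewrite ?divr_ge0 ?sqr_ge0 ?expR_ge0.
Qed.

Let expR_abs2_le (a x : R) : expR (a * x) * expR (2 * `|x|) <= expR ((a + 2) * x) + expR ((a - 2) * x).
Proof.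
rewrite -expRD; have h1 := expR_ge0 ((a + 2) * x); have h2 := expR_ge0 ((a - 2) * x).
have [x0|x0] := ger0P x.
  by rewrite (_ : a * x + 2 * x = (a + 2) * x); [lra|ring].
by rewrite (_ : a * x + 2 * - x = (a - 2) * x); [lra|ring].
Qed.

Let Jtrig (a : R) (g : R -> R) : measurable_fun [set: R] g -> (forall x, `|g x| <= 1) ->
  Jp (fun x => expR (a * x) * g x).
Proof. by move=> mg g1; exact: Jp_bounded (bounded_trig _ mg g1). Qed.

(** The amplitude c and the phase y stand for the constant factor |D|^(-s/2) of X^s. *)
Lemma laplace_cosB (z : C) (c y : R) :
  \int[mu]_x (c * (expR (complex.Re z * x) * cos (complex.Im z * x - y)) * p x) =
  c * cos y * complex.Re (laplace z) + c * sin y * complex.Im (laplace z).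
Proof.
have Jc := Jtrig (complex.Re z) (mcos (complex.Im z)) (fun x => cos_le1_ _).
have Js := Jtrig (complex.Re z) (msin (complex.Im z)) (fun x => sin_le1_ _).
rewrite /= -(IpZ _ Jc) -(IpZ _ Js) -IpD; [|exact: JpZ|exact: JpZ].
by apply: eq_Rintegral => x _; rewrite cosB; ring.
Qed.

Lemma laplace_sinB (z : C) (c y : R) :
  \int[mu]_x (c * (expR (complex.Re z * x) * sin (complex.Im z * x - y)) * p x) =
  c * cos y * complex.Im (laplace z) - c * sin y * complex.Re (laplace z).
Proof.
have Jc := Jtrig (complex.Re z) (mcos (complex.Im z)) (fun x => cos_le1_ _).
have Js := Jtrig (complex.Re z) (msin (complex.Im z)) (fun x => sin_le1_ _).
rewrite /= -mulNr -(IpZ _ Jc) -(IpZ _ Js) -IpD; [|exact: JpZ|exact: JpZ].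
by apply: eq_Rintegral => x _; rewrite sinB; ring.
Qed.

(** The derivative is the transform of x p(x); the second-order remainder, integrated against p, is
    O(|h|^2) because the moments at a + 2 and a - 2 are finite. *)
Lemma laplace_entire : entire laplace.
Proof.
apply/entire_cdiff => -[a b].
pose M (g : R -> R) := Ip (fun x => x * (expR (a * x) * g x)).
pose mc := fun x => cos (b * x); pose ms := fun x => sin (b * x).
have mmc : measurable_fun [set: R] mc := mcos b.
have mms : measurable_fun [set: R] ms := msin b.
exists (M mc +i* M ms).
pose K := 16 * (Ip (fun x => expR ((a + 2) * x)) + Ip (fun x => expR ((a - 2) * x))).
have K0 : 0 <= K.
  by rewrite mulr_ge0// addr_ge0//; apply: Rintegral_ge0 => x _; rewrite mulr_ge0 ?expR_ge0.
move=> e e0; exists (Num.min 1 (e / (2 * K + 1))).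
  by rewrite lt_min ltr01/= divr_gt0// ltr_wpDl// mulr_ge0.
move=> [h1 h2]; set h := h1 +i* h2; rewrite lt_min => /andP[hl1 hle].
have h11 : `|h1| <= 1 by apply: le_trans (ltW hl1); exact: (normr_Re_le h).
have J1 c (g : R -> R) : measurable_fun setT g -> (forall x, `|g x| <= 1) -> Jp (fun x => x * (expR (c * x) * g x)).
  by move=> mg g1; exact: Jp_bounded (bounded_xtrig _ mg g1).
have c1 (y : R) : forall x, `|cos (y * x)| <= 1 by move=> x; exact: cos_le1_.
have s1 (y : R) : forall x, `|sin (y * x)| <= 1 by move=> x; exact: sin_le1_.
have nh : normc h ^+ 2 = h1 ^+ 2 + h2 ^+ 2.
  by rewrite /= sqr_sqrtr// addr_ge0 ?sqr_ge0.
(* By the addition formulas the real and imaginary remainders both have this shape, with u and v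
   equal to plus or minus cos (b x) and sin (b x). *)
have rem (f u v : R -> R) : measurable_fun setT f -> (forall x, `|u x| <= 1) -> (forall x, `|v x| <= 1) ->
   (forall x, f x = expR (a * x) * (u x * (expR (h1 * x) * cos (h2 * x) - 1 - h1 * x)
       + v x * (expR (h1 * x) * sin (h2 * x) - h2 * x))) -> `|Ip f| <= K * normc h ^+ 2.
  move=> mf u1 v1 fE.
  have fb : exp_bounded f (16 * (h1 ^+ 2 + h2 ^+ 2)) (a + 2) (a - 2).
    split => // x; rewrite fE normrM ger0_norm ?expR_ge0//.
    apply: le_trans (ler_wpM2l (expR_ge0 _) (remainder_le h2 x (u1 x) (v1 x) h11)) _.
    rewrite mulrCA ler_wpM2l ?expR_abs2_le// mulr_ge0// addr_ge0 ?sqr_ge0//.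
  apply: le_trans (Ip_bound fb) _; rewrite nh /K.
  by rewrite le_eqVlt; apply/orP; left; apply/eqP; ring.
have HRe : `|Ip (fun x => expR ((a + h1) * x) * cos ((b + h2) * x)) - Ip (fun x => expR (a * x) * cos (b * x))
    - (h1 * M mc + - h2 * M ms)| <= K * normc h ^+ 2.
  rewrite /M Ip_lin; [|exact: Jtrig|exact: Jtrig|exact: (J1 a mc (mcos b) (c1 b))|exact: (J1 a ms (msin b) (s1 b))].
  apply: (rem _ (fun x => cos (b * x)) (fun x => - sin (b * x))) => //.
  - apply: measurable_funD; first exact: measurable_funM.
    apply: measurable_funD; first by apply: measurable_funM => //; exact: measurable_funM.
    by apply: measurable_funD; apply: measurable_funM => //; apply: measurable_funM => //; exact: measurable_funM.
  - by move=> x; rewrite normrN.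
  - by move=> x; rewrite /mc /ms !mulrDl expRD cosD; ring.
have HIm : `|Ip (fun x => expR ((a + h1) * x) * sin ((b + h2) * x)) - Ip (fun x => expR (a * x) * sin (b * x))
    - (h1 * M ms + h2 * M mc)| <= K * normc h ^+ 2.
  rewrite /M Ip_lin; [|exact: Jtrig|exact: Jtrig|exact: (J1 a ms (msin b) (s1 b))|exact: (J1 a mc (mcos b) (c1 b))].
  apply: (rem _ (fun x => sin (b * x)) (fun x => cos (b * x))) => //.
  - apply: measurable_funD; first exact: measurable_funM.
    apply: measurable_funD; first by apply: measurable_funM => //; exact: measurable_funM.
    by apply: measurable_funD; apply: measurable_funM => //; apply: measurable_funM => //; exact: measurable_funM.
  - by move=> x; rewrite /mc /ms !mulrDl expRD sinD; ring.
apply: le_trans (normc_le_ReIm _) _.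
apply: (@le_trans _ _ (K * normc h ^+ 2 + K * normc h ^+ 2)).
  apply: lerD; [apply: le_trans HRe|apply: le_trans HIm].
    rewrite le_eqVlt; apply/orP; left; apply/eqP; congr `|_|.
    by rewrite /laplace/= /Ip; ring.
  rewrite le_eqVlt; apply/orP; left; apply/eqP; congr `|_|.
  by rewrite /laplace/= /Ip; ring.
have n0 := normc_ge0 h; move: hle; rewrite ltr_pdivlMr; last by rewrite ltr_wpDl// mulr_ge0.
move=> /ltW hle.
have := ler_wpM2l n0 hle; rewrite expr2 => H; move: H; move: (normc h) n0 => n n0.
have := sqr_ge0 n; nra.
Qed.

End LaplaceTransform.

(** * Probabilities with a density *)

Section DensityProbability.
Variable R : realType.
Local Notation mu := (@lebesgue_measure R).
Variable p : R -> R.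
Hypothesis mp : measurable_fun [set: R] p.
Hypothesis p0 : forall x, 0 <= p x.
Hypothesis p1 : (\int[mu]_x (p x)%:E = 1)%E.

Definition density_prob (V : set (measurableTypeR R)) : \bar R := (\int[mu]_(x in V) (p x)%:E)%E.

Let density_prob0 : density_prob set0 = 0%E.
Proof. by rewrite /density_prob integral_set0. Qed.

Let density_prob_ge0 A : (0 <= density_prob A)%E.
Proof. by apply: integral_ge0 => x _; rewrite lee_fin. Qed.

Let density_prob_sigma_additive : semi_sigma_additive density_prob.
Proof.
move=> /= F mF tF mUF; rewrite /density_prob; apply: cvg_toP.
  apply: ereal_nondecreasing_is_cvgn => m n mn.
  apply: lee_sum_nneg_natr => // k _ _; apply: integral_ge0 => /= x Fkx.
  by rewrite lee_fin.
rewrite ge0_integral_bigcup//=.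
- by apply/measurable_EFinP/measurable_funTS; exact: mp.
- by move=> x _; rewrite lee_fin.
Qed.

HB.instance Definition _ := isMeasure.Build _ _ _
  density_prob density_prob0 density_prob_ge0 density_prob_sigma_additive.

Let density_prob_setT : density_prob setT = 1%E. Proof. exact: p1. Qed.

HB.instance Definition _ := @Measure_isProbability.Build _ _ R density_prob density_prob_setT.

Definition density_probability : probability (measurableTypeR R) R := density_prob.

Import HBNNSimple.
Local Open Scope ereal_scope.

Let integral_density_indic (E : set (measurableTypeR R)) : measurable E ->
  \int[density_probability]_x (\1_E x)%:E = \int[mu]_x ((\1_E x)%:E * (p x)%:E).
Proof.
move=> mE; rewrite integral_indic//= setIT /density_prob integral_mkcond/=.
apply: eq_integral => x _; rewrite patchE indicE.
by case: ifPn => xE; rewrite ?mul1e ?mul0e.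
Qed.

Let mEp : measurable_fun [set: measurableTypeR R] (fun x => (p x)%:E).
Proof. exact/measurable_EFinP. Qed.

Let integral_density_nnsfun (f : {nnsfun (measurableTypeR R) >-> R}) :
  \int[density_probability]_x (f x)%:E = \int[mu]_x ((f x)%:E * (p x)%:E).
Proof.
under [LHS]eq_integral do rewrite fimfunE -fsumEFin//.
rewrite [LHS]ge0_integral_fsum//; last 2 first.
- by move=> r; exact/measurable_EFinP/measurableT_comp.
- by move=> n x _; rewrite EFinM nnfun_muleindic_ge0.
under [RHS]eq_integral.
  move=> x xD; rewrite fimfunE -fsumEFin// ge0_mule_fsuml; last first.
    by move=> r; rewrite EFinM nnfun_muleindic_ge0.
  over.
rewrite [RHS]ge0_integral_fsum//; last 2 first.
- move=> r; apply: emeasurable_funM => //.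
  exact/measurable_EFinP/measurableT_comp.
- move=> n x _; rewrite EFinM mule_ge0 ?lee_fin//; exact: nnfun_muleindic_ge0.
apply: eq_fsbigr => r rf.
rewrite integralZl_indic_nnsfun//= integral_density_indic//.
under [RHS]eq_integral do rewrite EFinM -muleA.
case/set_mem : rf => y _ <-.
rewrite ge0_integralZl ?lee_fin//.
- by apply: emeasurable_funM => //; exact/measurable_EFinP/measurable_indic.
- by move=> x _; rewrite mule_ge0 ?lee_fin.
Qed.

Lemma ge0_integral_density (f : R -> R) : measurable_fun [set: measurableTypeR R] f ->
  (forall x, (0 <= f x)%R) ->
  \int[density_probability]_x (f x)%:E = \int[mu]_x (f x * p x)%:E.
Proof.
move=> mf f0; have mEf : measurable_fun [set: measurableTypeR R] (EFin \o f) by exact/measurable_EFinP.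
pose f_ := nnsfun_approx measurableT mEf.
have cf x : (f_ n x)%:E @[n --> \oo] --> (f x)%:E.
  by have := @cvg_nnsfun_approx _ _ _ _ measurableT _ mEf _ x Logic.I; apply => y _; rewrite lee_fin.
transitivity (lim (\int[density_probability]_x (f_ n x)%:E @[n --> \oo])).
  rewrite -monotone_convergence//=.
  - by apply: eq_integral => x _; apply/esym/cvg_lim => //; exact: cf.
  - by move=> n; exact/measurable_EFinP/measurable_funTS.
  - by move=> n ? _; rewrite lee_fin.
  - by move=> ? _ ? ? mn; rewrite lee_fin; exact/lefP/nd_nnsfun_approx.
transitivity (lim (\int[mu]_x ((f_ n x)%:E * (p x)%:E) @[n --> \oo])).
  by apply: congr_lim; apply/funext => n /=; exact: integral_density_nnsfun.
rewrite -monotone_convergence//=.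
- apply: eq_integral => x _; rewrite EFinM; apply/cvg_lim => //.
  by apply: cvgeZr => //; exact: cf.
- by move=> n; apply: emeasurable_funM => //; exact/measurable_EFinP/measurable_funTS.
- by move=> n x _; rewrite mule_ge0 ?lee_fin.
- move=> x _ a b ab; apply: lee_wpmul2r; first by rewrite lee_fin.
  by rewrite lee_fin; exact/lefP/nd_nnsfun_approx.
Qed.

(** Since p >= 0, multiplication by p commutes with taking positive and negative parts, which
    reduces to the nonnegative case. *)
Lemma integral_density (f : R -> R) : measurable_fun [set: measurableTypeR R] f ->
  \int[density_probability]_x (f x)%:E = \int[mu]_x (f x * p x)%:E.
Proof.
move=> mf; rewrite integralE [RHS]integralE; congr (_ - _).
- transitivity (\int[density_probability]_x (Num.max (f x) 0)%:E).
    by apply: eq_integral => x _; rewrite funeposE EFin_max.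
  rewrite ge0_integral_density; first last.
  + by move=> x; rewrite le_max lexx orbT.
  + exact: measurable_maxr.
  by apply: eq_integral => x _; rewrite funeposE -EFin_max -[in RHS](mul0r (p x)) -maxr_pMl.
- transitivity (\int[density_probability]_x (Num.max (- f x) 0)%R%:E).
    by apply: eq_integral => x _; rewrite funenegE EFin_max.
  rewrite ge0_integral_density; first last.
  + by move=> x; rewrite le_max lexx orbT.
  + by apply: measurable_maxr => //; exact: measurableT_comp.
  apply: eq_integral => x _.
  by rewrite funenegE -EFinN -EFin_max -[in RHS](mul0r (p x)) -mulNr -maxr_pMl.
Qed.

Lemma Rintegral_density (f : R -> R) : measurable_fun [set: measurableTypeR R] f ->
  (\int[density_probability]_x f x = \int[mu]_x (f x * p x))%R.
Proof. by move=> mf; rewrite /Rintegral integral_density. Qed.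

Lemma integrable_density (f : R -> R) : measurable_fun [set: measurableTypeR R] f ->
  (forall x, (0 <= f x)%R) -> \int[mu]_x (f x * p x)%:E < +oo ->
  density_probability.-integrable setT (EFin \o f).
Proof.
move=> mf f0 fo; apply/integrableP; split; first exact/measurable_EFinP.
under eq_integral => x _ do rewrite /= ger0_norm//.
by rewrite ge0_integral_density.
Qed.

End DensityProbability.

(** * Differences and rescalings of differentiable functions *)

Section EntireFunctions.
Variable R : realType.
Local Notation C := R[i].

Lemma cdiffB (f g : C -> C) (z l m : C) : cdiff f z l -> cdiff g z m ->
  cdiff (fun s => f s - g s) z (l - m).
Proof.
move=> df dg e e0; have e2 : 0 < e / 2 by rewrite divr_gt0.
have [d1 d10 h1] := df _ e2; have [d2 d20 h2] := dg _ e2.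
exists (Num.min d1 d2); first by rewrite lt_min d10.
move=> h; rewrite lt_min => /andP[/h1 H1 /h2 H2].
have -> : f (z + h) - g (z + h) - (f z - g z) - (l - m) * h =
  (f (z + h) - f z - l * h) + - (g (z + h) - g z - m * h) by ring.
apply: le_trans (le_normcD _ _) _; rewrite normcN.
have := lerD H1 H2; lra.
Qed.

Lemma cdiff_scale (f : C -> C) (c z l : C) : cdiff f (c * z) l ->
  cdiff (fun s => f (c * s)) z (l * c).
Proof.
move=> df e e0; have c0 := normc_ge0 c.
have c1 : 0 < normc c + 1 by rewrite ltr_wpDl.
have [d d0 Hd] := df _ (divr_gt0 e0 c1); exists (d / (normc c + 1)); first by rewrite divr_gt0.
move=> h; rewrite ltr_pdivlMr// => hd; have h0 := normc_ge0 h.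
have : normc (c * h) < d by apply: le_lt_trans hd; rewrite normcM; lra.
move=> /Hd; rewrite mulrDr [l * c * h]mulrAC -[l * h * c]mulrA [h * c]mulrC => H.
apply: le_trans H _; rewrite normcM mulrAC ler_pdivrMr//.
have := mulr_ge0 (ltW e0) h0; lra.
Qed.

End EntireFunctions.

(** * The density of each of the three fields *)

Section ThetaOfField.
Variables (R : realType) (K : qfield).
Local Notation mu := (@lebesgue_measure R).

Let D := abs_discr R K.
Let r (k : nat) : R := (rep_count R K k)%:R.
Let w := theta_weight R K.
(** Rescaling the theta variable by sqrt|D| turns the inversion v -> 1 / (|D| v) into x -> -x. *)
Let lam : R := theta_rate R K / Num.sqrt D.

Lemma abs_discr_gt0 : 0 < abs_discr R K. Proof. by case: K. Qed.
Lemma theta_weight_gt0 : 0 < theta_weight R K. Proof. by case: K => //=; rewrite divr_gt0. Qed.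
Lemma theta_weightE : theta_weight R K = (norm_exponent K)%:R^-1.
Proof. by case: K; rewrite /= ?div1r ?invr1. Qed.
Lemma abs_discrE : abs_discr R K = `|discr K|%:~R.
Proof. by case: K. Qed.

Let sD : 0 < Num.sqrt D. Proof. by rewrite sqrtr_gt0 abs_discr_gt0. Qed.

Lemma theta_rate_gt : 1 + w < lam.
Proof.
rewrite /lam ltr_pdivlMr// /w /D; case: K => /=.
- by rewrite sqrtr1; have := @pi_ge2 R; lra.
- have p2 := @pi_ge2 R.
  have := cos_ge1B (pi / 2 : R); rewrite cos_pihalf.
  rewrite (_ : 4 = 2 ^+ 2 :> R); last by ring.
  by rewrite sqrtr_sqr ger0_norm//; nra.
- have p2 := @pi_ge2 R.
  (* The tightest case. The bound cos x >= 1 - x^2 / 2 at x = pi / 4, where cos^2 x = 1/2 < 9/16,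
     gives pi^2 > 8. *)
  have s2 : Num.sqrt 8 < pi :> R.
    rewrite -[ltRHS]ger0_norm ?pi_ge0// -sqrtr_sqr ltr_sqrt ?exprn_gt0 ?pi_gt0//.
    have := cos_ge1B (pi / 4 : R).
    have cs : cos (pi / 4) < 3 / 4 :> R.
      have c2 : cos (pi / 4) ^+ 2 = 2^-1 :> R.
        have := cosD (pi / 4 : R) (pi / 4); rewrite (_ : pi / 4 + pi / 4 = pi / 2 :> R); last by field.
        rewrite cos_pihalf; have := cos2Dsin2 (pi / 4 : R); lra.
      nra.
    move: cs; lra.
  by lra.
Qed.

Let exponentE (k : nat) (u : R) : theta_rate R K * k%:R * (u / Num.sqrt D) = lam * k%:R * u.
Proof. by rewrite /lam; ring. Qed.

Let theta_cvg (u : R) : 0 < u -> cvgn (series (eterm lam r u)) /\ eser lam r u = thetaK K (u / Num.sqrt D).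
Proof.
move=> u0; have v0 : 0 < u / Num.sqrt D by rewrite divr_gt0.
have := theta_series K v0.
under eq_eseriesr do rewrite exponentE.
rewrite -/(eterm lam r u) => H.
have cv : cvgn (series (eterm lam r u)).
  apply: nneseries_fin_cvg; first by move=> k; rewrite mulr_ge0 ?expR_ge0.
  by rewrite H ltry.
by split => //; move: H; rewrite nneseries_EFin// => -[].
Qed.

Lemma theta_ecvg : ecvg lam r.
Proof. by split=> [k|u u0]; [exact: ler0n|case: (theta_cvg u0)]. Qed.

Lemma theta_funeq (x : R) : eser lam r (expR (- x)) = expR (w * x) * eser lam r (expR x).
Proof.
have [_ ->] := theta_cvg (expR_gt0 (- x)); have [_ ->] := theta_cvg (expR_gt0 x).
have v0 : 0 < expR x / Num.sqrt D by rewrite divr_gt0// expR_gt0.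
have := theta_inv K v0.
have -> : (abs_discr R K * (expR x / Num.sqrt D))^-1 = expR (- x) / Num.sqrt D.
  have DD : abs_discr R K = Num.sqrt D * Num.sqrt D by rewrite -expr2 sqr_sqrtr// ltW// abs_discr_gt0.
  by rewrite {1}DD expRN; field; rewrite !gt_eqF// expR_gt0.
have -> : Num.sqrt (abs_discr R K) * (expR x / Num.sqrt D) = expR x by rewrite mulrC divfK// gt_eqF.
by rewrite {1}/powR gt_eqF ?expR_gt0// expRK.
Qed.

Lemma dirichlet_rep_fin (s : R) : w < s ->
  (\sum_(k <oo) (if k is 0%N then 0 else r k * powR k%:R (- s))%R%:E < +oo)%E.
Proof.
move=> ws; have k0 : 0 < (norm_exponent K)%:R :> R by rewrite ltr0n norm_exponent_gt0.
have s1 : 1 < s * (norm_exponent K)%:R by move: ws; rewrite /w theta_weightE -div1r ltr_pdivrMr.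
by have := zeta_series K s1; rewrite mulfK ?gt_eqF// => ->; rewrite ltry.
Qed.

Let rep_at0 : r 0 = 1. Proof. by rewrite /r rep_count0. Qed.

Definition xi_density : R -> R := theta_density lam w r.

Lemma xi_density_ge0 x : 0 <= xi_density x.
Proof. exact: (theta_density_ge0 theta_ecvg theta_weight_gt0 theta_rate_gt theta_funeq). Qed.

Lemma xi_density_measurable : measurable_fun [set: R] xi_density.
Proof. apply: continuous_measurable_fun; exact: (theta_density_continuous theta_ecvg theta_weight_gt0 theta_rate_gt). Qed.

Lemma xi_density_moment (a : R) : (\int[mu]_x (expR (a * x)%R * xi_density x)%:E < +oo)%E.
Proof. exact: (theta_density_moment theta_ecvg theta_weight_gt0 theta_rate_gt theta_funeq dirichlet_rep_fin). Qed.

Lemma xi_density_mass : (\int[mu]_x (xi_density x)%:E = 1)%E.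
Proof. exact: (theta_density_mass theta_ecvg rep_at0 theta_weight_gt0 theta_rate_gt theta_funeq dirichlet_rep_fin). Qed.

Lemma xi_density_mellin (s : R) : 1 < s ->
  (\int[mu]_x (expR (s / (norm_exponent K)%:R * x)%R * xi_density x)%:E = (xi_real K s)%:E)%E.
Proof.
move=> s1; have k0 : 0 < (norm_exponent K)%:R :> R by rewrite ltr0n norm_exponent_gt0.
have ws : w < s / (norm_exponent K)%:R by rewrite /w theta_weightE ltr_pdivlMr// mulVf// gt_eqF.
rewrite (theta_density_mellin theta_ecvg theta_weight_gt0 theta_rate_gt ws (zeta_series K s1)); congr EFin.
have pi0 := @pi_gt0 R; have p0 := ltW pi0.
rewrite /xi_real /lam /w /D /cK /GammaR /GammaC /regulator /class_number.
(* The computation common to both imaginary quadratic fields: d is |D|, n the number of roots of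
   unity and 2 pi / n the constant [cK]. *)
have quad (d n z : R) : 0 < d -> 0 < n ->
    s * (s - 1) * Gamma s * powR (2 * pi / Num.sqrt d) (- s) * (n * z) =
    (2 * pi / n)^-1 * s * (s - 1) * powR d (s / 2) * (powR (2 * pi) (1 - s) * Gamma s) * z.
  move=> d0 n0; have q0 : 0 < 2 * pi :> R by rewrite mulr_gt0.
  rewrite powRM ?invr_ge0 ?sqrtr_ge0 ?(ltW q0)//.
  rewrite -powR12_sqrt ?(ltW d0)// -powRN -powRrM.
  rewrite (_ : - 2^-1 * - s = s / 2); last by ring.
  rewrite powRB ?(gt_eqF q0) ?implybT// powRr1 ?(ltW q0)// powRN.
  have e0 : powR (2 * pi) s != 0 :> R by rewrite gt_eqF// powR_gt0.
  move: (powR (2 * pi) s) e0 (Gamma s) (powR d _) => e e0 g t.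
  by move: (2 * pi) q0 => q q0; field; rewrite e0 !gt_eqF.
case: K => /=.
- rewrite sqrtr1 divr1 normr1 mulr1z powR1 mulNr expr1 !expr0.
  by move: (Gamma _) (powR pi _) (dedekind_zeta _ _) => g q z; field.
- by rewrite !divr1 invr1 mul1r !expr0 !expr1 !mulr1 mul1r quad.
- by rewrite !divr1 invr1 mul1r !expr0 !expr1 !mulr1 mul1r quad.
Qed.

Lemma xi_laplace (xi : R[i] -> R[i]) : entire xi ->
  (forall s : R, 1 < s -> xi s%:C = (xi_real K s)%:C) ->
  forall s, xi s = laplace xi_density ((norm_exponent K)%:R^-1%:C * s).
Proof.
move=> exi xis s; apply/eqP; rewrite -subr_eq0; apply/eqP.
apply: (@identity_theorem R (fun s => xi s - laplace xi_density ((norm_exponent K)%:R^-1%:C * s))) => [|t t1].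
  apply/entire_cdiff => z; have /entire_cdiff/(_ z)[l dl] := exi.
  have /entire_cdiff/(_ ((norm_exponent K)%:R^-1%:C * z))[m dm] :=
    laplace_entire xi_density_measurable xi_density_ge0 xi_density_moment.
  by exists (l - m * (norm_exponent K)%:R^-1%:C); apply: cdiffB => //; exact: cdiff_scale.
rewrite xis// (_ : (norm_exponent K)%:R^-1%:C * t%:C = (t / (norm_exponent K)%:R)%:C); last by rewrite -rmorphM mulrC.
rewrite /laplace/=.
have -> : \int[mu]_x (expR (t / (norm_exponent K)%:R * x) * cos (0 * x) * xi_density x) = xi_real K t.
  transitivity (fine (xi_real K t)%:E) => //; rewrite -xi_density_mellin//.
  by congr fine; apply: eq_integral => x _; rewrite mul0r cos0 mulr1.
have -> : \int[mu]_x (expR (t / (norm_exponent K)%:R * x) * sin (0 * x) * xi_density x) = 0.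
  transitivity (fine (\int[mu]_x (0 : \bar R))%E); last by rewrite integral0.
  by congr fine; apply: eq_integral => x _; rewrite mul0r sin0 mulr0 mul0r.
exact: subrr.
Qed.

End ThetaOfField.

Theorem theorem1p1 (R : realType) (K : qfield) (xi : R[i] -> R[i]) :
  entire xi ->
  (forall s : R, 1 < s -> xi s%:C = (xi_real K s)%:C) ->
  exists (d : measure_display) (T : measurableType d)
         (P : probability T R) (X : T -> R),
    [/\ measurable_fun setT X,
        (forall t, 0 < X t) &
        forall s : R[i],
          P.-integrable setT (fun t => (powR (X t) (complex.Re s))%:E) /\
          cexpect P (fun t => cpow (X t) s)
            = cpow (`|discr K|%:~R) (- s / 2%:R) * xi s].
Proof.
move=> exi xis.
(* 1 / k equals the weight w by [theta_weightE], and e^(-d) is |D|^(-1/2). *)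
pose k : R := (norm_exponent K)%:R; pose d : R := ln (abs_discr R K) / 2.
pose X (x : measurableTypeR R) : R := expR (k^-1 * x - d).
have mX : measurable_fun setT X.
  apply: continuous_measurable_fun => x; apply: continuous_comp; last exact: continuous_expR.
  by apply: cvgB; [exact: mulrl_continuous|exact: cvg_cst].
have mp := @xi_density_measurable R K; have p0 := @xi_density_ge0 R K.
have mom := @xi_density_moment R K.
exists _, (measurableTypeR R), (density_probability mp p0 (@xi_density_mass R K)), X.
split => // [t|s]; first exact: expR_gt0.
have powX (a x : R) : powR (X x) a = expR (- (a * d)) * expR (k^-1 * a * x).
  by rewrite /powR gt_eqF ?expR_gt0// expRK -expRD; congr expR; rewrite /X; ring.
have mpowX (a : R) : measurable_fun [set: measurableTypeR R] (fun x => powR (X x) a).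
  under eq_fun do rewrite powX.
  apply: continuous_measurable_fun => x; apply: cvgM; first exact: cvg_cst.
  by apply: continuous_comp; [exact: mulrl_continuous|exact: continuous_expR].
split.
  apply: integrable_density => //; first by move=> x; exact: powR_ge0.
  under eq_integral do rewrite powX -mulrA EFinM.
  rewrite ge0_integralZl//; first exact: lte_mul_pinfty.
  - apply/measurable_EFinP; apply: measurable_funM => //.
    apply: continuous_measurable_fun => x.
    by apply: continuous_comp; [exact: mulrl_continuous|exact: continuous_expR].
  - by move=> x _; rewrite lee_fin mulr_ge0 ?expR_ge0.
rewrite (xi_laplace exi xis) -abs_discrE.
set a := complex.Re s; set b := complex.Im s; set z := k^-1%:C * s.
have za : complex.Re z = k^-1 * a by rewrite /z /a; case: (s) => ? ? /=; rewrite mul0r subr0.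
have zb : complex.Im z = k^-1 * b by rewrite /z /b; case: (s) => ? ? /=; rewrite mul0r addr0.
(* The argument of X^s is that of e^(z x) shifted by the constant b d, the form required by
   [laplace_cosB] and [laplace_sinB]. *)
have lnX (x : R) : b * ln (X x) = complex.Im z * x - b * d by rewrite expRK zb; ring.
have cE (x : R) : complex.Re (cpow (X x) s) =
    expR (- (a * d)) * (expR (complex.Re z * x) * cos (complex.Im z * x - b * d)).
  by rewrite /= -lnX powX za -/a -/b; ring.
have sE (x : R) : complex.Im (cpow (X x) s) =
    expR (- (a * d)) * (expR (complex.Re z * x) * sin (complex.Im z * x - b * d)).
  by rewrite /= -lnX powX za -/a -/b; ring.
have mtrig (g : R -> R) : continuous g -> measurable_fun [set: measurableTypeR R]
    (fun x => expR (- (a * d)) * (expR (complex.Re z * x) * g (complex.Im z * x - b * d))).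
  move=> cg; apply: measurable_funM => //; apply: measurable_funM; apply: continuous_measurable_fun => x.
    by apply: continuous_comp; [exact: mulrl_continuous|exact: continuous_expR].
  apply: continuous_comp; last exact: cg.
  by apply: cvgB; [exact: mulrl_continuous|exact: cvg_cst].
have ERe : \int[density_probability mp p0 (@xi_density_mass R K)]_x complex.Re (cpow (X x) s) =
   expR (- (a * d)) * cos (b * d) * complex.Re (laplace (xi_density K) z)
   + expR (- (a * d)) * sin (b * d) * complex.Im (laplace (xi_density K) z).
  rewrite -laplace_cosB//.
  have := Rintegral_density mp p0 (@xi_density_mass R K) (mtrig _ (@continuous_cos R)) => <-.
  by apply: eq_Rintegral => x _; exact: cE.
have EIm : \int[density_probability mp p0 (@xi_density_mass R K)]_x complex.Im (cpow (X x) s) =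
   expR (- (a * d)) * cos (b * d) * complex.Im (laplace (xi_density K) z)
   - expR (- (a * d)) * sin (b * d) * complex.Re (laplace (xi_density K) z).
  rewrite -laplace_sinB//.
  have := Rintegral_density mp p0 (@xi_density_mass R K) (mtrig _ (@continuous_sin R)) => <-.
  by apply: eq_Rintegral => x _; exact: sE.
have D0 := abs_discr_gt0 R K.
have -> : cpow (abs_discr R K) (- s / 2%:R) = (expR (- (a * d)) * cos (b * d)) +i* (- (expR (- (a * d)) * sin (b * d))).
  have -> : - s / 2%:R = (- (a / 2)) +i* (- (b / 2)).
    have -> : - s / 2%:R = - s * (2^-1 : R)%:C by rewrite fmorphV rmorph_nat.
    rewrite /a /b; case: (s) => u v; apply/eqP; rewrite eq_complex/=.
    by apply/andP; split; apply/eqP; ring.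
  rewrite /cpow /powR (gt_eqF D0)/=.
  rewrite (_ : - (a / 2) * ln (abs_discr R K) = - (a * d)); last by rewrite /d; ring.
  rewrite (_ : - (b / 2) * ln (abs_discr R K) = - (b * d)); last by rewrite /d; ring.
  rewrite cosN sinN; apply/eqP; rewrite eq_complex/=; apply/andP; split; apply/eqP; ring.
rewrite /cexpect ERe EIm; case: (laplace _ z) => u v.
by apply/eqP; rewrite eq_complex/=; apply/andP; split; apply/eqP; ring.
Qed.
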